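(* Let $r\geqslant3$. The classes $\widehat{\mathcal L}$, $\widehat{\mathcal L}_1$, $\widehat{\mathcal L}_2$, $\mathcal A_1$, $\widehat{\mathcal A}_1$, $\mathcal A_2$ and $\widehat{\mathcal A}_2$ of $r$th order linear ODEs are normalized in the generalized extended sense. The corresponding generalized extended equivalence groups are related to the reparameterization based on fundamental sets of solutions, i.e., they are the generalized equivalence groups of the reparameterized classes whose arbitrary elements are $(\chi_1,\dots,\chi_r,b)$ with $\{\chi_1,\dots,\chi_r\}$ a fundamental set of solutions of the associated homogeneous equation.
   Context: The underlying field $\mathbb F$ is $\mathbb R$ or $\mathbb C$; everything is smooth and local (considered on suitable open domains). $x=x(t)$ is the unknown function, $x^{(k)}=d^kx/dt^k$. Classes. $\mathcal L$: equations $x^{(r)}+a_{r-1}(t)x^{(r-1)}+\dots+a_1(t)x^{(1)}+a_0(t)x=b(t)$ with arbitrary smooth $a_i,b$. $\mathcal L_1$: $a_{r-1}=0$. $\mathcal L_2$: $a_{r-1}=a_{r-2}=0$. $\mathcal A_1$: $a_0=0$. $\mathcal A_2$: $a_0=a_1=0$. A hat denotes the subclass of homogeneous equations ($b=0$). Reparameterization. Replace the arbitrary elements $a_0,\dots,a_{r-1},b$ by $\chi_1,\dots,\chi_r,b$, functions of $t$ only, where $\chi_1,\dots,\chi_r$ is a fundamental set of solutions of the homogeneous equation corresponding to the equation; thus the Wronskian satisfies $W(\chi_1,\dots,\chi_r)\ne0$ and the equation is written as $W(\chi_1,\dots,\chi_r,x)/W(\chi_1,\dots,\chi_r)=b$.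 (This amounts to passing to a covering of the system of constraints for the original arbitrary elements; different tuples $(\chi_1,\dots,\chi_r)$ related by constant nonsingular linear combining give the same equation.) The reparameterized subclasses are singled out by the following additional constraints, where $D_n=\det(\partial^m\chi_j/\partial t^m)$ with $j=1,\dots,r$ and $m$ running through $\{0,\dots,r\}\setminus\{n\}$: $\widehat{\mathcal L}$: $b=0$; $\widehat{\mathcal L}_1$: $D_{r-1}=0$, $b=0$; $\widehat{\mathcal L}_2$: $D_{r-1}=D_{r-2}=0$, $b=0$; $\mathcal A_1$: $\chi_1=1$; $\widehat{\mathcal A}_1$: $\chi_1=1$, $b=0$; $\mathcal A_2$: $\chi_1=1$, $\chi_2=t$; $\widehat{\mathcal A}_2$: $\chi_1=1$, $\chi_2=t$, $b=0$. Generalized equivalence group. For a reparameterized class it consists of the transformations of $t$, $x$, the derivatives of $x$ and the arbitrary elements (where derivatives of the $\chi_i$ up to order $r$ are also regarded as arbitrary elements) that are consistent with the contact structure, are point transformations with respect to $(t,x)$ whenever the arbitrary elements are fixed, and map every equation of the class (with its tuple of arbitrary elements) to an equation of the class; in contrast to usual equivalence transformations, the components for $t$ and $x$ are allowed to depend on arbitrary elements. An admissible transformation of a class is a triple consisting of a source equation and a target equation of the class (given by tuples of arbitrary elements) and a point transformation $\tilde t=T(t,x)$, $\tilde x=X(t,x)$ with nonvanishing Jacobian mapping the source to the target. The equivalence groupoid of the class is the set of all its admissible transformations. A class is normalized in the generalized sense if each of its admissible transformations is obtained from an element of its generalized equivalence group by substituting the source tuple of arbitrary elements. A class is said to be normalized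 in the generalized extended sense if its counterpart obtained by replacing the system of constraints for arbitrary elements by a covering (here, the reparameterization replacing the arbitrary elements $a_0,\dots,a_{r-1},b$ by $\chi_1,\dots,\chi_r,b$, where $\chi_1,\dots,\chi_r$ is a fundamental set of solutions of the homogeneous equation corresponding to the equation, together with the additional constraints on $\chi_1,\dots,\chi_r,b$ that single out the reparameterized subclass) is normalized in the generalized sense; the generalized equivalence group of this counterpart, generating its entire equivalence groupoid, is then called the generalized extended equivalence group of the initial class. *)

(* Defs.v *)
From HB Require Import structures.
From mathcomp Require Import all_boot all_order all_algebra.
From mathcomp Require Import boolp classical_sets reals topology normedtype.
From mathcomp Require Import derive.
Set Implicit Arguments.
Unset Strict Implicit.
Unset Printing Implicit Defensive.
Import Order.TTheory GRing.Theory Num.Theory numFieldNormedType.Exports.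
Local Open Scope classical_set_scope.
Local Open Scope ring_scope.

(* [ndiff_on n U f] is n-fold Frechet differentiability over the base field F, so
   [smooth_on] means C^oo for real F and holomorphic for complex F. *)
Section Smooth.
Context {F : numFieldType} {V W : normedModType F}.

Fixpoint ndiff_on (n : nat) (U : set V) (f : V -> W) : Prop :=
  if n is n'.+1 then
    (forall p, U p -> differentiable f p) /\
    (forall v, ndiff_on n' U (fun p => 'D_v f p))
  else True.

Definition smooth_on (U : set V) (f : V -> W) : Prop := forall n, ndiff_on n U f.

End Smooth.

Section LinearODE.
Variables (F : numFieldType) (r : nat).

(* Functions of t are total functions F -> F; only their restrictions to the
   open set carried by the record are meaningful. *)

(* x^(r) + a_(r-1) x^(r-1) + ... + a_0 x = b *)
Record lode := Lode {
  ldom : set F;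
  coef : 'I_r -> F -> F;
  lrhs : F -> F }.

Definition class_L (e : lode) : Prop :=
  [/\ open (ldom e), forall i, smooth_on (ldom e) (coef e i)
    & smooth_on (ldom e) (lrhs e)].

Definition coef_vanishes (k : nat) (e : lode) : Prop :=
  forall i : 'I_r, i = k :> nat -> forall t, ldom e t -> coef e i t = 0.

Definition homogeneous (e : lode) : Prop := forall t, ldom e t -> lrhs e t = 0.

(* [chi i] stands for chi_(i+1). *)
Record param := Param {
  pdom : set F;
  chi : 'I_r -> F -> F;
  rhs : F -> F }.

Definition wronskian (th : param) (t : F) : F :=
  \det (\matrix_(i < r, m < r) derive1n m (chi th i) t).

(* D_n: the derivative orders run through {0, ..., r} \ {n}. *)
Definition wronskian_minor (n : nat) (th : param) (t : F) : F :=
  \det (\matrix_(j < r, m < r) derive1n (bump n m) (chi th j) t).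

Definition solves_hom (e : lode) (y : F -> F) : Prop :=
  forall t, ldom e t ->
    derive1n r y t + \sum_(i < r) coef e i t * derive1n i y t = 0.

(* The domain is not required to be connected, so linear independence of the
   solutions is expressed by the nonvanishing of their Wronskian. *)
Definition fundamental_set (e : lode) (th : param) : Prop :=
  [/\ forall i, smooth_on (ldom e) (chi th i),
      forall i, solves_hom e (chi th i)
    & forall t, ldom e t -> wronskian th t != 0].

Definition reparameterizes (th : param) (e : lode) : Prop :=
  [/\ pdom th = ldom e, fundamental_set e th
    & forall t, ldom e t -> rhs th t = lrhs e t].

(* The counterpart, under the reparameterization by fundamental sets of
   solutions, of the class C, with the additional constraints K on the new
   arbitrary elements. *)
Definition counterpart (C : lode -> Prop) (K : param -> Prop)
    (th : param) : Prop :=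
  (exists2 e, C e & reparameterizes th e) /\ K th.

(* A point of the jet space: (t, (x, x^(1), ..., x^(r))). *)
Definition jet : Type := (F * 'rV[F]_r.+1)%type.

Definition jet_base (z : jet) : F * F := (z.1, z.2 ord0 ord0).

(* W(chi_1, ..., chi_r, x) as a function on the jet space *)
Definition wronskian_with (th : param) (z : jet) : F :=
  \det (\matrix_(i < r.+1, m < r.+1)
    if unlift ord_max i is Some k then derive1n m (chi th k) z.1
    else z.2 ord0 m).

Definition on_equation (th : param) (z : jet) : Prop :=
  wronskian_with th z / wronskian th z.1 = rhs th z.1.

(* D_t = d/dt + x^(1) d/dx + x^(2) d/dx^(1) + ... + x^(r) d/dx^(r-1); it is
   only applied to functions that do not depend on x^(r). *)
Definition total_deriv (g : jet -> F) (z : jet) : F :=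
  'D_((1, \row_(k < r.+1) if (k < r)%N then z.2 ord0 (inord k.+1) else 0) : jet)
    g z.

Definition total_deriv_T (phi : F * F -> F * F) (z : jet) : F :=
  total_deriv (fun w => (phi (jet_base w)).1) z.

Definition prolong_coord (phi : F * F -> F * F) (k : nat) : jet -> F :=
  iter k (fun g z => total_deriv g z / total_deriv_T phi z)
         (fun w => (phi (jet_base w)).2).

Definition prolong (phi : F * F -> F * F) (z : jet) : jet :=
  ((phi (jet_base z)).1, \row_(k < r.+1) prolong_coord phi k z).

Definition jac (phi : F * F -> F * F) (p : F * F) : F :=
  let T q := (phi q).1 in let X q := (phi q).2 in
  'D_((1, 0) : F * F) T p * 'D_((0, 1) : F * F) X p
  - 'D_((0, 1) : F * F) T p * 'D_((1, 0) : F * F) X p.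

(* Candidates for admissible transformations; [ptrans] is only meaningful on
   [pt_dom]. *)
Record arrow := Arrow {
  source : param;
  target : param;
  pt_dom : set (F * F);
  ptrans : F * F -> F * F }.

Definition prolongable (g : arrow) (z : jet) : Prop :=
  pt_dom g (jet_base z) /\ total_deriv_T (ptrans g) z != 0.

Definition arrow_of (S : param -> Prop) (g : arrow) : Prop :=
  [/\ S (source g) /\ S (target g),
      open (pt_dom g),
      forall p, pt_dom g p -> pdom (source g) p.1 /\
                              pdom (target g) (ptrans g p).1,
      smooth_on (pt_dom g) (ptrans g)
    & forall p, pt_dom g p -> jac (ptrans g) p != 0].

Definition equivalence_groupoid (S : param -> Prop) (g : arrow) : Prop :=
  arrow_of S g /\
  (forall z, prolongable g z ->
     (on_equation (source g) z <-> on_equation (target g) (prolong (ptrans g) z))).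

(* The space with coordinates t, x^(k), chi_i^(k) and b, where 0 <= k <= r. The
   derivatives of the chi_i are coordinates of their own, so the components of a
   transformation may depend on them. *)
Definition ext_space : Type := (jet * ('M[F]_(r, r.+1) * F))%type.

Definition lift_jet (th : param) (z : jet) : ext_space :=
  (z, (\matrix_(i < r, m < r.+1) derive1n m (chi th i) z.1, rhs th z.1)).

Record ext_trans := ExtTrans {
  et_dom : set ext_space;
  et_map : ext_space -> ext_space }.

Definition local_diffeo (Phi : ext_trans) : Prop :=
  [/\ open (et_dom Phi), smooth_on (et_dom Phi) (et_map Phi)
    & forall p, et_dom Phi p -> injective ('d (et_map Phi) p)].

Definition acts_as (Phi : ext_trans) (g : arrow) (z : jet) : Prop :=
  et_dom Phi (lift_jet (source g) z) /\
  et_map Phi (lift_jet (source g) z)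
    = lift_jet (target g) (prolong (ptrans g) z).

(* The transformations form a pseudogroup: they are defined on open sets and the
   image of an equation is required to be in the class locally. For each fixed
   tuple th of the class, near each point, the t- and x-components of Phi form
   a point transformation of (t, x), the components for the derivatives of x are
   its prolongation (consistency with the contact structure), and the remaining
   components are the values and derivatives of a tuple of the class whose
   equation is the image of the equation of th. *)
Definition generalized_equivalence_group (S : param -> Prop)
    (Phi : ext_trans) : Prop :=
  local_diffeo Phi /\
  (forall (th : param) (z0 : jet), S th -> pdom th z0.1 ->
     et_dom Phi (lift_jet th z0) ->
     exists g : arrow,
       [/\ equivalence_groupoid S g, source g = th
         & \forall z \near z0, prolongable g z /\ acts_as Phi g z]).

Definition obtained_from (Phi : ext_trans) (g : arrow) : Prop :=
  forall z, prolongable g z -> acts_as Phi g z.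

Definition normalized_generalized (S : param -> Prop) : Prop :=
  forall g, equivalence_groupoid S g ->
    exists2 Phi, generalized_equivalence_group S Phi & obtained_from Phi g.

Definition generates_groupoid (G : ext_trans -> Prop) (S : param -> Prop) : Prop :=
  forall g, equivalence_groupoid S g <->
    arrow_of S g /\ exists2 Phi, G Phi & obtained_from Phi g.

Definition normalized_generalized_extended (C : lode -> Prop)
    (K : param -> Prop) : Prop :=
  normalized_generalized (counterpart C K).

Definition generalized_extended_equivalence_group (C : lode -> Prop)
    (K : param -> Prop) : ext_trans -> Prop :=
  generalized_equivalence_group (counterpart C K).

Variant class_name := hatL | hatL1 | hatL2 | A1 | hatA1 | A2 | hatA2.

Definition initial_class (c : class_name) (e : lode) : Prop :=
  class_L e /\
  match c with
  | hatL => homogeneous e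
  | hatL1 => coef_vanishes r.-1 e /\ homogeneous e
  | hatL2 => [/\ coef_vanishes r.-1 e, coef_vanishes r.-2 e & homogeneous e]
  | A1 => coef_vanishes 0 e
  | hatA1 => coef_vanishes 0 e /\ homogeneous e
  | A2 => coef_vanishes 0 e /\ coef_vanishes 1 e
  | hatA2 => [/\ coef_vanishes 0 e, coef_vanishes 1 e & homogeneous e]
  end.

Definition rhs0 (th : param) : Prop := forall t, pdom th t -> rhs th t = 0.

Definition minor0 (n : nat) (th : param) : Prop :=
  forall t, pdom th t -> wronskian_minor n th t = 0.

Definition chi1_is_1 (th : param) : Prop :=
  forall i : 'I_r, i = 0%N :> nat -> forall t, pdom th t -> chi th i t = 1.

Definition chi2_is_t (th : param) : Prop :=
  forall i : 'I_r, i = 1%N :> nat -> forall t, pdom th t -> chi th i t = t.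

Definition constraints (c : class_name) (th : param) : Prop :=
  match c with
  | hatL => rhs0 th
  | hatL1 => minor0 r.-1 th /\ rhs0 th
  | hatL2 => [/\ minor0 r.-1 th, minor0 r.-2 th & rhs0 th]
  | A1 => chi1_is_1 th
  | hatA1 => chi1_is_1 th /\ rhs0 th
  | A2 => chi1_is_1 th /\ chi2_is_t th
  | hatA2 => [/\ chi1_is_1 th, chi2_is_t th & rhs0 th]
  end.

End LinearODE.

(* Main.v *)
Require Import Defs.
From HB Require Import structures.
From mathcomp Require Import all_boot all_order all_algebra.
From mathcomp Require Import boolp classical_sets reals topology normedtype.
From mathcomp Require Import functions landau derive complex ring lra zify.
Set Implicit Arguments.
Unset Strict Implicit.
Unset Printing Implicit Defensive.
Import Order.TTheory GRing.Theory Num.Theory numFieldNormedType.Exports.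
Local Open Scope classical_set_scope.
Local Open Scope ring_scope.

(* Let [alpha] be the vector (a_0, ..., a_(r-1), 1) of coefficients attached to a
   tuple [chi]. Along the solutions of the source equation with D_t T = 0 the
   prolonged derivatives of an admissible transformation would have poles of
   strictly increasing order unless T_x = 0, and a second difference in
   (x^(1), x^(r-1)) of the transformed equation gives X_xx = 0, so that
   t~ = T(t), x~ = X1(t) (x + xi(t)). Prolongation is then right multiplication
   of the jets by a triangular matrix Q(t), and comparing the equations as
   hyperplanes yields Q alpha~ = lambda alpha with lambda = X1 / T'^r. Hence the
   functions chi~_i(T) / X1 solve the source equation, that is,
   chi~_i(T) = X1 sum_j C_ij chi_j with C locally constant; in the homogeneous
   classes also xi = sum_j c_j chi_j. The constraints chi_1 = 1 and chi_2 = t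
   express X1 = 1 / sum_j C_1j chi_j and T = X1 sum_j C_2j chi_j, while those on
   a_(r-1), a_(r-2) only involve T and X1. So all components can be written as
   functions of t, x and the chi_j with C, c fixed; replacing d/dt by the
   derivation t + shift on the extended jet space turns them into one map that
   acts on every equation of the class. This map is a local diffeomorphism: in
   a kernel vector the components vanish order by order. *)

(** * Calculus of smooth functions *)

(** An arrow is given between two particular equations, whereas an equivalence transformation has to
    act on all equations of the class. So the arrow is split into what belongs to its source tuple
    and what can be kept for every other tuple: the constants, and those functions of t that the
    constraints leave free. In the classes A1 and A2 the same constants give another X1 (and T) for
    another tuple, which is why the t- and x-components depend on chi. Domains are arbitrary open
    sets, and neither they nor their fibres over t need be connected; hence C and c are functions on
    the domain that are constant only near each point, and every integration takes place in a box.
    The map must moreover be a local diffeomorphism at points of the extended jet space that are not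
    lifts of tuples, where no constraint holds; this dictates the components for the prescribed
    chi_i and for b. The order of the complex field is partial, so the mean value inequality and the
    inverse function theorem are derived from a completeness property that both fields share. The
    bound r >= 3 makes x^(2) differ from x^(r), and x^(1) from x^(r-1). *)

Section Calculus.
Context {F : numFieldType}.
Implicit Types V W E : normedModType F.

Lemma open_near V (U : set V) p : open U -> U p -> \forall q \near p, U q.
Proof. by move=> oU Up; apply: (@open_nbhs_nbhs _ p U); split. Qed.

(** Both difference quotients are the same function of the step, so the identity holds for any
    [f]. *)
Lemma derive_linpre V E W (L : {linear V -> E}) (f : E -> W) a v :
  'D_v (fun p => f (L p)) a = 'D_(L v) f (L a).
Proof.
rewrite /derive; set d := (fun _ : F => _); set d' := (fun _ : F => _).
suff -> : d = d' by [].
by rewrite funeqE => h; rewrite /d /d' /= linearP.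
Qed.

Lemma derivativeD V W (f g : V -> W) a v :
  differentiable f a -> differentiable g a ->
  'D_v (fun p => f p + g p) a = 'D_v f a + 'D_v g a.
Proof.
by move=> df dg; rewrite (deriveD (diff_derivable df) (diff_derivable dg)).
Qed.

Lemma derivativeB V W (f g : V -> W) a v :
  differentiable f a -> differentiable g a ->
  'D_v (fun p => f p - g p) a = 'D_v f a - 'D_v g a.
Proof.
by move=> df dg; rewrite (deriveB (diff_derivable df) (diff_derivable dg)).
Qed.

Lemma derivativeM V (f g : V -> F) a v :
  differentiable f a -> differentiable g a ->
  'D_v (fun p => f p * g p) a = f a * 'D_v g a + 'D_v f a * g a.
Proof.
move=> df dg; rewrite (deriveM (diff_derivable df) (diff_derivable dg)).
by rewrite /GRing.scale /= [g a * _]mulrC.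
Qed.

Lemma derivativeV V (f : V -> F) a v :
  differentiable f a -> f a != 0 ->
  'D_v (fun p => (f p)^-1) a = - (f a)^-1 ^+ 2 * 'D_v f a.
Proof.
by move=> df f0; rewrite (deriveV f0 (diff_derivable df)) -exprVn.
Qed.

Lemma derivativeC V W (c : W) a v : 'D_v (fun _ : V => c) a = 0.
Proof. exact: derive_cst. Qed.

Lemma derivative_comp1 V (f : F -> F) (g : V -> F) a v :
  differentiable g a -> differentiable f (g a) ->
  'D_v (fun p => f (g p)) a = derive1 f (g a) * 'D_v g a.
Proof.
move=> dg df; rewrite deriveE; last exact: differentiable_comp.
by rewrite (diff_comp dg df) /= diff1E //= mulrC deriveE.
Qed.

Lemma derivative_addv V W (f : V -> W) a u v : differentiable f a ->
  'D_(u + v) f a = 'D_u f a + 'D_v f a.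
Proof. by move=> df; rewrite !deriveE // linearD. Qed.

Lemma derivative_scalev V W (f : V -> W) a c v : differentiable f a ->
  'D_(c *: v) f a = c *: 'D_v f a.
Proof. by move=> df; rewrite !deriveE // linearZ. Qed.

Lemma derivative_sumv V W I (s : seq I) (P : pred I) (f : V -> W) a
    (v : I -> V) : differentiable f a ->
  'D_(\sum_(i <- s | P i) v i) f a = \sum_(i <- s | P i) 'D_(v i) f a.
Proof.
move=> df; rewrite deriveE // linear_sum; apply: eq_bigr => i _.
by rewrite deriveE.
Qed.

(** The differential of [f] serves for [g]: the two first-order expansions have the same remainder
    near [a]. *)
Lemma differentiable_eq_near V W (f g : V -> W) a :
  (\forall x \near a, f x = g x) -> differentiable f a -> differentiable g a.
Proof.
move=> fg df; have fa : f a = g a by exact: nbhs_singleton fg.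
apply/diff_locallyP.
have fg0 : \forall x \near 0, f (x + a) = g (x + a).
  by have := fg; rewrite (near_shift 0 a)/= subr0.
have H : g \o shift a = cst (g a) + 'd f a +o_ 0 id.
  apply/eqaddoP => e e0; have /eqaddoP /(_ e e0) := diff_locally df.
  apply: filter_app; apply: filterS fg0 => x Hx.
  rewrite -![(_ + _ : _ -> _) _]/(_ + _) -![(- _ : _ -> _) _]/(- _) /=.
  by rewrite /shift /= Hx /cst -fa.
have dc := diff_continuous df.
have -> : 'd g a = 'd f a :> (V -> W) by apply: diff_unique.
by split.
Qed.

Lemma differentiable_linear V W (f : V -> W) a :
  linear f -> continuous f -> differentiable f a.
Proof.
move=> fl fc; pose fM := GRing.isLinear.Build _ _ _ _ f fl.
pose L : {linear V -> W} := HB.pack f fM.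
by rewrite (_ : f = L) //; apply: linear_differentiable.
Qed.

Lemma derivative_linpost V W E (f : V -> W) (L : W -> E) a v :
  linear L -> continuous L -> differentiable f a ->
  'D_v (fun p => L (f p)) a = L ('D_v f a).
Proof.
move=> Ll Lc df; pose LM := GRing.isLinear.Build _ _ _ _ L Ll.
pose L' : {linear W -> E} := HB.pack L LM.
rewrite deriveE; last first.
  by apply: differentiable_comp => //; apply: differentiable_linear.
rewrite (diff_comp df); last exact: differentiable_linear.
by rewrite deriveE // -[in RHS]/(L' _) /= (@diff_lin _ _ _ L').
Qed.

Lemma ndiff_sub V W n (U U' : set V) (f : V -> W) :
  U' `<=` U -> ndiff_on n U f -> ndiff_on n U' f.
Proof.
move=> sU; elim: n f => //= n IH f [df nf].
by split=> [p /sU/df//|v]; apply: IH.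
Qed.

Lemma smooth_sub V W (U U' : set V) (f : V -> W) :
  U' `<=` U -> smooth_on U f -> smooth_on U' f.
Proof. by move=> sU sf n; apply: ndiff_sub (sf n). Qed.

Lemma ndiffS V W n (U : set V) (f : V -> W) :
  ndiff_on n.+1 U f -> ndiff_on n U f.
Proof.
by elim: n f => //= n IH f [df nf]; split=> // v; apply: IH; apply: nf.
Qed.

Lemma smooth_diff V W (U : set V) (f : V -> W) p :
  smooth_on U f -> U p -> differentiable f p.
Proof. by move=> /(_ 1%N)[+ _]; apply. Qed.

Lemma smooth_deriv V W (U : set V) (f : V -> W) v :
  smooth_on U f -> smooth_on U (fun p => 'D_v f p).
Proof. by move=> sf n; have [_] := sf n.+1; apply. Qed.

Lemma smooth_cont V W (U : set V) (f : V -> W) p :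
  smooth_on U f -> U p -> {for p, continuous f}.
Proof. by move=> sf Up; apply: differentiable_continuous; apply: smooth_diff Up. Qed.

(** Openness turns equality on [U] into equality near each point, so the derivatives agree on [U] as
    well and the induction continues. *)
Lemma ndiff_eq V W n (U : set V) (f g : V -> W) : open U ->
  (forall p, U p -> f p = g p) -> ndiff_on n U f -> ndiff_on n U g.
Proof.
move=> oU; elim: n f g => //= n IH f g fg [df nf].
have H p : U p -> \forall q \near p, f q = g q.
  by move=> Up; apply: filterS (open_near oU Up) => q; apply: fg.
split=> [p Up|v]; first by apply: differentiable_eq_near (df p Up); apply: H.
by apply: IH (nf v) => p Up; apply: near_eq_derive; apply: H.
Qed.

Lemma smooth_eq V W (U : set V) (f g : V -> W) : open U ->
  (forall p, U p -> f p = g p) -> smooth_on U f -> smooth_on U g.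
Proof. by move=> oU fg sf n; apply: ndiff_eq (sf n). Qed.

(** Meant for the matrices of constants attached to an arrow, which are constant near each point
    only. *)
Lemma smooth_local V W (U : set V) (f : V -> W) : open U ->
  (forall p, U p -> exists A, [/\ open A, A p & smooth_on A f]) ->
  smooth_on U f.
Proof.
move=> oU H n; elim: n f H => //= n IH f H; split=> [p /H[A [oA Ap sf]]|v].
  exact: smooth_diff sf Ap.
apply: IH => p /H[A [oA Ap sf]]; exists A; split=> //; exact: smooth_deriv.
Qed.

Lemma smooth_cst V W (U : set V) (c : W) : smooth_on U (fun _ => c).
Proof.
move=> n; elim: n c => //= n IH c; split=> [p _|v]; first exact: differentiable_cst.
have -> : (fun p : V => 'D_v (fun=> c) p) = (fun=> 0) by apply/funext => p; rewrite derivativeC.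
exact: IH.
Qed.

Lemma smooth_linear V W (U : set V) (f : V -> W) :
  linear f -> continuous f -> smooth_on U f.
Proof.
move=> fl fc [//|n]; split=> [p _|v]; first exact: differentiable_linear.
pose fM := GRing.isLinear.Build _ _ _ _ f fl.
pose L : {linear V -> W} := HB.pack f fM.
have -> : (fun p => 'D_v f p) = (fun=> f v).
  apply/funext => p; rewrite deriveE; last exact: differentiable_linear.
  by rewrite (_ : f = L) // diff_lin.
exact: smooth_cst.
Qed.

Lemma ndiffD V W n (U : set V) (f g : V -> W) : open U ->
  ndiff_on n U f -> ndiff_on n U g -> ndiff_on n U (fun p => f p + g p).
Proof.
move=> oU; elim: n f g => // n IH f g [df nf] [dg ng]; split=> [p Up|v].
  by apply: differentiableD; [apply: df|apply: dg].
apply: ndiff_eq (IH _ _ (nf v) (ng v)) => // p Up.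
by rewrite derivativeD //; [apply: df|apply: dg].
Qed.

Lemma smoothD V W (U : set V) (f g : V -> W) : open U ->
  smooth_on U f -> smooth_on U g -> smooth_on U (fun p => f p + g p).
Proof. by move=> oU sf sg n; apply: ndiffD. Qed.

Lemma smooth_sum V W I (s : seq I) (P : pred I) (U : set V) (f : I -> V -> W) :
  open U -> (forall i, P i -> smooth_on U (f i)) ->
  smooth_on U (fun p => \sum_(i <- s | P i) f i p).
Proof.
move=> oU sf; elim: s => [|i s IH].
  by under eq_fun do rewrite big_nil; exact: smooth_cst.
under eq_fun do rewrite big_cons.
case: (boolP (P i)) => // Pi; apply: smoothD => //; exact: sf.
Qed.

Lemma ndiff_linpost V W E n (U : set V) (f : V -> W) (L : W -> E) : open U ->
  linear L -> continuous L -> ndiff_on n U f -> ndiff_on n U (fun p => L (f p)).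
Proof.
move=> oU Ll Lc; elim: n f => //= n IH f [df nf]; split=> [p Up|v].
  apply: differentiable_comp; [exact: df|exact: differentiable_linear].
apply: ndiff_eq (IH _ (nf v)) => // p Up.
by rewrite (derivative_linpost _ Ll Lc) //; exact: df.
Qed.

Lemma smooth_linpost V W E (U : set V) (f : V -> W) (L : W -> E) : open U ->
  linear L -> continuous L -> smooth_on U f -> smooth_on U (fun p => L (f p)).
Proof. by move=> oU Ll Lc sf n; apply: ndiff_linpost. Qed.

(** A directional derivative of the composite is again a composite with [L], of the derivative of
    [f] along [L v]; the induction therefore varies [f]. *)
Lemma smooth_linpre V E W (U : set E) (L : V -> E) (f : E -> W) :
  linear L -> continuous L -> smooth_on U f ->
  smooth_on (L @^-1` U) (fun p => f (L p)).
Proof.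
move=> Ll Lc sf n; pose LM := GRing.isLinear.Build _ _ _ _ L Ll.
pose L' : {linear V -> E} := HB.pack L LM.
elim: n f sf => //= n IH f sf; split=> [p Up|v].
  apply: (@differentiable_comp _ _ _ _ L f); first exact: differentiable_linear.
  exact: smooth_diff sf Up.
rewrite (_ : (fun p => _) = (fun p => 'D_(L v) f (L p))); last first.
  by apply/funext => p; rewrite (derive_linpre L').
exact: IH (smooth_deriv (L v) sf).
Qed.

Lemma ndiffM V n (U : set V) (f g : V -> F) : open U ->
  ndiff_on n U f -> ndiff_on n U g -> ndiff_on n U (fun p => f p * g p).
Proof.
move=> oU; elim: n f g => // n IH f g sf sg.
have [nf' ng'] := (ndiffS sf, ndiffS sg).
case: sf sg => df nf [dg ng]; split=> [p Up|v].
  by apply: differentiableM; [apply: df|apply: dg].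
apply: (@ndiff_eq _ _ _ _ (fun p => f p * 'D_v g p + 'D_v f p * g p)) => //.
  by move=> p Up; rewrite derivativeM //; [apply: df|apply: dg].
by apply: ndiffD => //; apply: IH => //; [apply: ng|apply: nf].
Qed.

Lemma smoothM V (U : set V) (f g : V -> F) : open U ->
  smooth_on U f -> smooth_on U g -> smooth_on U (fun p => f p * g p).
Proof. by move=> oU sf sg n; apply: ndiffM. Qed.

Lemma smoothN V (U : set V) (f : V -> F) : open U ->
  smooth_on U f -> smooth_on U (fun p => - f p).
Proof.
move=> oU sf; have := smoothM oU (smooth_cst U (-1 : F)) sf.
by under eq_fun do rewrite mulN1r.
Qed.

Lemma smoothB V (U : set V) (f g : V -> F) : open U ->
  smooth_on U f -> smooth_on U g -> smooth_on U (fun p => f p - g p).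
Proof. by move=> oU sf sg; apply: smoothD => //; apply: smoothN. Qed.

(** The derivative of 1/f is -(1/f)^2 times that of [f]: only 1/f itself recurs, with one order of
    differentiability less. *)
Lemma smoothV V (U : set V) (f : V -> F) : open U ->
  (forall p, U p -> f p != 0) -> smooth_on U f -> smooth_on U (fun p => (f p)^-1).
Proof.
move=> oU f0 sf n; have df p : U p -> differentiable f p by exact: smooth_diff.
elim: n => // n IH; split=> [p Up|v].
  by apply: differentiableV; [apply: df|apply: f0].
apply: (@ndiff_eq _ _ _ _ (fun p => (- 1 * ((f p)^-1 * (f p)^-1)) * 'D_v f p)) => //.
  move=> p Up; rewrite derivativeV; [by rewrite expr2 mulN1r|exact: df|exact: f0].
apply: ndiffM => //; last exact: (smooth_deriv v sf).
by do !apply: ndiffM => //; exact: smooth_cst.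
Qed.

Lemma smooth_div V (U : set V) (f g : V -> F) : open U ->
  (forall p, U p -> g p != 0) -> smooth_on U f -> smooth_on U g ->
  smooth_on U (fun p => f p / g p).
Proof. by move=> oU g0 sf sg; apply: smoothM => //; apply: smoothV. Qed.

Lemma smoothX V (U : set V) (f : V -> F) k : open U ->
  smooth_on U f -> smooth_on U (fun p => f p ^+ k).
Proof.
move=> oU sf; elim: k => [|k IH]; first by under eq_fun do rewrite expr0; exact: smooth_cst.
by under eq_fun do rewrite exprS; exact: smoothM.
Qed.

Lemma smooth_prod V I (s : seq I) (U : set V) (f : I -> V -> F) :
  open U -> (forall i, smooth_on U (f i)) ->
  smooth_on U (fun p => \prod_(i <- s) f i p).
Proof.
move=> oU sf; elim: s => [|i s IH].
  by under eq_fun do rewrite big_nil; exact: smooth_cst.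
by under eq_fun do rewrite big_cons; exact: smoothM.
Qed.

Lemma smooth_det V n (U : set V) (A : V -> 'M[F]_n) : open U ->
  (forall i j, smooth_on U (fun p => A p i j)) ->
  smooth_on U (fun p => \det (A p)).
Proof.
move=> oU sA; rewrite /determinant; apply: smooth_sum => // s _.
by apply: smoothM => //; [exact: smooth_cst|apply: smooth_prod].
Qed.

Lemma ndiff_comp1 V n (U : set V) (U' : set F) (f : F -> F) (g : V -> F) :
  open U -> (forall p, U p -> U' (g p)) ->
  ndiff_on n U' f -> ndiff_on n U g -> ndiff_on n U (fun p => f (g p)).
Proof.
move=> oU; elim: n f g => // n IH f g UU' sf sg.
have ng' := ndiffS sg.
case: sf sg => df nf [dg ng]; split=> [p Up|v].
  by apply: differentiable_comp; [apply: dg|apply: df; apply: UU'].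
apply: (@ndiff_eq _ _ _ _ (fun p => 'D_1 f (g p) * 'D_v g p)) => //.
  move=> p Up; have dgp := dg p Up; have dfp := df _ (UU' _ Up).
  by rewrite [RHS]derivative_comp1 // derive1E.
by apply: ndiffM => //; [exact: (IH ('D_1 f) g UU' (nf 1) ng')|apply: ng].
Qed.

Lemma smooth_comp1 V (U : set V) (U' : set F) (f : F -> F) (g : V -> F) :
  open U -> (forall p, U p -> U' (g p)) ->
  smooth_on U' f -> smooth_on U g -> smooth_on U (fun p => f (g p)).
Proof. by move=> oU UU' sf sg n; apply: ndiff_comp1 UU' _ _. Qed.

Lemma smooth_derive1 (U : set F) (f : F -> F) :
  smooth_on U f -> smooth_on U (derive1 f).
Proof.
move=> sf; rewrite (_ : derive1 f = fun p => 'D_1 f p); first exact: smooth_deriv.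
by apply/funext => p; rewrite derive1E.
Qed.

Lemma smooth_derive1n (U : set F) (f : F -> F) k :
  smooth_on U f -> smooth_on U (derive1n k f).
Proof. by move=> sf; elim: k => // k IH; rewrite derive1nS; exact: smooth_derive1. Qed.

Lemma derive1_near (f g : F -> F) (a : F) :
  (\forall x \near a, f x = g x) -> derive1 f a = derive1 g a.
Proof. by move=> fg; rewrite !derive1E; apply: near_eq_derive. Qed.

Lemma derive1n_near (f g : F -> F) (a : F) k :
  (\forall x \near a, f x = g x) ->
  \forall x \near a, derive1n k f x = derive1n k g x.
Proof.
move=> fg; elim: k => // k IH.
by have := nbhs_interior IH; apply: filterS => x Hx; exact: derive1_near.
Qed.

Lemma derive1n_cst (c : F) k : derive1n k.+1 (fun _ : F => c) = fun=> 0.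
Proof.
elim: k => [|k IH]; rewrite derive1nS ?IH; apply/funext => t;
by rewrite derive1E derivativeC.
Qed.

Lemma derive1_id' : derive1 (fun t : F => t) = fun=> 1.
Proof. by apply/funext => t; rewrite derive1E derive_id. Qed.

End Calculus.

(** * Smoothness of matrices, pairs and functions of one coordinate *)

Section MatrixCalculus.
Variable F : numFieldType.

Lemma derivative_chain (V W E : normedModType F) (f : V -> W) (g : W -> E) a v :
  differentiable f a -> differentiable g (f a) ->
  'D_v (fun p => g (f p)) a = 'D_('D_v f a) g (f a).
Proof.
move=> df dg; have dgf : differentiable (g \o f) a by exact: differentiable_comp.
by rewrite (deriveE _ dgf) diff_comp // !deriveE.
Qed.

Lemma derivative_linear (V W : normedModType F) (L : V -> W) a v :
  linear L -> continuous L -> 'D_v L a = L v.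
Proof.
by move=> Ll Lc; rewrite (derivative_linpost (f := fun x => x) (L := L)) // derive_id.
Qed.

Lemma smooth_matrix (V : normedModType F) m n (U : set V) (f : V -> 'M[F]_(m, n)) : open U ->
  (forall i j, smooth_on U (fun p => f p i j)) -> smooth_on U f.
Proof.
move=> oU sf; rewrite (_ : f = fun p => \sum_i \sum_j f p i j *: delta_mx i j); last first.
  by apply/funext => p; rewrite -matrix_sum_delta.
apply: smooth_sum => // i _; apply: smooth_sum => // j _.
apply: (smooth_linpost (L := fun a : F => a *: delta_mx i j)) => //.
  by move=> a u v; rewrite scalerDl scalerA.
exact: scalel_continuous.
Qed.

Lemma open_neq0 (V : normedModType F) (U : set V) (f : V -> F) : open U -> smooth_on U f ->
  open [set p | U p /\ f p != 0].
Proof.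
move=> oU sf; rewrite openE => p [Up fp].
have H : \forall w \near p, f w != 0.
  have := smooth_cont sf Up => /cvgrPdist_lt /(_ `|f p|).
  rewrite normr_gt0 => /(_ fp); apply: filterS => w.
  by apply: contraTneq => ->; rewrite subr0 ltxx.
by apply: filterS2 (open_near oU Up) H.
Qed.

Lemma derivative_quot (V : normedModType F) (f g : V -> F) q v :
  differentiable f q -> differentiable g q -> g q != 0 ->
  'D_v (fun p => f p / g p) q
  = f q * (- (g q)^-1 ^+ 2 * 'D_v g q) + 'D_v f q / g q.
Proof.
move=> df dg g0; have dg' : differentiable (fun p => (g p)^-1) q by exact: differentiableV.
by rewrite (derivativeM _ df dg') (derivativeV _ dg g0).
Qed.

Lemma smooth_fst (V W : normedModType F) (U : set (V * W)%type) : smooth_on U (fun p => p.1).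
Proof. by apply: smooth_linear => // p; exact: cvg_fst. Qed.

Lemma smooth_snd (V W : normedModType F) (U : set (V * W)%type) : smooth_on U (fun p => p.2).
Proof. by apply: smooth_linear => // p; exact: cvg_snd. Qed.

Lemma smooth_coord (V : normedModType F) m n (U : set V) (f : V -> 'M[F]_(m, n)) i j : open U ->
  smooth_on U f -> smooth_on U (fun p => f p i j).
Proof.
move=> oU; apply: (@smooth_linpost _ _ _ _ _ _ (fun A : 'M[F]_(m, n) => A i j)) => //.
  by move=> c A B; rewrite !mxE.
exact: coord_continuous.
Qed.

(** Carries an identity over to the one parameter value at which the denominators used to prove it
    vanish. *)
Lemma continuous_zero_away (f : F -> F) : {for 0, continuous f} ->
  (forall e : F, e != 0 -> f e = 0) -> f 0 = 0.
Proof.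
move=> fc H; apply/eqP; apply: contraT => f0.
have n0 : 0 < `|f 0| by rewrite normr_gt0.
have /cvgrPdist_lt /(_ _ n0) /nbhs_ballP[d /= d0 Hd] := fc.
have h0 : d / 2 != 0 :> F by rewrite mulf_neq0 ?invr_eq0 ?lt0r_neq0.
have bd : ball (0 : F) d (d / 2).
  by rewrite /ball /= sub0r normrN gtr0_norm ?divr_gt0 // ltr_pdivrMr // mulr_natr mulr2n ltrDl.
by have := Hd _ bd; rewrite /= (H _ h0) subr0 ltxx.
Qed.

Lemma smooth_pair (V W E : normedModType F) (U : set V) (f : V -> W) (g : V -> E) : open U ->
  smooth_on U f -> smooth_on U g -> smooth_on U (fun p => (f p, g p)).
Proof.
move=> oU sf sg.
rewrite (_ : (fun p => _) = (fun p => ((f p, 0) : W * E) + (0, g p))); last first.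
  by apply/funext => p; congr (_, _); rewrite /= ?addr0 ?add0r.
have c1 : continuous (fun w : W => (w, 0) : W * E).
  by move=> w; apply: cvg_pair; [exact: cvg_id|exact: cvg_cst].
have c2 : continuous (fun w : E => (0, w) : W * E).
  by move=> w; apply: cvg_pair; [exact: cvg_cst|exact: cvg_id].
apply: smoothD => //.
  apply: (smooth_linpost (L := fun w : W => (w, 0) : W * E)) => // a u v.
  by congr (_, _); rewrite /= scaler0 addr0.
apply: (smooth_linpost (L := fun w : E => (0, w) : W * E)) => // a u v.
by congr (_, _); rewrite /= scaler0 addr0.
Qed.

Lemma derivative_bigsum (V : normedModType F) (n : nat) (f : 'I_n -> V -> F) a v :
  (forall i, differentiable (f i) a) ->
  'D_v (fun p => \sum_(i < n) f i p) a = \sum_(i < n) 'D_v (f i) a.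
Proof.
move=> df; rewrite (_ : (fun p => _) = \sum_(i < n) f i); last first.
  by apply/funext => u; rewrite fct_sumE.
by rewrite derive_sum // => i; exact: diff_derivable.
Qed.

(** Entries of the inverse are cofactors over the determinant, hence rational in the entries of
    [A]. *)
Lemma smooth_invmx (V : normedModType F) (n : nat) (U : set V) (A : V -> 'M[F]_n) i j :
  open U -> (forall k l, smooth_on U (fun p => A p k l)) ->
  (forall p, U p -> \det (A p) != 0) -> smooth_on U (fun p => invmx (A p) i j).
Proof.
move=> oU sA A0.
apply: (@smooth_eq _ _ _ U (fun p => (\det (A p))^-1 * \adj (A p) i j)) => //.
  by move=> p Up; rewrite /invmx unitmxE unitfE (A0 _ Up) [RHS]mxE.
apply: smoothM => //; first by apply: smoothV => //; exact: smooth_det.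
rewrite (_ : (fun p => _) = (fun p => (-1) ^+ (j + i) * \det (row' j (col' i (A p))))); last first.
  by apply/funext => p; rewrite mxE.
apply: smoothM => //; first exact: smooth_cst.
apply: smooth_det => // k l.
rewrite (_ : (fun p => _) = (fun p => A p (lift j k) (lift i l))); first exact: sA.
by apply/funext => p; rewrite !mxE.
Qed.

Lemma smooth_comp_fst (O : set (F * F)) (I : set F) (f : F -> F) : open O ->
  (forall q, O q -> I q.1) -> smooth_on I f -> smooth_on O (fun q => f q.1).
Proof. by move=> oO OI sf; apply: (smooth_comp1 oO OI sf); exact: smooth_fst. Qed.

Lemma derivative_fst (V W : normedModType F) (q v : V * W) :
  'D_v (fun q : V * W => q.1) q = v.1.
Proof. by apply: derivative_linear => // p; exact: cvg_fst. Qed.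

Lemma derivative_snd (V W : normedModType F) (q v : V * W) :
  'D_v (fun q : V * W => q.2) q = v.2.
Proof. by apply: derivative_linear => // p; exact: cvg_snd. Qed.

Lemma derivative_comp_fst (W : normedModType F) (f : F -> F) (q v : F * W) :
  differentiable f q.1 -> 'D_v (fun q : F * W => f q.1) q = derive1 f q.1 * v.1.
Proof.
move=> df; rewrite (derivative_comp1 (g := fun q : F * W => q.1)) ?derivative_fst //.
exact: smooth_diff (@smooth_fst _ _ setT) Logic.I.
Qed.

End MatrixCalculus.

(** * Mean value inequality and inverse functions *)

(* Completeness and the Archimedean property in a form that makes sense for
   both R and R[i], whose order is only partial. *)
Definition geometric_complete (F : numFieldType) : Prop :=
  forall (u : nat -> F) (M : F),
    (forall n, `|u n.+1 - u n| <= M / 2 ^+ n) ->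
  exists l, forall n, `|l - u n| <= 4 * (M / 2 ^+ n).

Definition dyadic_archi (F : numFieldType) : Prop :=
  forall x y : F, 0 < y -> exists n : nat, `|x| / 2 ^+ n < y.

(** All steps from the n-th on add up to at most d n = 2 M / 2^n, so the intervals of radius d n
    around u n are nested; the supremum of their left ends lies in each of them. *)
Lemma geometric_complete_real (R : realType) (u : nat -> R) (M : R) :
    (forall n, `|u n.+1 - u n| <= M / 2 ^+ n) ->
  exists l, forall n, `|l - u n| <= 2 * (M / 2 ^+ n).
Proof.
move=> Hu; pose d n := 2 * (M / 2 ^+ n).
have dS n : d n = 2 * d n.+1.
  by rewrite /d exprS; field; rewrite ?expf_neq0 ?pnatr_eq0.
have M0 n : 0 <= d n by rewrite mulr_ge0 // (le_trans _ (Hu n)).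
have step n : u n - d n <= u n.+1 - d n.+1 /\ u n.+1 + d n.+1 <= u n + d n.
  have := Hu n; rewrite (_ : M / 2 ^+ n = d n.+1); last first.
    by rewrite /d exprS; field; rewrite ?expf_neq0 ?pnatr_eq0.
  by rewrite ler_norml (dS n) => /andP[]; lra.
have inc n k : u n - d n <= u (n + k)%N - d (n + k)%N.
  by elim: k => [|k IH]; rewrite ?addn0 // addnS; have [] := step (n + k)%N; lra.
have dec n k : u (n + k)%N + d (n + k)%N <= u n + d n.
  by elim: k => [|k IH]; rewrite ?addn0 // addnS; have [] := step (n + k)%N; lra.
have vw n k : u k - d k <= u n + d n.
  have [h|/ltnW h] := leqP k n.
    by have := inc k (n - k)%N; rewrite subnKC //; have := M0 n; lra.
  by have := dec n (k - n)%N; rewrite subnKC //; have := M0 k; lra.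
pose E := [set u k - d k | k in setT].
exists (sup E) => n; rewrite ler_norml; apply/andP; split.
  rewrite -/(d n); suff : u n - d n <= sup E by lra.
  by apply: ub_le_sup; [exists (u n + d n) => _ [k _ <-]|exists n].
rewrite -/(d n); suff : sup E <= u n + d n by lra.
by apply: ge_sup => [|_ [k _ <-] //]; exists (u 0%N - d 0%N), 0%N.
Qed.

(** In the complex case the real and imaginary parts converge separately, each with the real bound
    2; their sum accounts for the constant 4. *)
Lemma geometric_complete_RC (R : realType) (F : numFieldType) :
  F = (R : numFieldType) \/ F = (R[i] : numFieldType) -> geometric_complete F.
Proof.
case=> -> u M Hu.
  have [l Hl] := geometric_complete_real Hu; exists l => n.
  apply: le_trans (Hl n) _; apply: ler_wpM2r; last by rewrite ler_nat.
  exact: le_trans (Hu n).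
have M0 : 0 <= M by have := Hu 0%N; rewrite expr0 divr1; apply: le_trans.
have [m Mm] : exists m : R, M = m%:C%C by apply/complex_realP; exact: ger0_real.
have H2 n : (2 : R[i]) ^+ n = (2 ^+ n)%:C%C.
  by rewrite rmorphXn /= rmorphMn rmorph1.
have MC n : M / 2 ^+ n = (m / 2 ^+ n)%:C%C.
  by rewrite Mm H2 -[X in _ * X]fmorphV -rmorphM.
have Im_le (z : R[i]) : `|complex.Im z|%:C%C <= `|z|.
  have := normc_ge_Re (z * 'i%C); rewrite ReiNIm normrN normrM.
  by rewrite [`|'i%C|]normc_def /= expr0n expr1n add0r sqrtr1 mulr1.
have [a Ha] : exists l, forall n, `|l - complex.Re (u n)| <= 2 * (m / 2 ^+ n).
  apply: geometric_complete_real => n; rewrite -lecR -MC.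
  rewrite (le_trans _ (Hu n)) // (le_trans _ (normc_ge_Re _)) //.
  by case: (u n) => ? ?; case: (u n.+1).
have [b Hb] : exists l, forall n, `|l - complex.Im (u n)| <= 2 * (m / 2 ^+ n).
  apply: geometric_complete_real => n; rewrite -lecR -MC.
  rewrite (le_trans _ (Hu n)) // (le_trans _ (Im_le _)) //.
  by case: (u n) => ? ?; case: (u n.+1).
exists (a +i* b)%C => n; rewrite MC.
have -> : (a +i* b)%C - u n
    = (a - complex.Re (u n))%:C%C + 'i%C * (b - complex.Im (u n))%:C%C.
  by rewrite [LHS]complexE; case: (u n).
apply: le_trans (ler_normD _ _) _; rewrite normrM.
rewrite [`|'i%C|]normc_def /= expr0n expr1n add0r sqrtr1 mul1r.
rewrite !normc_def /= expr0n !addr0 !sqrtr_sqr -rmorphD.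
rewrite (_ : 4 = (4 : R)%:C%C); last by rewrite rmorphMn rmorph1.
by rewrite -rmorphM lecR; have := Ha n; have := Hb n; lra.
Qed.

Lemma dyadic_archi_real (R : realType) (x y : R) :
  0 < y -> exists n : nat, `|x| / 2 ^+ n < y.
Proof.
move=> y0; have [n Hn] : exists n : nat, `|x| / y < n%:R.
  by exists (Num.truncn (`|x| / y)).+1; rewrite truncnS_gt.
exists n; rewrite ltr_pdivrMr ?exprn_gt0 // mulrC -ltr_pdivrMr //.
by apply: lt_trans Hn _; rewrite -natrX ltr_nat ltn_expl.
Qed.

Lemma dyadic_archi_RC (R : realType) (F : numFieldType) :
  F = (R : numFieldType) \/ F = (R[i] : numFieldType) -> dyadic_archi F.
Proof.
case=> -> x y y0; first exact: dyadic_archi_real.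
have [b yb] : exists m : R, y = m%:C%C by apply/complex_realP; exact: gtr0_real.
have [a xa] : exists m : R, `|x| = m%:C%C by apply/complex_realP; exact: normr_real.
have a0 : 0 <= a by rewrite -ler0c -xa.
have b0 : 0 < b by rewrite -ltcR -yb.
have [n Hn] := dyadic_archi_real a b0; exists n.
have H2 : (2 : R[i]) ^+ n = (2 ^+ n)%:C%C by rewrite rmorphXn /= rmorphMn rmorph1.
by rewrite xa yb H2 -[X in _ * X]fmorphV -rmorphM ltcR -(ger0_norm a0).
Qed.

Section MeanValue.
Variable F : numFieldType.
Hypothesis cF : geometric_complete F.
Hypothesis aF : dyadic_archi F.

(** An epsilon-delta form of differentiability, with the increment as a scalar; [derive1_of_eps] is
    the way back. *)
Lemma derive1_eps (f : F -> F) (x : F) : differentiable f x ->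
  forall e : F, 0 < e -> exists2 d : F, 0 < d &
  forall h, `|h| < d -> `|f (x + h) - f x - derive1 f x * h| <= e * `|h|.
Proof.
move=> /diff_derivable -/(_ 1) /derivable_nbhs H e e0.
move: H => /eqaddoP /(_ e e0) /nbhs_ballP[d /= d0 Hd]; exists d => // h hd.
have := Hd h; rewrite /ball /= sub0r normrN => /(_ hd).
rewrite -![(_ + _ : _ -> _) _]/(_ + _) -![(- _ : _ -> _) _]/(- _) /= /cst.
by rewrite derive1E [h%:A]mulr1 [h + x]addrC opprD addrA /GRing.scale /= [h * _]mulrC.
Qed.

Lemma derive1_of_eps (f : F -> F) (x d : F) :
  (forall e : F, 0 < e -> exists2 r : F, 0 < r &
    forall h, `|h| < r -> `|f (x + h) - f x - d * h| <= e * `|h|) ->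
  differentiable f x /\ derive1 f x = d.
Proof.
move=> H.
have Hc : (fun h => h^-1 *: ((f \o shift x) (h *: 1) - f x)) @ 0^' --> d.
  apply/cvgrPdist_le => e e0; have [r r0 Hr] := H _ e0.
  apply/nbhs_ballP; exists r => //= h; rewrite /ball /= sub0r normrN => hr h0.
  have := Hr h hr; rewrite [_%:A]mulr1 [h + x]addrC distrC => Hh.
  have hn0 : 0 < `|h| by rewrite normr_gt0.
  rewrite -(ler_pM2r hn0) -normrM mulrBl /GRing.scale /= (mulrC h^-1) -mulrA mulVf ?mulr1 //.
have dv : derivable f x 1 by apply/cvg_ex; exists d.
split; first exact/derivable1_diffP.
by rewrite derive1E; apply: cvg_lim.
Qed.

(** Passing to the limit in an inequality. In a partial order a failed inequality can be reversed
    only between real elements. *)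
Lemma dyadic_le (x y C : F) : x \is Num.real -> y \is Num.real -> 0 <= C ->
  (forall n, x <= y + C / 2 ^+ n) -> x <= y.
Proof.
move=> xr yr C0 H; rewrite real_leNgt //; apply/negP => yx.
have xy0 : 0 < x - y by rewrite subr_gt0.
have [n] := aF C xy0; rewrite ger0_norm // ltrBrDl.
by move=> /(le_lt_trans (H n)); rewrite ltxx.
Qed.

Lemma dyadic_small (C d : F) : 0 <= C -> 0 < d ->
  exists n, C / 2 ^+ n < d.
Proof. by move=> C0 /(aF C)[n]; rewrite ger0_norm // => Hn; exists n. Qed.

(* Bisection: a chord of slope at least [K' > K] has a half with the same
   property, and the nested chords shrink to a point where the derivative is
   too large. *)
Lemma mean_value (f : F -> F) (c m K : F) :
  0 <= K -> m \is Num.real ->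
  (forall t, `|t - c| <= m -> differentiable f t /\ `|derive1 f t| <= K) ->
  forall a b, `|a - c| <= m -> `|b - c| <= m -> `|f b - f a| <= K * `|b - a|.
Proof.
move=> K0 mr H a b am bm.
rewrite real_leNgt ?normr_real ?realM ?normr_real ?ger0_real //.
apply/negP => Hgt.
have ab : b - a != 0.
  by apply/eqP => ba; move: Hgt; rewrite ba (subr0_eq ba) subrr normr0 mulr0 ltxx.
have L0 : 0 < `|b - a| by rewrite normr_gt0.
set L := `|b - a| in L0 Hgt.
pose K' := `|f b - f a| / L.
have KK' : K < K' by rewrite ltr_pdivlMr.
have K'0 : 0 < K' by apply: le_lt_trans KK'.
pose step (p : F * F) := let: (x, y) := p in let z := (x + y) / 2 in
  if K' * `|y - z| <= `|f y - f z| then (z, y) else (x, z).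
pose s n := iter n step (a, b).
have half (x y : F) : y - (x + y) / 2 = (y - x) / 2 by field.
have half' (x y : F) : (x + y) / 2 - x = (y - x) / 2 by field.
have mid (x y : F) : `|x - c| <= m -> `|y - c| <= m -> `|(x + y) / 2 - c| <= m.
  move=> xm ym; have -> : (x + y) / 2 - c = ((x - c) + (y - c)) / 2 by field.
  rewrite normrM normfV [`|2|]ger0_norm // ler_pdivrMr // mulr_natr mulr2n.
  by apply: le_trans (ler_normD _ _) _; apply: lerD.
have inv n : [/\ `|(s n).1 - c| <= m, `|(s n).2 - c| <= m,
    K' * `|(s n).2 - (s n).1| <= `|f (s n).2 - f (s n).1| &
    `|(s n).2 - (s n).1| = L / 2 ^+ n].
  elim: n => [|n]; first by rewrite /= expr0 divr1 divfK ?lt0r_neq0.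
  rewrite /s iterS -/(s n); case: (s n) => x y /= [xm ym Hxy Exy].
  have E2 : `|(y - x) / 2| = L / 2 ^+ n.+1.
    by rewrite normrM Exy normfV [`|2|]ger0_norm // exprSr invfM mulrA.
  case: ifP => Hif /=; first by split => //; [exact: mid|rewrite half].
  split => //; [exact: mid| |by rewrite half'].
  have : `|f y - f ((x + y) / 2)| < K' * `|y - (x + y) / 2|.
    by rewrite real_ltNge ?Hif ?normr_real // realM ?normr_real ?gtr0_real.
  rewrite half half' => Hlt.
  have : K' * `|y - x| <= `|f y - f ((x + y) / 2)| + `|f ((x + y) / 2) - f x|.
    apply: le_trans Hxy _; apply: le_trans (ler_normD _ _).
    by rewrite addrA subrK.
  have -> : `|y - x| = `|(y - x) / 2| + `|(y - x) / 2|.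
    by rewrite normrM normfV [`|2|]ger0_norm //; field.
  rewrite mulrDr => Hle; rewrite -(lerD2l (K' * `|(y - x) / 2|)).
  by apply: le_trans Hle _; rewrite lerD2r ltW.
have stepn n : `|(s n.+1).1 - (s n).1| <= L / 2 ^+ n.
  have [_ _ _] := inv n; rewrite /s iterS -/(s n); case: (s n) => x y /= <-.
  case: ifP => _ /=; last by rewrite subrr normr0.
  rewrite half' normrM normfV [`|2|]ger0_norm // ler_pdivrMr // ler_peMr //.
  by rewrite ler1n.
have [l Hl] := cF stepn.
have lm : `|l - c| <= m.
  apply: (@dyadic_le _ _ (4 * L)); rewrite ?normr_real ?mulr_ge0 ?(ltW L0) //.
  move=> n; have [sm _ _ _] := inv n.
  have -> : l - c = (l - (s n).1) + ((s n).1 - c) by rewrite addrA subrK.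
  rewrite addrC; apply: le_trans (ler_normD _ _) _; apply: lerD => //.
  by rewrite -mulrA.
have [dl Kl] := H _ lm.
(* The ends of the chord lie within 4 q and 5 q of the limit point, so the two remainders add up to
   9 e q. Any denominator above 9 contradicts slope [K']. *)
pose e := (K' - K) / 20.
have e0 : 0 < e by rewrite divr_gt0 ?subr_gt0.
have [d d0 Hd] := derive1_eps dl e0.
have [n Hn] := @dyadic_small (5 * L) d (mulr_ge0 (ler0n _ _) (ltW L0)) d0.
have [_ _ Hk Es] := inv n.
set x := (s n).1 in Hk Es *; set y := (s n).2 in Hk Es *.
pose q := L / 2 ^+ n.
have q0 : 0 < q by rewrite divr_gt0 ?exprn_gt0.
have xq : `|x - l| <= 4 * q by rewrite distrC; exact: Hl.
have yq : `|y - l| <= 5 * q.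
  have -> : y - l = (y - x) + (x - l) by rewrite addrA subrK.
  apply: le_trans (ler_normD _ _) _; rewrite Es -/q.
  rewrite (_ : 5 * q = q + 4 * q); last by ring.
  exact: lerD.
have qd : 5 * q < d by rewrite mulrA.
have xd : `|x - l| < d.
  by apply: le_lt_trans qd; apply: le_trans xq _; rewrite ler_pM2r // ler_nat.
have yd : `|y - l| < d by apply: le_lt_trans qd.
have Ex := Hd _ xd; have Ey := Hd _ yd; rewrite !subrKC in Ex Ey.
have : K' * q <= (K + 9 * e) * q.
  apply: le_trans (_ : `|f y - f x| <= _); first by rewrite -[q]Es.
  have -> : f y - f x = (f y - f l - derive1 f l * (y - l))
     - (f x - f l - derive1 f l * (x - l)) + derive1 f l * (y - x) by ring.
  rewrite (_ : (K + 9 * e) * q = e * (5 * q) + e * (4 * q) + K * q); last by ring.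
  apply: le_trans (ler_normD _ _) _; apply: lerD; last first.
    rewrite normrM Es; apply: ler_wpM2r => //; exact: ltW.
  apply: le_trans (ler_normB _ _) _; apply: lerD.
    by apply: le_trans Ey _; rewrite ler_pM2l.
  by apply: le_trans Ex _; rewrite ler_pM2l.
rewrite ler_pM2r // => HK.
have : K' - K <= 9 * e by rewrite lerBlDl.
rewrite /e mulrCA -[leLHS]mulr1 ler_pM2l ?subr_gt0 //.
rewrite ler_pdivlMr // mul1r ler_nat //.
Qed.

(** The mean value inequality wants a closed disc; the one of radius |a - c| lies inside the open
    disc of the hypothesis. *)
Lemma zero_derivative_cst (f : F -> F) (c m : F) :
  (forall t, `|t - c| < m -> differentiable f t /\ derive1 f t = 0) ->
  forall a, `|a - c| < m -> f a = f c.
Proof.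
move=> H a am; apply/eqP; rewrite -subr_eq0 -normr_le0.
rewrite -(mul0r `|a - c|).
apply: (@mean_value f c `|a - c| 0) => //; rewrite ?normr_real //.
  by move=> t tc; have [|? ->] := H t; [exact: le_lt_trans am|rewrite normr0].
by rewrite subrr normr0.
Qed.

Lemma zero_derivative_line (V : normedModType F) (f : V -> F) (p v : V) (m : F) :
  (forall s, `|s| < m ->
     differentiable f (p + s *: v) /\ 'D_v f (p + s *: v) = 0) ->
  forall s, `|s| < m -> f (p + s *: v) = f p.
Proof.
move=> H s sm; pose g (s : F) := f (p + s *: v).
have dv (t : F) : differentiable (fun s : F => p + s *: v) t.
  apply: differentiableD; first exact: differentiable_cst.
  exact: differentiableZl.
suff : g s = g 0 by rewrite /g scale0r addr0.
apply: (@zero_derivative_cst g 0 m); last by rewrite subr0.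
move=> t; rewrite subr0 => /H [df Df]; split; first exact: differentiable_comp.
rewrite derive1E -Df /derive; set d := (fun _ : F => _); set d' := (fun _ : F => _).
suff -> : d = d' by [].
rewrite funeqE => h; rewrite /d /d' /g /= [_%:A]mulr1.
by rewrite scalerDl addrCA.
Qed.

(** Near [t0] the function T(t) - A t has Lipschitz constant |A| / 2. Hence [T] is injective with a
    Lipschitz inverse, its image is open by a Newton iteration with frozen slope [A], and the
    inverse is smooth because its derivative is 1/T' composed with itself. *)
Lemma inverse_function (U : set F) (T : F -> F) (t0 : F) :
  open U -> smooth_on U T -> U t0 -> derive1 T t0 != 0 ->
  exists (V : set F) (S : F -> F), [/\ open V, V t0 & V `<=` U] /\
    [/\ open (T @` V), smooth_on (T @` V) S & forall t, V t -> S (T t) = t].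
Proof.
move=> oU sT Ut0; set A := derive1 T t0 => A0.
have nA : 0 < `|A| by rewrite normr_gt0.
have hA : 0 < `|A| / 2 by rewrite divr_gt0.
have [m m0 Hm] : exists2 m : F, 0 < m & forall t, `|t - t0| <= m ->
    U t /\ `|derive1 T t - A| <= `|A| / 2.
  have : \forall t \near t0, `|A - derive1 T t| <= `|A| / 2.
    have /cvgrPdist_le := smooth_cont (smooth_derive1 sT) Ut0; exact.
  move=> h2; have h1 := open_near oU Ut0.
  have : \forall t \near t0, U t /\ `|A - derive1 T t| <= `|A| / 2.
    exact: filterI.
  move=> /nbhs_ballP[d /= d0 Hd].
  exists (d / 2); first by rewrite divr_gt0.
  move=> t tm; have [|/= Ut Ht] := Hd t.
    rewrite /ball /= distrC; apply: le_lt_trans tm _.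
    by rewrite ltr_pdivrMr // mulr_natr mulr2n ltrDl.
  by split=> //; rewrite distrC.
have dT t : U t -> differentiable T t by exact: smooth_diff.
have lip a b : `|a - t0| <= m -> `|b - t0| <= m ->
    `|T b - T a - A * (b - a)| <= `|A| / 2 * `|b - a|.
  move=> am bm; pose g (t : F) := T t - A * t.
  have -> : T b - T a - A * (b - a) = g b - g a by rewrite /g; ring.
  apply: (@mean_value g t0 m) => //; first exact: ltW; first by rewrite gtr0_real.
  move=> t /Hm[Ut Ht].
  have dAt : differentiable (fun t : F => A * t) t by exact: differentiableZ.
  split; first by apply: differentiableB => //; exact: dT.
  rewrite derive1E derivativeB //; last exact: dT.
  rewrite [X in _ - X](_ : _ = A) -?derive1E //.
  by rewrite derive1E (derivativeM _ (differentiable_cst _ _)) // derive_id derivativeC mulr1 mul0r addr0.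
have lip' a b : `|a - t0| <= m -> `|b - t0| <= m ->
    `|A| / 2 * `|b - a| <= `|T b - T a|.
  move=> am bm; have := lip _ _ am bm => H.
  have : `|A| * `|b - a| <= `|T b - T a| + `|A| / 2 * `|b - a|.
    rewrite -normrM -[A * _](subKr (T b - T a)).
    by apply: le_trans (ler_normB _ _) _; rewrite lerD2l.
  rewrite (_ : `|A| * `|b - a| = `|A| / 2 * `|b - a| + `|A| / 2 * `|b - a|) ?lerD2r //.
  by field.
pose V := [set t : F | `|t - t0| < m].
have oV : open V.
  rewrite (_ : V = ball t0 m); first exact: ball_open.
  by apply/funext => t; rewrite /V /ball /= distrC.
have VU : V `<=` U by move=> t /ltW /Hm[].
have inj a b : V a -> V b -> T a = T b -> a = b.
  move=> /ltW Va /ltW Vb E; have := lip' _ _ Va Vb; rewrite E subrr normr0.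
  rewrite pmulr_rle0 // normr_le0 subr_eq0 => /eqP //.
pose S (y : F) := xget 0 [set t | V t /\ T t = y].
have ST t : V t -> S (T t) = t.
  move=> Vt; rewrite /S; case: xgetP => [x -> [Vx /inj]|/(_ t)]; first exact.
  by move=> /(_ (conj Vt erefl)).
have dT0 t : V t -> derive1 T t != 0.
  move=> /ltW /Hm[_ H]; apply/eqP => H0; move: H; rewrite H0 sub0r normrN.
  rewrite ler_pdivlMr // mulr_natr mulr2n gerDl => /le_lt_trans /(_ nA).
  by rewrite ltxx.
have oTV : open (T @` V).
  rewrite openE => _ [t1 Vt1 <-].
  (* Iterates and limit stay within 4 M of [t1] with M < d, well inside the remaining distance 8 d
     to the boundary of [V]. *)
  pose d := (m - `|t1 - t0|) / 8.
  have d0 : 0 < d by rewrite divr_gt0 // subr_gt0.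
  apply/nbhs_ballP; exists (`|A| * d); first by rewrite /= mulr_gt0.
  move=> /= y; rewrite /ball /= => yd; move: (y : F) yd => {}y yd.
  pose M : F := `|T t1 - y| / `|A|.
  have M0 : 0 <= M by rewrite divr_ge0.
  have q0 n : 0 <= 2 * M / 2 ^+ n.
    by apply: divr_ge0; [apply: mulr_ge0|apply: exprn_ge0]; rewrite ?ler0n.
  have Md : M < d by rewrite /M ltr_pdivrMr // mulrC.
  (* Newton's method for T t = y with the constant slope [A]. By [lip] each step is at most half the
     preceding one, the first having length [M]. *)
  pose s n := iter n (fun t => t + (y - T t) / A) t1.
  have Vs t : `|t - t1| <= 4 * M -> V t.
    move=> tM; rewrite /V /= -[t](subrK t1) -addrA.
    apply: le_lt_trans (ler_normD _ _) _.
    apply: (@lt_le_trans _ _ (8 * d + `|t1 - t0|)); last first.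
      by rewrite (_ : 8 * d = m - `|t1 - t0|) ?subrK //; rewrite /d; field.
    rewrite ltrD2r; apply: le_lt_trans tM _.
    apply: (@lt_trans _ _ (4 * d)); first by rewrite ltr_pM2l.
    by rewrite ltr_pM2r // ltr_nat.
  have key n : `|s n.+1 - s n| <= M / 2 ^+ n /\ `|s n - t1| <= 2 * M - 2 * M / 2 ^+ n.
    elim: n => [|n [H1 H2]].
      rewrite /= subrr normr0 expr0 !divr1 subrr addrAC subrr add0r.
      by rewrite normrM normfV distrC; split.
    have H2' : `|s n.+1 - t1| <= 2 * M - 2 * M / 2 ^+ n.+1.
      rewrite -[s n.+1](subrK (s n)) -addrA.
      apply: le_trans (ler_normD _ _) _; apply: le_trans (lerD H1 H2) _.
      have -> : 2 * M / 2 ^+ n.+1 = M / 2 ^+ n.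
        by rewrite exprS; field; rewrite ?expf_neq0 ?pnatr_eq0.
      rewrite -[2 * M / _]mulrA; set w := M / 2 ^+ n.
      by rewrite (_ : w + _ = 2 * M - w) //; ring.
    have V1 : V (s n).
      apply: Vs; apply: le_trans H2 _; apply: (@le_trans _ _ (2 * M)).
        by rewrite gerBl.
      by apply: ler_wpM2r => //; rewrite ler_nat.
    have V2 : V (s n.+1).
      apply: Vs; apply: le_trans H2' _; apply: (@le_trans _ _ (2 * M)).
        by rewrite gerBl.
      by apply: ler_wpM2r => //; rewrite ler_nat.
    split=> //.
    have -> : s n.+2 - s n.+1 = - (T (s n.+1) - T (s n) - A * (s n.+1 - s n)) / A.
      rewrite [s n.+2]iterS -/(s n.+1).
      have -> : A * (s n.+1 - s n) = y - T (s n).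
        by rewrite [s n.+1]iterS -/(s n) addrAC subrr add0r mulrC divfK.
      by rewrite addrAC subrr add0r; congr (_ / _); ring.
    rewrite normrM normrN normfV ler_pdivrMr //.
    apply: le_trans (lip _ _ (ltW V1) (ltW V2)) _.
    apply: (@le_trans _ _ (`|A| / 2 * (M / 2 ^+ n))); first by rewrite ler_pM2l.
    by rewrite exprS le_eqVlt; apply/orP; left; apply/eqP; field; rewrite ?expf_neq0 ?pnatr_eq0.
  have [l Hl] := cF (fun n => (key n).1).
  have Vl : V l by apply: Vs; have := Hl 0%N; rewrite expr0 divr1.
  exists l => //; apply/eqP; rewrite -subr_eq0 -normr_le0.
  (* [T l] is compared with [y] through the n-th iterate: the remainder in [lip] and [A] times the
     distance from [l] to the next iterate are each at most 4 |A| M / 2^n. *)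
  apply: (@dyadic_le `|T l - y| 0 (8 * `|A| * M)); rewrite ?normr_real //.
    by rewrite mulr_ge0 // mulr_ge0.
  move=> n; rewrite add0r.
  have Vsn : V (s n).
    have [_ H] := key n; apply: Vs; apply: le_trans H _.
    apply: (@le_trans _ _ (2 * M)).
      by rewrite gerBl.
    by apply: ler_wpM2r => //; rewrite ler_nat.
  have -> : T l - y = (T l - T (s n) - A * (l - s n)) + A * (l - s n.+1).
    rewrite [s n.+1]iterS -/(s n).
    have -> : A * (l - (s n + (y - T (s n)) / A)) = A * (l - s n) - (y - T (s n)).
      by rewrite opprD addrA mulrBr; congr (_ - _); rewrite mulrC divfK.
    by ring.
  apply: le_trans (ler_normD _ _) _.
  have E : 8 * `|A| * M / 2 ^+ n = `|A| * (4 * (M / 2 ^+ n)) + `|A| * (4 * (M / 2 ^+ n)).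
    by ring.
  rewrite E; apply: lerD.
    apply: le_trans (lip _ _ (ltW Vsn) (ltW Vl)) _.
    apply: le_trans (ler_wpM2l (ltW hA) (Hl n)) _.
    apply: ler_wpM2r; first by rewrite mulr_ge0 // divr_ge0 ?exprn_ge0.
    by rewrite ler_pdivrMr // mulr_natr mulr2n lerDl.
  rewrite normrM; apply: ler_wpM2l => //.
  apply: le_trans (Hl n.+1) _; apply: ler_wpM2l => //.
  apply: ler_wpM2l => //; rewrite lef_pV2 ?posrE ?exprn_gt0 // exprS ler_peMl ?exprn_ge0 //.
  by rewrite ler1n.
have dS t : V t -> differentiable S (T t) /\ derive1 S (T t) = (derive1 T t)^-1.
  move=> Vt; set B := derive1 T t; have B0 : B != 0 by exact: dT0.
  have nB : 0 < `|B| by rewrite normr_gt0.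
  apply: derive1_of_eps => e e0.
  (* Chosen so that dividing by [B] and using |A| / 2 |k| <= |h| leaves an error of exactly e
     |h|. *)
  pose e' := e * `|B| * `|A| / 2.
  have e'0 : 0 < e' by rewrite divr_gt0 // !mulr_gt0.
  have [d d0 Hd] := derive1_eps (dT _ (VU _ Vt)) e'0.
  have /nbhs_ballP[r1 /= r10 Hr1] : nbhs (T t) (T @` V).
    by apply: open_nbhs_nbhs; split=> //; exists t.
  pose r := `|A| / 2 * d.
  have r0 : 0 < r by rewrite mulr_gt0.
  have [q q0 [qr1 qr]] : exists2 q, 0 < q & q <= r1 /\ q <= r.
    have [h|h] := real_leP (gtr0_real r10) (gtr0_real r0).
      by exists r1.
    by exists r => //; split=> //; exact: ltW.
  exists q => // h hq.
  have [t2 Vt2 E2] : (T @` V) (T t + h).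
    apply: Hr1; rewrite /ball /= opprD addrA subrr sub0r normrN.
    exact: lt_le_trans qr1.
  rewrite -E2 !ST //; pose k := t2 - t.
  have hE : h = T t2 - T t by rewrite E2 addrAC subrr add0r.
  have kh : `|A| / 2 * `|k| <= `|h| by rewrite hE; apply: lip'; exact: ltW.
  have kd : `|k| < d.
    rewrite -(ltr_pM2l hA); apply: le_lt_trans kh _; exact: lt_le_trans qr.
  have := Hd k kd; rewrite /k subrKC -hE -/k -/B => Hk.
  have -> : k - B^-1 * h = - (h - B * k) / B.
    by rewrite opprB mulrBl mulrAC divff // mul1r mulrC.
  rewrite normrM normrN normfV ler_pdivrMr //; apply: le_trans Hk _.
  rewrite /e' (_ : _ * `|k| = e * `|B| * (`|A| / 2 * `|k|)); last by ring.
  by rewrite [leRHS]mulrAC; apply: ler_wpM2l => //; rewrite mulr_ge0 ?(ltW e0).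
exists V, S; split=> //; first by split=> //; rewrite /V /= subrr normr0.
(* Bootstrapping: the derivative of [S] is a smooth function evaluated at [S], so n-fold
   differentiability of [S] gives one order more. *)
split=> // n; elim: n => // n IH; split=> [_ [t Vt <-]|v]; first by have [] := dS t Vt.
have sTi : smooth_on V (fun t => (derive1 T t)^-1).
  by apply: smoothV => //; apply: smooth_derive1; exact: smooth_sub sT.
apply: (@ndiff_eq _ _ _ _ _ (fun y => (derive1 T (S y))^-1 * v)) => //.
  move=> _ [t Vt <-]; have [h1 h2] := dS t Vt.
  rewrite ST // -h2 -[in 'D_v _ _](mulr1 v) derivative_scalev // derive1E mulrC.
  by [].
apply: ndiffM => //; last exact: smooth_cst.
apply: (@ndiff_comp1 _ _ n (T @` V) V (fun t => (derive1 T t)^-1)) => //.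
by move=> _ [t Vt <-]; rewrite ST.
Qed.

End MeanValue.

(** * Linear algebra of jets *)

Section JetAlgebra.
Variables (F : fieldType) (r : nat).
Implicit Types J : 'M[F]_(r, r.+1).

Definition jet_wronskian J : F := \det (col' ord_max J).

(* The coefficients (a_0, ..., a_(r-1), 1) of the operator annihilating the
   functions with jets J. *)
Definition annihilator J : 'cV[F]_r.+1 :=
  \col_m if unlift ord_max m is Some k
         then - (invmx (col' ord_max J) *m col ord_max J) k ord0 else 1.

Lemma annihilator_max J : annihilator J ord_max ord0 = 1.
Proof. by rewrite mxE unlift_none. Qed.

Lemma mulmx_col' m (A : 'M[F]_(m, r.+1)) (n : 'I_r.+1) (b : 'cV[F]_r.+1) :
  A *m b = col' n A *m row' n b + b n ord0 *: col n A.
Proof.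
apply/matrixP => i j; rewrite ord1 !mxE (bigD1_ord n) //= addrC mulrC.
by congr (_ + _); apply: eq_bigr => k _; rewrite !mxE.
Qed.

Lemma annihilatorP J : jet_wronskian J != 0 -> J *m annihilator J = 0.
Proof.
move=> W; rewrite (mulmx_col' _ ord_max) annihilator_max scale1r.
have -> : row' ord_max (annihilator J) = - (invmx (col' ord_max J) *m col ord_max J).
  by apply/matrixP => i j; rewrite ord1 !mxE liftK mxE.
by rewrite mulmxN mulKVmx ?addNr // unitmxE unitfE.
Qed.

(** The kernel of [J] is a line: its first r columns form an invertible matrix, so a kernel vector
    with last entry 0 vanishes. *)
Lemma annihilator_uniq J (b : 'cV[F]_r.+1) : jet_wronskian J != 0 ->
  J *m b = 0 -> b = b ord_max ord0 *: annihilator J.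
Proof.
move=> W Jb; apply/eqP; rewrite -subr_eq0; set d := b - _.
have dm : d ord_max ord0 = 0 by rewrite /d !mxE unlift_none mulr1 subrr.
have Jd : J *m d = 0.
  by rewrite /d mulmxBr Jb -scalemxAr annihilatorP // scaler0 subr0.
have : row' ord_max d = 0.
  move: Jd; rewrite (mulmx_col' _ ord_max) dm scale0r addr0 => /(congr1 (mulmx (invmx (col' ord_max J)))).
  by rewrite mulKmx ?mulmx0 // unitmxE unitfE.
move=> d'; apply/eqP/matrixP => i j; rewrite ord1.
case: (unliftP ord_max i) => [k ->|->]; last by rewrite dm mxE.
by have := congr1 (fun A : 'cV_r => A k ord0) d'; rewrite !mxE.
Qed.

(** Cramer's rule without signs; it turns the constraints D_n = 0 into a_n = 0. If the minor is
    singular, a kernel vector of it padded by 0 in place n is a nonzero kernel vector of [J], hence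
    a multiple of the annihilator. *)
Lemma minor_annihilator J (n : 'I_r.+1) : n != ord_max -> jet_wronskian J != 0 ->
  (\det (col' n J) = 0) <-> (annihilator J n ord0 = 0).
Proof.
move=> nm W; split=> [d0|a0].
  have /eqP/det0P[v v0 vJ] : \det (col' n J)^T = 0 by rewrite det_tr.
  pose b : 'cV[F]_r.+1 := \col_m if unlift n m is Some k then v ord0 k else 0.
  have bn : b n ord0 = 0 by rewrite mxE unlift_none.
  have rb : row' n b = v^T.
    by apply/matrixP => i j; rewrite ord1 !mxE liftK.
  have Jb : J *m b = 0.
    rewrite (mulmx_col' _ n) bn scale0r addr0 rb.
    by rewrite -[col' n J]trmxK -trmx_mul vJ trmx0.
  have bE := annihilator_uniq W Jb.
  have bm0 : b ord_max ord0 != 0.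
    apply: contraNneq v0 => bm; move: bE; rewrite bm scale0r => b0.
    by rewrite -[v]trmxK -rb b0; apply/eqP/matrixP => i j; rewrite !mxE.
  have := congr1 (fun A : 'cV_r.+1 => A n ord0) bE; rewrite bn mxE => /esym/eqP.
  by rewrite mulf_eq0 (negPf bm0) => /eqP.
apply/eqP; apply: contraT => d0.
have := annihilatorP W; rewrite (mulmx_col' _ n) a0 scale0r addr0.
move=> /(congr1 (mulmx (invmx (col' n J)))); rewrite mulKmx ?mulmx0 ?unitmxE ?unitfE // => H.
case: (unliftP n ord_max) => [k km|h]; last by rewrite h eqxx in nm.
have := congr1 (fun A : 'cV_r => A k ord0) H; rewrite !mxE -km unlift_none.
by move/eqP; rewrite oner_eq0.
Qed.

(** The bordered matrix sends the annihilator to a multiple of the last basis vector. Multiplying by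
    the adjugate and reading the last entry, where the annihilator is 1, gives the determinant; the
    cofactor that appears is the Wronskian. *)
Lemma det_append_row J (x : 'rV[F]_r.+1) :
  \det (\matrix_(i < r.+1, m < r.+1)
          if unlift ord_max i is Some k then J k m else x ord0 m)
  = jet_wronskian J * (x *m annihilator J) ord0 ord0 \/ jet_wronskian J = 0.
Proof.
have [->|W] := eqVneq (jet_wronskian J) 0; [by right|left].
set A := (X in \det X).
have Aa : A *m annihilator J = (x *m annihilator J) ord0 ord0 *: delta_mx ord_max ord0.
  apply/matrixP => i j; rewrite ord1 [RHS]mxE.
  case: (unliftP ord_max i) => [k ->|->].
    rewrite [X in _ = _ * X]mxE eq_sym (negPf (neq_lift _ _)) mulr0.
    have := congr1 (fun B : 'cV_r => B k ord0) (annihilatorP W).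
    rewrite !mxE => H; rewrite -[RHS]H; apply: eq_bigr => m _.
    by rewrite !mxE liftK.
  rewrite [X in _ = _ * X]mxE !eqxx mulr1 !mxE; apply: eq_bigr => m _.
  by rewrite !mxE unlift_none.
have := congr1 (mulmx (\adj A)) Aa; rewrite mulmxA mul_adj_mx mul_scalar_mx.
rewrite -scalemxAr => /(congr1 (fun B : 'cV_r.+1 => B ord_max ord0)).
rewrite mxE annihilator_max mulr1 => ->; rewrite mxE mulrC; congr (_ * _).
rewrite mxE (bigD1 ord_max) //= !mxE !eqxx mulr1 big1 ?addr0; last first.
  by move=> i im; rewrite !mxE (negPf im) mulr0.
rewrite /cofactor addnn -signr_odd odd_double expr0 mul1r; congr (\det _).
by apply/matrixP => i k; rewrite !mxE liftK.
Qed.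

End JetAlgebra.

Lemma sum_combination (F : numFieldType) n (f a b d : 'I_n -> F) (k k' o s : F) :
  \sum_j f j * ((k - s * k') * a j + o * (b j - s * d j)) =
  k * (\sum_j f j * a j) + o * (\sum_j f j * b j)
  - s * (k' * (\sum_j f j * a j) + o * (\sum_j f j * d j)).
Proof.
rewrite mulrDr !mulr_sumr -!big_split /= -sumrB; apply: eq_bigr => j _; ring.
Qed.

(** Rewrites the transformation rule for b, found for points of the equation, in the form b~ -
    alpha~ x~ = lambda (b - alpha x), which makes sense at all jets. *)
Lemma rhs_transform (F : numFieldType) r (x xi : 'rV[F]_r.+1) (Q : 'M[F]_r.+1)
    (a a' : 'cV[F]_r.+1) (l b b' : F) : Q *m a' = l *: a ->
  b' = l * (b + (xi *m a) ord0 ord0) ->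
  b' = l * (b - (x *m a) ord0 ord0) + ((x + xi) *m Q *m a') ord0 ord0.
Proof.
move=> QE ->; have -> : ((x + xi) *m Q *m a') ord0 ord0 = l * ((x *m a) ord0 ord0 + (xi *m a) ord0 ord0).
  by rewrite -mulmxA QE -scalemxAr mxE mulmxDl [X in _ * X]mxE.
ring.
Qed.

Section ParamJets.
Variables (F : numFieldType) (r : nat).
Implicit Types th : param F r.

Definition jetmx th (t : F) : 'M[F]_(r, r.+1) :=
  \matrix_(i < r, m < r.+1) derive1n m (chi th i) t.

Lemma jet_wronskianE th t : jet_wronskian (jetmx th t) = wronskian th t.
Proof.
congr (\det _); apply/matrixP => i m; rewrite !mxE lift_max //.
Qed.

Lemma on_equationE th (z : jet F r) : wronskian th z.1 != 0 ->
  on_equation th z <->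
  (z.2 *m annihilator (jetmx th z.1)) ord0 ord0 = rhs th z.1.
Proof.
move=> W; rewrite /on_equation /wronskian_with.
have := det_append_row (jetmx th z.1) z.2.
rewrite jet_wronskianE => -[E|/eqP]; last by rewrite (negPf W).
rewrite (_ : \det _ = wronskian th z.1 * (z.2 *m annihilator (jetmx th z.1)) ord0 ord0); last first.
  rewrite -E; congr (\det _); apply/matrixP => i m; rewrite !mxE.
  by case: (unlift ord_max i) => // k; rewrite mxE.
by rewrite mulrAC mulfV // mul1r.
Qed.

Lemma minorE th t (n : nat) (hn : (n < r)%N) : wronskian th t != 0 ->
  wronskian_minor n th t = 0 <->
  annihilator (jetmx th t) (inord n) ord0 = 0.
Proof.
move=> W; rewrite -minor_annihilator ?jet_wronskianE //; last first.
  by apply/eqP => /(congr1 val) /=; rewrite inordK ?ltnS ?(ltnW hn) // => E; move: hn; rewrite E ltnn.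
rewrite (_ : wronskian_minor n th t = \det (col' (inord n) (jetmx th t))) //.
by congr (\det _); apply/matrixP => i m; rewrite !mxE /= inordK // ltnS ltnW.
Qed.

End ParamJets.

(** * Prolongation *)

Section LieDerivative.
Variables (F : numFieldType) (E : normedModType F) (V : E -> E).

Definition Lie (g : E -> F) (q : E) : F := 'D_(V q) g q.

Lemma Lie_near (f g : E -> F) (q : E) :
  (\forall p \near q, f p = g p) -> Lie f q = Lie g q.
Proof. exact: near_eq_derive. Qed.

(** The field is a combination of constant directions with smooth coefficients, which reduces its
    action to ordinary directional derivatives. *)
Lemma smooth_Lie (I : finType) (v0 : E) (l : I -> E -> F) (e : I -> E)
    (U : set E) (g : E -> F) :
  (forall q, V q = v0 + \sum_i l i q *: e i) -> open U ->
  (forall i, smooth_on U (l i)) -> smooth_on U g -> smooth_on U (Lie g).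
Proof.
move=> VE oU sl sg.
apply: (@smooth_eq _ _ _ U (fun q => 'D_v0 g q + \sum_i l i q * 'D_(e i) g q)) => //.
  move=> q Uq; have dg := smooth_diff sg Uq.
  rewrite /Lie VE derivative_addv // derivative_sumv //; congr (_ + _).
  by apply: eq_bigr => i _; rewrite derivative_scalev.
apply: smoothD => //; first exact: smooth_deriv.
by apply: smooth_sum => // i _; apply: smoothM => //; exact: smooth_deriv.
Qed.

(* Order filtration: [S m] is the space of directions of order greater than m,
   and the field V shifts the order by one. *)
Variables (N : E -> E) (S : nat -> set E).
Hypothesis VN : forall q w, V (q + w) = V q + N w.
Hypothesis SN : forall m w, S m.+1 w -> S m (N w).
Hypothesis SS : forall m w, S m.+1 w -> S m w.
Hypothesis SD : forall m (c : F) w w', S m w -> S m w' -> S m (c *: w + w').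

(** Invariance under [S m] says that [g] depends only on the coordinates of order at most m. *)
Definition of_order m (g : E -> F) := forall q w, S m w -> g (q + w) = g q.

Lemma of_orderS m g : of_order m g -> of_order m.+1 g.
Proof. by move=> og q w /SS; apply: og. Qed.

Lemma of_order_le m n g : (m <= n)%N -> of_order m g -> of_order n g.
Proof.
by move=> /subnK <-; elim: (n - m)%N => [|k IH] // /IH; exact: of_orderS.
Qed.

Lemma of_orderD m f g : of_order m f -> of_order m g ->
  of_order m (fun q => f q + g q).
Proof. by move=> of_ og q w Sw; rewrite of_ // og. Qed.

Lemma of_orderM m f g : of_order m f -> of_order m g ->
  of_order m (fun q => f q * g q).
Proof. by move=> of_ og q w Sw; rewrite of_ // og. Qed.

Lemma of_order_cst m c : of_order m (fun=> c).
Proof. by []. Qed.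

Lemma of_order_deriv m g q v w : of_order m g -> S m w ->
  'D_v g (q + w) = 'D_v g q.
Proof.
move=> og Sw; rewrite /derive; set d := (fun _ : F => _); set d' := (fun _ : F => _).
suff -> : d = d' by [].
by rewrite funeqE => h; rewrite /d /d' /= addrA !(og _ w Sw).
Qed.

Lemma of_order_deriv0 m g q v w : of_order m g -> S m w ->
  'D_(v + w) g q = 'D_v g q.
Proof.
move=> og Sw; rewrite /derive; set d := (fun _ : F => _); set d' := (fun _ : F => _).
suff -> : d = d' by [].
rewrite funeqE => h; rewrite /d /d' /= [h *: (v + w)]scalerDr addrAC og //.
by rewrite -[_ *: w]addr0; apply: SD => //; rewrite -(subrr w) -scaleN1r addrC; exact: SD.
Qed.

Lemma of_order_Lie m g : of_order m g -> of_order m.+1 (Lie g).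
Proof.
move=> og q w Sw; rewrite /Lie VN.
by rewrite (of_order_deriv _ _ og (SS Sw)) (of_order_deriv0 _ _ og (SN Sw)).
Qed.

Lemma deriv_of_order m g q w : of_order m g -> S m w -> 'D_w g q = 0.
Proof.
by move=> og Sw; rewrite -[w]add0r (of_order_deriv0 _ _ og Sw) derive0.
Qed.

(** Moving along [w] does not affect [g] itself but tilts the field by multiples of [N w]. So
    [Lie g] is affine on that line, and its slope is read off without second derivatives. *)
Lemma deriv_Lie m g q w : of_order m g -> S m w -> differentiable g q ->
  (forall h : F, N (h *: w) = h *: N w) ->
  'D_w (Lie g) q = 'D_(N w) g q.
Proof.
move=> og Sw dg Nw.
have Sh h : S m (h *: w).
  by rewrite -[_ *: w]addr0; apply: SD => //; rewrite -(subrr w) -scaleN1r addrC; exact: SD.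
have E1 (h : F) : Lie g (q + h *: w) = Lie g q + h * 'D_(N w) g q.
  rewrite /Lie VN (of_order_deriv _ _ og (Sh h)) Nw derivative_addv //.
  by rewrite derivative_scalev.
apply/lim_near_cst => //=; near=> h.
have h0 : h != 0 by near: h; exact: nbhs_dnbhs_neq.
by rewrite [_ + q]addrC E1 addrAC subrr add0r /GRing.scale /= mulrA mulVf // mul1r.
Unshelve. all: by end_near. Qed.

End LieDerivative.

Section ProlongMatrix.
Variable F : numFieldType.

(* Coefficients of the k-th derivative with respect to T of [X1 * y] in the
   derivatives of y with respect to t. *)
Fixpoint prolong_mx (T X1 : F -> F) (k j : nat) : F -> F :=
  if k is k'.+1 then fun t =>
    (derive1 (prolong_mx T X1 k' j) t
     + (if j is j'.+1 then prolong_mx T X1 k' j' t else 0)) / derive1 T t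
  else if j is 0%N then X1 else fun=> 0.

Variables (T X1 : F -> F) (I : set F).
Hypothesis oI : open I.
Hypothesis sT : smooth_on I T.
Hypothesis T0 : forall t, I t -> derive1 T t != 0.
Hypothesis sX : smooth_on I X1.
Local Notation P := (prolong_mx T X1).

Lemma smooth_prolong_mx k j : smooth_on I (P k j).
Proof.
elim: k j => [[|j]|k IH j] //=; first exact: smooth_cst.
apply: smooth_div => //; last exact: smooth_derive1.
apply: smoothD => //; first exact: smooth_derive1.
by case: j => // ; exact: smooth_cst.
Qed.

Lemma prolong_mx_gt k j t : I t -> (k < j)%N -> P k j t = 0.
Proof.
elim: k j t => [[|j]|k IH [|j]] // t It kj /=.
rewrite (IH j) // addr0.
rewrite (@derive1_near _ _ (fun=> 0)) ?derive1_cst ?mul0r //.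
by apply: filterS (open_near oI It) => u Iu; apply: IH => //; exact: ltnW.
Qed.

Lemma prolong_mx_diag k t : I t -> P k k t = X1 t / derive1 T t ^+ k.
Proof.
elim: k t => [|k IH] t It /=; first by rewrite expr0 divr1.
rewrite (@derive1_near _ _ (fun=> 0)); last first.
  by apply: filterS (open_near oI It) => u Iu; apply: prolong_mx_gt.
by rewrite derive1_cst add0r IH // exprSr invfM mulrA.
Qed.

(** Stated for any field [V] with a clock [tau] advancing at unit speed, in order to serve both
    functions of t and functions on the jet space with the total derivative. *)
Lemma prolong_mx_expand (E : normedModType F) (V : E -> E) (tau : E -> F)
    (W : set E) (n : nat) (L Q : nat -> E -> F) :
  open W -> (forall q, W q -> I (tau q)) ->
  (forall q, W q -> differentiable tau q /\ 'D_(V q) tau q = 1) ->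
  (forall j q, (j < n)%N -> W q ->
     differentiable (L j) q /\ 'D_(V q) (L j) q = L j.+1 q) ->
  (forall q, W q -> Q 0%N q = X1 (tau q) * L 0%N q) ->
  (forall k q, (k < n)%N -> W q ->
     Q k.+1 q = 'D_(V q) (Q k) q / derive1 T (tau q)) ->
  forall k q, (k <= n)%N -> W q ->
    Q k q = \sum_(j < k.+1) P k j (tau q) * L j q.
Proof.
move=> oW WI Htau HL Q0 QS; elim=> [|k IH] q kn Wq.
  by rewrite Q0 // big_ord_recl big_ord0 addr0.
rewrite QS //.
rewrite (near_eq_derive (g := fun q => \sum_(j < k.+1) P k j (tau q) * L j q)); last first.
  by apply: filterS (open_near oW Wq) => u Wu; apply: IH => //; exact: ltnW.
have [dtau Dtau] := Htau _ Wq; have It := WI _ Wq.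
have dP j : differentiable (P k j) (tau q).
  exact: smooth_diff (smooth_prolong_mx k j) It.
have dPt j : differentiable (fun q => P k j (tau q)) q.
  exact: differentiable_comp.
have Hj (j : 'I_k.+1) : 'D_(V q) (fun q => P k j (tau q) * L j q) q =
    P k j (tau q) * L j.+1 q + derive1 (P k j) (tau q) * L j q.
  have [dL DL] := HL j q (leq_trans (ltn_ord j) kn) Wq.
  by rewrite derivativeM // DL derivative_comp1 // Dtau mulr1.
have -> : 'D_(V q) (fun q => \sum_(j < k.+1) P k j (tau q) * L j q) q =
    \sum_(j < k.+1) (P k j (tau q) * L j.+1 q + derive1 (P k j) (tau q) * L j q).
  have dd (j : 'I_k.+1) : derivable (fun q => P k j (tau q) * L j q) q (V q).
    apply: diff_derivable; have [dL _] := HL j q (leq_trans (ltn_ord j) kn) Wq.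
    exact: differentiableM.
  rewrite (_ : (fun q => _) = \sum_(j < k.+1) (fun q => P k j (tau q) * L j q)); last first.
    by apply/funext => u; rewrite fct_sumE.
  by rewrite derive_sum //; apply: eq_bigr => j _; rewrite Hj.
rewrite mulr_suml; under [LHS]eq_bigr do rewrite mulrDl.
rewrite big_split /=; under [RHS]eq_bigr do rewrite mulrDl mulrDl.
(* The two groups of terms are those where the coefficient is differentiated and those where the
   order of y rises, matching the two summands in the recursion of [prolong_mx]. *)
rewrite [RHS]big_split /= addrC; congr (_ + _).
  rewrite [RHS]big_ord_recr /= (@derive1_near _ (P k k.+1) (fun=> 0)); last first.
    by apply: filterS (open_near oI It) => u Iu; apply: prolong_mx_gt.
  rewrite derive1_cst !mul0r addr0; apply: eq_bigr => j _.
  by rewrite mulrAC.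
rewrite [RHS]big_ord_recl /= !mul0r add0r; apply: eq_bigr => j _.
by rewrite mulrAC.
Qed.

Lemma prolong_mx_derive1n (J : set F) (y' y : F -> F) :
  (forall t, I t -> J (T t)) -> smooth_on J y' -> smooth_on I y ->
  (forall t, I t -> y' (T t) = X1 t * y t) ->
  forall k t, I t -> derive1n k y' (T t) = \sum_(j < k.+1) P k j t * derive1n j y t.
Proof.
move=> IJ sy' sy H k t It.
apply: (@prolong_mx_expand F (fun=> 1) id I k (fun j => derive1n j y)
          (fun k t => derive1n k y' (T t))) => // [q Iq|j q _ Iq|j q _ Iq].
- by split; [exact/derivable1_diffP/derivable_id|exact: derive_id].
- split; first exact: smooth_diff (smooth_derive1n j sy) Iq.
  by rewrite derive1nS derive1E.
rewrite (derivative_comp1 (f := derive1n j y') (g := T)).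
- by rewrite -derive1E mulfK // T0.
- exact: smooth_diff sT Iq.
- exact: smooth_diff (smooth_derive1n j sy') (IJ _ Iq).
Qed.

End ProlongMatrix.

(** * The total derivative on the jet space, and the proof that T does not depend on x *)

Section Jets.
Variables (F : numFieldType) (r : nat).
Local Notation E := (F * 'rV[F]_r.+1)%type.

Definition jfield (z : E) : E :=
  (1, \row_(k < r.+1) if (k < r)%N then z.2 ord0 (inord k.+1) else 0).

Definition jshift (z : E) : E :=
  (0, \row_(k < r.+1) if (k < r)%N then z.2 ord0 (inord k.+1) else 0).

Definition jorder (m : nat) : set E :=
  [set w : E | w.1 = 0 /\ forall k : 'I_r.+1, (k <= m)%N -> w.2 ord0 k = 0].

Definition jcoord (k : nat) (z : E) : F := z.2 ord0 (inord k).

Local Notation D := (Lie jfield).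

Lemma jfield_shift z w : jfield (z + w) = jfield z + jshift w.
Proof.
congr (_, _); first by rewrite addr0.
by apply/matrixP => i j; rewrite !mxE; case: ifP; rewrite ?addr0 // mxE.
Qed.

Lemma jshift_order m w : jorder m.+1 w -> jorder m (jshift w).
Proof.
move=> [w1 w2]; split=> // k km; rewrite mxE; case: ifP => // kr.
by apply: w2; rewrite inordK.
Qed.

Lemma jorderS m w : jorder m.+1 w -> jorder m w.
Proof. by move=> [w1 w2]; split=> // k km; apply: w2; exact: leqW. Qed.

Lemma jorderD m (c : F) w w' : jorder m w -> jorder m w' -> jorder m (c *: w + w').
Proof.
move=> [w1 w2] [w1' w2']; split=> [|k km].
  by rewrite /= w1 w1' scaler0 addr0.
by rewrite !mxE w2 // w2' // mulr0 addr0.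
Qed.

Local Notation ordj := (of_order jorder).

Lemma smooth_jcoord k (U : set E) : open U -> smooth_on U (jcoord k).
Proof. by move=> oU; apply: smooth_coord => //; exact: smooth_snd. Qed.

Lemma jcoord_order k m : (k <= r)%N -> (k <= m)%N -> ordj m (jcoord k).
Proof.
by move=> kr km z w [_ H]; rewrite /jcoord mxE H ?addr0 // inordK.
Qed.

Lemma linear_jcoord k : linear (jcoord k).
Proof. by move=> c z z'; rewrite /jcoord !mxE. Qed.

Lemma continuous_jcoord k : continuous (jcoord k).
Proof.
move=> z; apply: differentiable_continuous.
by apply: smooth_diff (smooth_jcoord k (@openT _)) _.
Qed.

Lemma deriv_jcoord k z v : 'D_v (jcoord k) z = jcoord k v.
Proof. exact: derivative_linear (@linear_jcoord k) (@continuous_jcoord k). Qed.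

Lemma D_jcoord k z : (k < r)%N -> D (jcoord k) z = jcoord k.+1 z.
Proof.
by move=> kr; rewrite /Lie deriv_jcoord /jcoord mxE inordK ?kr // ltnS ltnW.
Qed.

Lemma smooth_D (U : set E) g : open U -> smooth_on U g -> smooth_on U (D g).
Proof.
move=> oU; apply: (smooth_Lie (v0 := ((1, 0) : E))
  (l := fun (k : 'I_r.+1) (z : E) => if (k < r)%N then jcoord k.+1 z else 0)
  (e := fun k : 'I_r.+1 => ((0, delta_mx ord0 k) : E))) => //.
  move=> z; rewrite /jfield; congr (_, _).
    by rewrite /= raddf_sum /= big1 ?addr0 // => k _; rewrite scaler0.
  rewrite /= add0r raddf_sum /=; apply/matrixP => i j; rewrite !mxE summxE ord1.
  rewrite (eq_bigr (fun k : 'I_r.+1 => (if (k < r)%N then jcoord k.+1 z else 0) * (j == k)%:R)).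
    by rewrite (bigD1 j) //= eqxx mulr1 big1 ?addr0 // => k; rewrite eq_sym => /negPf ->; rewrite mulr0.
  by move=> k _; rewrite !mxE ord1.
by move=> k; case: (k < r)%N; [exact: smooth_jcoord|exact: smooth_cst].
Qed.

Lemma linear_jet_base : linear (@jet_base F r).
Proof. by move=> c z z'; rewrite /jet_base /= !mxE. Qed.

Lemma continuous_jet_base : continuous (@jet_base F r).
Proof.
move=> z; apply: (@cvg_pair _ _ _ (nbhs z) (nbhs z.1) (nbhs (z.2 ord0 ord0))); first exact: cvg_fst.
have EE (x : E) : x.2 ord0 ord0 = jcoord 0 x.
  by rewrite /jcoord; congr (x.2 _ _); apply/val_inj; rewrite /= inordK.
by rewrite (EE z) (funext EE); exact: (@continuous_jcoord 0 z).
Qed.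

Lemma smooth_base (O : set (F * F)) (f : F * F -> F) : smooth_on O f ->
  smooth_on (@jet_base F r @^-1` O) (fun z => f (jet_base z)).
Proof.
by apply: smooth_linpre; [exact: linear_jet_base|exact: continuous_jet_base].
Qed.

Lemma open_base (O : set (F * F)) : open O -> open (@jet_base F r @^-1` O).
Proof. by move=> oO; apply: open_comp => // z _; exact: continuous_jet_base. Qed.

Lemma base_order (f : F * F -> F) : ordj 0 (fun z => f (jet_base z)).
Proof.
by move=> z w [w1 w2]; rewrite /jet_base /= mxE w2 // w1 !addr0.
Qed.

Hypothesis r0 : (0 < r)%N.

Lemma D_base (f : F * F -> F) z : differentiable f (jet_base z) ->
  D (fun z => f (jet_base z)) z =
    'D_(1, 0) f (jet_base z) + jcoord 1 z * 'D_(0, 1) f (jet_base z).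
Proof.
move=> df; pose LM := GRing.isLinear.Build _ _ _ _ _ linear_jet_base.
pose L : {linear E -> (F * F)%type} := HB.pack (@jet_base F r) LM.
rewrite /Lie (derive_linpre L) /= -[X in _ + X]derivative_scalev //.
rewrite -derivative_addv //; congr ('D_ _ _ _).
rewrite /jet_base /jfield /= mxE r0 /jcoord; congr (_, _).
  by rewrite /= scaler0 addr0.
by rewrite /= add0r [_ *: 1]mulr1.
Qed.

Section Prolongation.
Variables (O : set (F * F)) (phi : F * F -> F * F).
Hypothesis oO : open O.
Hypothesis sphi : smooth_on O phi.
Let T q := (phi q).1.
Let X q := (phi q).2.
Local Notation OJ := (@jet_base F r @^-1` O).
Local Notation Delta := (total_deriv_T phi : E -> F).

Lemma smooth_phi1 : smooth_on O T.
Proof.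
apply: (smooth_linpost (L := fun p : F * F => p.1)) => // p; exact: cvg_fst.
Qed.

Lemma smooth_phi2 : smooth_on O X.
Proof.
apply: (smooth_linpost (L := fun p : F * F => p.2)) => // p; exact: cvg_snd.
Qed.

Lemma smooth_Delta : smooth_on OJ Delta.
Proof.
by apply: smooth_D; [exact: open_base|exact: (smooth_base smooth_phi1)].
Qed.

Lemma DeltaE z : O (jet_base z) -> Delta z =
  'D_(1, 0) T (jet_base z) + jcoord 1 z * 'D_(0, 1) T (jet_base z).
Proof. by move=> Oz; apply: (@D_base T z); exact: smooth_diff smooth_phi1 Oz. Qed.

(* The (k+1)st prolonged coordinate is [prolong_num k / Delta ^+ (2 k + 1)]. *)
Fixpoint prolong_num (k : nat) : E -> F :=
  if k is k'.+1 then fun z => Delta z * D (prolong_num k') z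
    - (2 * k' + 1)%:R * prolong_num k' z * D Delta z
  else D (fun z => X (jet_base z)).

Lemma smooth_prolong_num k : smooth_on OJ (prolong_num k).
Proof.
have oJ := open_base oO.
elim: k => [|k IH] /=; first by apply: smooth_D => //; exact: (smooth_base smooth_phi2).
apply: smoothB => //; apply: smoothM => //.
- exact: smooth_Delta.
- exact: smooth_D.
- by apply: smoothM => //; exact: smooth_cst.
- by apply: smooth_D => //; exact: smooth_Delta.
Qed.

(** By the quotient rule D(N / Delta^m) / Delta = (Delta D N - m N D Delta) / Delta^(m+2): each
    prolongation raises the exponent by 2, starting from 1. *)
Lemma prolong_coordE k z : O (jet_base z) -> Delta z != 0 ->
  prolong_coord phi k.+1 z = prolong_num k z / Delta z ^+ (2 * k + 1).
Proof.
elim: k z => [|k IH] z Oz Dz; first by rewrite expr1.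
rewrite [LHS]/(D (prolong_coord phi k.+1) z / Delta z).
have oJ := open_base oO; have dDelta := smooth_diff smooth_Delta Oz.
have dN := smooth_diff (smooth_prolong_num k) Oz.
rewrite (@Lie_near _ _ _ _ (fun z => prolong_num k z * (Delta z ^+ (2 * k + 1))^-1)); last first.
  apply: filterS (open_near (open_neq0 oJ smooth_Delta) (conj Oz Dz)) => w [Ow Dw].
  exact: IH.
have dX m : differentiable (fun z => Delta z ^+ m) z.
  exact: smooth_diff (smoothX m oJ smooth_Delta) Oz.
have DX m : D (fun z => Delta z ^+ m.+1) z = m.+1%:R * Delta z ^+ m * D Delta z.
  elim: m => [|m IHm].
    by rewrite expr0 mulr1 mul1r; under eq_fun do rewrite expr1.
  rewrite /Lie; under eq_fun do rewrite exprS.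
  rewrite derivativeM // -[X in _ * X]/(D _ z) IHm -/(D Delta z).
  by rewrite [m.+2%:R]mulrS exprS; ring.
rewrite /Lie derivativeM //; last by apply: differentiableV => //; rewrite expf_neq0.
rewrite derivativeV ?expf_neq0 //.
rewrite -/(D (fun z => Delta z ^+ (2 * k + 1)) z) -/(D (prolong_num k) z) addn1 DX.
rewrite (_ : 2 * k.+1 + 1 = (2 * k).+3)%N; last by rewrite mulnS !addSn addn1.
rewrite (exprS _ (2 * k).+2) (exprS _ (2 * k).+1) !(exprS _ (2 * k)).
rewrite [prolong_num k.+1 z]/= addn1.
have alg (n dn d dd x c : F) : d != 0 -> x != 0 ->
   (n * (- (d * x)^-1 ^+ 2 * (c * x * dd)) + dn / (d * x)) / d
   = (d * dn - c * n * dd) / (d * (d * (d * x))).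
  by move=> d0 x0; field; rewrite x0 d0.
by apply: alg => //; rewrite expf_neq0.
Qed.

(** Isolates x^(2), whose coefficient is T_x: when T_x is nonzero, [D Delta] can be given any value
    by the choice of x^(2). *)
Lemma D_Delta z : (1 < r)%N -> O (jet_base z) -> D Delta z =
  D (fun w => 'D_(1, 0) T (jet_base w)) z
  + jcoord 1 z * D (fun w => 'D_(0, 1) T (jet_base w)) z
  + jcoord 2 z * 'D_(0, 1) T (jet_base z).
Proof.
move=> r1 Oz; have oJ := open_base oO.
have s1 v : smooth_on OJ (fun w => 'D_v T (jet_base w)).
  exact: (smooth_base (smooth_deriv v smooth_phi1)).
rewrite (@Lie_near _ _ _ _ (fun w => 'D_(1, 0) T (jet_base w)
    + jcoord 1 w * 'D_(0, 1) T (jet_base w))); last first.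
  by apply: filterS (open_near oJ Oz) => w; exact: DeltaE.
have d1 v := smooth_diff (s1 v) Oz.
have dj : differentiable (jcoord 1 : E -> F) z by exact: smooth_diff (smooth_jcoord 1 oJ) Oz.
rewrite /Lie derivativeD //; last exact: differentiableM.
by rewrite derivativeM // -[X in _ + (_ + X * _)]/(D (jcoord 1) z) D_jcoord // addrA.
Qed.

(* As [Delta] tends to 0 along a line of the source equation, the numerator of
   the highest prolonged coordinate tends to a nonzero value while all other
   terms of the target equation, cleared of denominators, tend to 0. *)
Lemma fibre_preserving (a a' : 'cV[F]_r.+1) (s s' : F) (p : F * F) :
  (2 < r)%N -> O p -> jac phi p != 0 ->
  a ord_max ord0 = 1 -> a' ord_max ord0 = 1 ->
  (forall z : E, jet_base z = p -> Delta z != 0 ->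
     (z.2 *m a) ord0 ord0 = s -> ((prolong phi z).2 *m a') ord0 ord0 = s') ->
  'D_(0, 1) T p = 0.
Proof.
move=> r2 Op Jp am a'm H; apply/eqP; apply: contraT => Tx0.
have oJ := open_base oO.
set Tx := 'D_(0, 1) T p in Tx0; pose Tt := 'D_(1, 0) T p.
(* The value of x^(1) at which [Delta] vanishes. *)
pose p0 := - Tt / Tx.
have r1 : (1 < r)%N by exact: ltnW.
pose i1 : 'I_r.+1 := inord 1; pose i2 : 'I_r.+1 := inord 2.
have v0 : nat_of_ord (ord0 : 'I_r.+1) = 0%N by [].
have v1 : nat_of_ord i1 = 1%N by rewrite inordK // ltnS ltnW.
have v2 : nat_of_ord i2 = 2%N by rewrite inordK // ltnS ltnW.
pose e k : 'rV[F]_r.+1 := delta_mx ord0 k.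
have eM k (c : 'cV[F]_r.+1) : (e k *m c) ord0 ord0 = c k ord0.
  by rewrite -rowE mxE.
(* Orders above 2 default to 0. The top one is then corrected in [zy] to satisfy the source
   equation, which leaves orders 0, 1, 2 untouched since r > 2. *)
pose zz (y : F) : 'rV[F]_r.+1 :=
  \row_k nth 0 [:: p.2; p0; y] k.
pose zy y : E := (p.1, zz y + (s - (zz y *m a) ord0 ord0) *: e ord_max).
have mE (k : nat) : (k <= r)%N -> nat_of_ord (inord k : 'I_r.+1) = k.
  by move=> kr; rewrite inordK // ltnS.
have emax (k : nat) : (k < r)%N -> e ord_max ord0 (inord k) = 0.
  move=> kr; rewrite mxE eqxx (_ : (_ == _) = false) //.
  by apply/eqP => /(congr1 val) /=; rewrite mE ?(ltnW kr) // => E; move: kr; rewrite E ltnn.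
have o0 : (ord0 : 'I_r.+1) = inord 0 by apply/val_inj; rewrite /= mE.
have zyk y k : (k < r)%N -> (zy y).2 ord0 (inord k) = nth 0 [:: p.2; p0; y] k.
  by move=> kr; rewrite [LHS]mxE [X in _ + X]mxE emax // mulr0 addr0 mxE mE // ltnW.
have zy0 y : jet_base (zy y) = p.
  by rewrite /jet_base o0 zyk //= -surjective_pairing.
have zy1 y : jcoord 1 (zy y) = p0 by rewrite /jcoord zyk.
have zy2 y : jcoord 2 (zy y) = y by rewrite /jcoord zyk.
have zya y : ((zy y).2 *m a) ord0 ord0 = s.
  by rewrite /zy /= mulmxDl -scalemxAl mxE [X in _ + X]mxE eM am mulr1 subrKC.
have Oz y : O (jet_base (zy y)) by rewrite zy0.
have D0 y : Delta (zy y) = 0.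
  by rewrite DeltaE // zy0 zy1 -/Tx -/Tt /p0 divfK // addrN.
pose c := D (fun w => 'D_(1, 0) T (jet_base w)) (zy 0)
  + p0 * D (fun w => 'D_(0, 1) T (jet_base w)) (zy 0).
have DB v y : D (fun w => 'D_v T (jet_base w)) (zy y) = D (fun w => 'D_v T (jet_base w)) (zy 0).
  rewrite !(@D_base ('D_v T)) ?zy0 ?zy1 //; exact: smooth_diff (smooth_deriv v smooth_phi1) Op.
(* With this x^(2) one has D Delta = 1 at the point where Delta = 0, so that the recursion for the
   numerators becomes N_(k+1) = -(2k+1) N_k. *)
pose y := (1 - c) / Tx; pose z0 := zy y.
have DD0 : D Delta z0 = 1.
  by rewrite /z0 D_Delta // zy1 zy2 !DB -/c zy0 -/Tx /y divfK // subrKC.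
(* Multiplied by T_x, this numerator is minus the Jacobian. *)
have N0 : prolong_num 0 z0 != 0.
  rewrite /= (@D_base X) ?zy0 ?zy1; last exact: smooth_diff smooth_phi2 Op.
  apply: contraNneq Jp => E0; rewrite /jac -/T -/X -/Tt -/Tx.
  have : Tx * ('D_(1, 0) X p + p0 * 'D_(0, 1) X p) = 0 by rewrite E0 mulr0.
  have Txp : Tx * p0 = - Tt by rewrite mulrC /p0 divfK.
  rewrite mulrDr mulrA Txp mulNr => /eqP.
  by rewrite subr_eq0 => /eqP ->; rewrite subrr.
have Nk k : prolong_num k z0 != 0.
  elim: k => [//|k IH] /=; rewrite D0 mul0r sub0r oppr_eq0 DD0 mulr1.
  by rewrite mulf_neq0 // pnatr_eq0 addn1.
(* A direction inside the source equation that changes x^(1); along it [Delta] is T_x times the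
   parameter. *)
pose w : E := (0, e i1 - a i1 ord0 *: e ord_max).
pose zt (t : F) := z0 + t *: w.
have i1E k : (k < r)%N -> e i1 ord0 (inord k) = (k == 1%N)%:R.
  move=> kr; rewrite mxE eqxx; congr ((_ : bool)%:R).
  by rewrite -val_eqE /= v1 mE // ltnW.
have ztk t k : (k < r)%N -> (zt t).2 ord0 (inord k) = z0.2 ord0 (inord k) + t * (k == 1%N)%:R.
  move=> kr; rewrite [LHS]mxE [X in _ + X]mxE; congr (_ + _ * _).
  by rewrite [LHS]mxE i1E // [X in _ + X]mxE [X in - X]mxE emax // mulr0 subr0.
have zt0 t : jet_base (zt t) = p.
  rewrite -[RHS](zy0 y) -/z0 /jet_base; congr (_, _); first by rewrite /= scaler0 addr0.
  by rewrite o0 ztk //= mulr0 addr0.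
have zt1 t : jcoord 1 (zt t) = p0 + t.
  by rewrite -(zy1 y) -/z0 /jcoord ztk //= mulr1.
have ztD t : Delta (zt t) = Tx * t.
  rewrite DeltaE ?zt0 // zt1 -/Tt -/Tx mulrDl /p0 divfK // addrA addrN add0r.
  exact: mulrC.
have zta t : ((zt t).2 *m a) ord0 ord0 = s.
  have wa : (w.2 *m a) ord0 ord0 = 0.
    by rewrite /w /= mulmxBl -scalemxAl [LHS]mxE [X in _ + X]mxE [X in _ - X]mxE !eM am mulr1 subrr.
  by rewrite /zt mulmxDl mxE zya -scalemxAl [X in _ + X]mxE wa mulr0 addr0.
(* The target equation multiplied by Delta^(2r-1), the denominator of its top derivative. Where
   Delta = 0 only the term of order r keeps no power of [Delta]. *)
pose h (z : E) := \sum_(k < r.+1) (if (k : nat) is j.+1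
    then prolong_num j z * Delta z ^+ (2 * (r - k)) else X (jet_base z) * Delta z ^+ (2 * r - 1)) * a' k ord0
  - s' * Delta z ^+ (2 * r - 1).
have sh : smooth_on OJ h.
  have sX m : smooth_on OJ (fun z => Delta z ^+ m) by apply: smoothX => //; exact: smooth_Delta.
  apply: smoothB => //; last by apply: smoothM => //; exact: smooth_cst.
  apply: smooth_sum => // k _; apply: smoothM => //; last exact: smooth_cst.
  case: (nat_of_ord k) => [|j]; apply: smoothM => //; last exact: smooth_prolong_num.
  exact: (smooth_base smooth_phi2).
have h0 t : t != 0 -> h (zt t) = 0.
  move=> t0; have Dt : Delta (zt t) != 0 by rewrite ztD mulf_neq0.
  have Ot : O (jet_base (zt t)) by rewrite zt0.
  rewrite /h -(H (zt t) (zt0 t) Dt (zta t)) mxE mulr_suml -sumrB big1 // => k _.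
  rewrite mxE mulrAC -mulrBl; have := ltn_ord k; case: (nat_of_ord k) => [|j] jr.
    by rewrite subrr mul0r.
  rewrite prolong_coordE //.
  rewrite (_ : 2 * r - 1 = (2 * j + 1) + 2 * (r - j.+1))%N; last by lia.
  by rewrite [_ ^+ (2 * j + 1 + _)]exprD mulrA divfK ?expf_neq0 // subrr mul0r.
have hz0 : h z0 = 0.
  have -> : z0 = zt 0 by rewrite /zt scale0r addr0.
  apply: (@continuous_zero_away F (fun t => h (zt t))); last exact: h0.
  apply: (@continuous_comp _ _ _ zt h).
    apply: differentiable_continuous; apply: differentiableD; first exact: differentiable_cst.
    exact: differentiableZl.
  by apply: smooth_cont sh _; rewrite /= zt0.
move: hz0; rewrite /h D0 expr0n (_ : (2 * r - 1 == 0)%N = false); last by apply/eqP; lia.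
rewrite mulr0n [s' * _]mulr0 subr0 (bigD1 ord_max) //= big1 ?addr0; last first.
  move=> k km; case E : (nat_of_ord k) => [|j]; first by rewrite mulr0 mul0r.
  rewrite expr0n (_ : (2 * (r - j.+1) == 0)%N = false) ?mulr0 ?mul0r //.
  have := ltn_ord k; have : nat_of_ord k != r by apply: contra km => /eqP kr; apply/eqP/val_inj.
  by rewrite E => /eqP; lia.
have M n A : (0 < n)%N ->
    (if n is j.+1 then prolong_num j z0 * 1 else A) = 0 -> false.
  by case: n => // j _; rewrite mulr1 => /eqP; rewrite (negPf (Nk j)).
by rewrite a'm mulr1 subnn muln0 expr0; exact: M.
Qed.

End Prolongation.

End Jets.

(** * Leading terms of the iterated total derivatives of a function of (t, x) *)

Section SecondOrder.
Variables (F : numFieldType) (r : nat).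
Hypothesis r2 : (2 < r)%N.
Let r1 : (1 < r)%N. Proof. exact: leq_trans r2. Qed.
Let r0 : (0 < r)%N. Proof. exact: leq_trans r2. Qed.
Local Notation E := (F * 'rV[F]_r.+1)%type.
Local Notation D := (Lie (@jfield F r)).
Local Notation ordj := (of_order (@jorder F r)).
Local Notation b f := (fun z : E => f (jet_base z)).
Local Notation x k := (@jcoord F r k).

Lemma jorder_Lie m g : ordj m g -> ordj m.+1 (D g).
Proof.
exact: (of_order_Lie (@jfield_shift F r) (@jshift_order F r) (@jorderS F r) (@jorderD F r)).
Qed.

Lemma jorder_le m n g : (m <= n)%N -> ordj m g -> ordj n g.
Proof. exact: (of_order_le (@jorderS F r)). Qed.

Variables (O : set (F * F)) (X Xt Xx Xtt Xtx Xxt Xxx : F * F -> F).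
Hypothesis oO : open O.
Hypothesis sX : smooth_on O X.
Hypotheses (sXt : smooth_on O Xt) (sXx : smooth_on O Xx) (sXtt : smooth_on O Xtt)
  (sXtx : smooth_on O Xtx) (sXxt : smooth_on O Xxt) (sXxx : smooth_on O Xxx).
Local Notation OJ := (@jet_base F r @^-1` O).
Hypotheses (DX : forall z, OJ z -> D (b X) z = Xt (jet_base z) + x 1 z * Xx (jet_base z))
  (DXt : forall z, OJ z -> D (b Xt) z = Xtt (jet_base z) + x 1 z * Xtx (jet_base z))
  (DXx : forall z, OJ z -> D (b Xx) z = Xxt (jet_base z) + x 1 z * Xxx (jet_base z)).
Let oJ : open OJ := open_base oO.
Local Notation L k := (iter k D (b X)).

Let sb (f : F * F -> F) : smooth_on O f -> smooth_on OJ (b f).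
Proof. exact: smooth_base. Qed.
Let sx m : smooth_on OJ (x m). Proof. exact: smooth_jcoord. Qed.
Let sM (f g : E -> F) : smooth_on OJ f -> smooth_on OJ g -> smooth_on OJ (fun z => f z * g z).
Proof. exact: smoothM. Qed.
Let sA (f g : E -> F) : smooth_on OJ f -> smooth_on OJ g -> smooth_on OJ (fun z => f z + g z).
Proof. exact: smoothD. Qed.
Let sD (f : E -> F) : smooth_on OJ f -> smooth_on OJ (D f).
Proof. exact: smooth_D. Qed.
Let DM (f g : E -> F) z : smooth_on OJ f -> smooth_on OJ g -> OJ z ->
  D (fun z => f z * g z) z = f z * D g z + D f z * g z.
Proof.
by move=> sf sg Oz; apply: derivativeM; [exact: smooth_diff sf Oz|exact: smooth_diff sg Oz].
Qed.
Let DA (f g : E -> F) z : smooth_on OJ f -> smooth_on OJ g -> OJ z ->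
  D (fun z => f z + g z) z = D f z + D g z.
Proof.
by move=> sf sg Oz; apply: derivativeD; [exact: smooth_diff sf Oz|exact: smooth_diff sg Oz].
Qed.
Let Dx m z : (m < r)%N -> D (x m) z = x m.+1 z.
Proof. exact: D_jcoord. Qed.
Let od m (f : F * F -> F) : ordj m.+1 (D (b f)).
Proof. exact: (jorder_le (ltn0Sn m) (jorder_Lie (@base_order F r f))). Qed.
Let ob m (f : F * F -> F) : ordj m (b f).
Proof. exact: (jorder_le (leq0n m) (@base_order F r f)). Qed.
Let Dnear (f g : E -> F) z : (forall z, OJ z -> f z = g z) -> OJ z -> D f z = D g z.
Proof. by move=> fg Oz; apply: Lie_near; apply: filterS (open_near oJ Oz); exact: fg. Qed.

Lemma smooth_iter_D k : smooth_on OJ (L k).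
Proof. by elim: k => [|k IH]; [exact: sb|exact: sD]. Qed.

Lemma iter_D_order k : ordj k (L k).
Proof.
elim: k => [|k IH]; first exact: (@base_order F r X).
exact: jorder_Lie.
Qed.

Lemma iter_D_first k : (0 < k <= r)%N -> exists A : E -> F,
  [/\ ordj k.-1 A, smooth_on OJ A &
      forall z, OJ z -> L k z = Xx (jet_base z) * x k z + A z].
Proof.
elim: k => // -[|k] IH kr.
  exists (b Xt); split; [exact: ob|exact: sb|move=> z Oz].
  by rewrite [LHS](DX Oz) addrC mulrC.
have kr' : (0 < k.+1 <= r)%N by case/andP: kr => _ /ltnW ->.
have [A [oA sA' HA]] := IH kr'.
have sXx' := sb sXx.
exists (fun z => D (b Xx) z * x k.+1 z + D A z); split.
- apply: of_orderD; last exact: (jorder_Lie oA).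
  apply: of_orderM; first exact: od.
  by apply: jcoord_order => //; case/andP: kr'.
- exact: (sA (sM (sD sXx') (sx k.+1)) (sD sA')).
- move=> z Oz.
  rewrite [LHS](Dnear (g := fun z => Xx (jet_base z) * x k.+1 z + A z) HA Oz).
  by rewrite (DA (sM sXx' (sx k.+1)) sA' Oz) (DM sXx' (sx k.+1) Oz) Dx ?addrA //.

Qed.

(** Each total derivative adds X_xx x^(1) to the coefficient of the second highest derivative,
    through the term X_x x^(k). The induction starts at k = 3, since for k = 2 the factors x^(1) and
    x^(k-1) coincide and X_xx comes with coefficient 1 instead of 2. *)
Lemma iter_D_second k : (2 < k <= r)%N -> exists (kappa : F * F -> F) (M : E -> F),
  [/\ smooth_on O kappa, ordj k.-2 M, smooth_on OJ M &
      forall z, OJ z -> L k z = Xx (jet_base z) * x k z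
        + (k%:R * Xxx (jet_base z) * x 1 z + kappa (jet_base z)) * x k.-1 z
        + M z].
Proof.
have x1 := sx 1; have x2 := sx 2.
elim: k => // k IH /andP[k2 kr].
move: k2; rewrite leq_eqVlt ltnS => /orP[/eqP k3|k2].
  have <- : 2%N = k by lia.
  pose M z := (D (b Xxt) z + D (b Xxx) z * x 1 z + D (b Xtx) z) * x 1 z + D (b Xtt) z.
  exists (fun p => 2 * Xxt p + Xtx p), M; split.
  - by apply: (smoothD oO) => //; apply: (smoothM oO) => //; exact: smooth_cst.
  - have o1 : ordj 1 (x 1) by apply: jcoord_order; first exact: ltnW.
    rewrite /M [3.-2]/=; apply: of_orderD; last exact: (@od 0 Xtt).
    apply: of_orderM; last exact: o1.
    apply: of_orderD; last exact: (@od 0 Xtx).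
    by apply: of_orderD; [exact: (@od 0 Xxt)|apply: of_orderM; [exact: (@od 0 Xxx)|exact: o1]].
  - have sd f : smooth_on O f -> smooth_on OJ (D (b f)) by move=> /sb/sD.
    exact: (sA (sM (sA (sA (sd _ sXxt) (sM (sd _ sXxx) x1)) (sd _ sXtx)) x1) (sd _ sXtt)).
  - move=> z Oz.
    pose G z := (Xxt (jet_base z) + x 1 z * Xxx (jet_base z)) * x 1 z + (Xtt (jet_base z) + x 1 z * Xtx (jet_base z)).
    have L1 w : OJ w -> L 1 w = Xt (jet_base w) + x 1 w * Xx (jet_base w) by exact: DX.
    have L2 w : OJ w -> L 2 w = x 2 w * Xx (jet_base w) + G w.
      move=> Ow; rewrite [LHS](Dnear (g := fun w => Xt (jet_base w) + x 1 w * Xx (jet_base w)) L1 Ow).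
      rewrite (DA (sb sXt) (sM x1 (sb sXx)) Ow) (DM x1 (sb sXx) Ow).
      by rewrite (DXt Ow) (DXx Ow) (Dx _ r1) /G; ring.
    have s1 := sA (sb sXxt) (sM x1 (sb sXxx)).
    have s2 := sA (sb sXtt) (sM x1 (sb sXtx)).
    have s3 : smooth_on OJ G := sA (sM s1 x1) s2.
    rewrite [LHS](Dnear (g := fun w => x 2 w * Xx (jet_base w) + G w) L2 Oz).
    rewrite (DA (sM x2 (sb sXx)) s3 Oz) (DM x2 (sb sXx) Oz) (DXx Oz).
    rewrite [D G z](DA (sM s1 x1) s2 Oz) (DM s1 x1 Oz).
    rewrite (DA (sb sXxt) (sM x1 (sb sXxx)) Oz) (DA (sb sXtt) (sM x1 (sb sXtx)) Oz).
    rewrite (DM x1 (sb sXxx) Oz) (DM x1 (sb sXtx) Oz) (Dx _ r2) (Dx _ r1).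
    rewrite /M [3.-1]/=.
    move: (D (b Xxt) z) (D (b Xxx) z) (D (b Xtt) z) (D (b Xtx) z) => p1 p2 p3 p4.
    by ring.
have kk : (2 < k <= r)%N by rewrite k2 ltnW.
have [kappa [M [sk oM sM' HL]]] := IH kk.
pose B (z : E) := k%:R * Xxx (jet_base z) * x 1 z + kappa (jet_base z).
have sB : smooth_on OJ B.
  apply: sA; last exact: (sb sk).
  by apply: sM x1; apply: sM (sb sXxx); exact: smooth_cst.
have oB : ordj 1 B.
  apply: of_orderD; last exact: ob.
  apply: of_orderM; last by apply: jcoord_order; first exact: ltnW.
  by apply: of_orderM; [exact: of_order_cst|exact: ob].
exists (fun p => Xxt p + kappa p), (fun z => D B z * x k.-1 z + D M z); split.
- exact: (smoothD oO).
- have E1 : (k.-2.+1 = k.-1)%N by lia.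
  apply: of_orderD; last by have := jorder_Lie oM; rewrite E1.
  apply: of_orderM; last by apply: jcoord_order; lia.
  by apply: (@jorder_le 2); [lia|exact: jorder_Lie].
- exact: (sA (sM (sD sB) (sx k.-1)) (sD sM')).
- move=> z Oz.
  have s1 := sM (sb sXx) (sx k); have s2 := sM sB (sx k.-1).
  rewrite [LHS](Dnear (g := fun w => Xx (jet_base w) * x k w + B w * x k.-1 w + M w) HL Oz).
  rewrite (DA (sA s1 s2) sM' Oz) (DA s1 s2 Oz) (DM (sb sXx) (sx k) Oz) (DM sB (sx k.-1) Oz).
  rewrite (Dx _ kr) (Dx (m := k.-1)) ?prednK ?(DXx Oz) ?[k.+1.-1]/=; try lia.
  rewrite [k.+1%:R]mulrS /B.
  move: (D M z) (D _ z) => p1 p2.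
  by ring.
Qed.

End SecondOrder.

(** * Boxes in the (t, x)-plane and restriction to lines x = const *)

Section Boxes.
Variable F : numFieldType.
Hypothesis cF : geometric_complete F.
Hypothesis aF : dyadic_archi F.

Definition box (p : F * F) (d : F) : set (F * F) :=
  [set q | `|q.1 - p.1| < d /\ `|q.2 - p.2| < d].

Lemma box_ball p d : box p d = ball p d.
Proof.
apply/funext => q; apply/propext; split=> -[q1 q2]; split;
  by [rewrite /ball /= distrC|move: q1; rewrite /ball /= distrC|move: q2; rewrite /ball /= distrC].
Qed.

Lemma open_box p d : open (box p d).
Proof. by rewrite box_ball; exact: ball_open. Qed.

Lemma box_center p d : 0 < d -> box p d p.
Proof. by move=> d0; split; rewrite subrr normr0. Qed.

Lemma open_contains_box (O : set (F * F)) p : open O -> O p ->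
  exists2 d, 0 < d & box p d `<=` O.
Proof.
move=> oO Op; have /nbhs_ballP[d /= d0 Hd] : nbhs p O by exact: open_nbhs_nbhs.
by exists d => //; rewrite box_ball.
Qed.

Definition interval_ball (t d : F) : set F := [set u | `|u - t| < d].

Lemma open_interval_ball t d : open (interval_ball t d).
Proof.
rewrite (_ : interval_ball t d = ball t d); first exact: ball_open.
by apply/funext => u; rewrite /interval_ball /ball /= distrC.
Qed.

(** Integration along the fibre of the box, which is a disc; the fibres of [O] need not be
    connected. *)
Lemma box_const (O : set (F * F)) (f : F * F -> F) p d :
  box p d `<=` O -> smooth_on O f -> (forall q, O q -> 'D_(0, 1) f q = 0) ->
  forall q, box p d q -> f q = f (q.1, p.2).
Proof.
move=> BO sf f0 q [q1 q2].
have E s : (q.1, p.2) + s *: ((0, 1) : F * F) = (q.1, p.2 + s).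
  by congr (_, _); rewrite /= ?scaler0 ?addr0 // [_ *: _]mulr1.
have := @zero_derivative_line F cF aF _ f (q.1, p.2) (0, 1) d _ (q.2 - p.2) q2.
rewrite E subrKC -surjective_pairing; apply => s sd; rewrite E.
have Oq : O (q.1, p.2 + s) by apply: BO; split=> //=; rewrite addrAC subrr add0r.
by split; [exact: smooth_diff sf Oq|exact: f0].
Qed.

Lemma derive_restrict (f : F * F -> F) (c t v : F) :
  'D_v (fun t => f (t, c)) t = 'D_((v, 0) : F * F) f (t, c).
Proof.
rewrite /derive; set d := (fun _ : F => _); set d' := (fun _ : F => _).
suff -> : d = d' by [].
rewrite funeqE => h; rewrite /d /d' /=; congr (_ *: (f _ - _)).
by congr (_, _); rewrite /= scaler0 add0r.
Qed.

Lemma differentiable_restrict (f : F * F -> F) (c t : F) :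
  differentiable f (t, c) -> differentiable (fun t => f (t, c)) t.
Proof.
by move=> df; apply: (@differentiable_comp _ _ _ _ (fun t : F => (t, c)) f).
Qed.

Lemma smooth_restrict (O : set (F * F)) (I : set F) (f : F * F -> F) (c : F) :
  (forall t, I t -> O (t, c)) -> smooth_on O f -> smooth_on I (fun t => f (t, c)).
Proof.
move=> IO sf n; elim: n f sf => // n IH f sf; split=> [t It|v].
  by apply: differentiable_restrict; exact: smooth_diff sf (IO _ It).
rewrite (_ : (fun p => _) = (fun t => 'D_((v, 0) : F * F) f (t, c))).
  exact: IH (smooth_deriv _ sf).
by apply/funext => t; rewrite derive_restrict.
Qed.

Lemma zero_derivative_interval (f : F -> F) t d :
  (forall u, interval_ball t d u -> differentiable f u /\ derive1 f u = 0) ->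
  forall u, interval_ball t d u -> f u = f t.
Proof. exact: zero_derivative_cst. Qed.

End Boxes.

Section LieBase.
Variables (F : numFieldType) (r : nat).
Local Notation E := (F * 'rV[F]_r.+1)%type.

Lemma Lie_fst (f : F -> F) (z : E) : differentiable f z.1 ->
  Lie (@jfield F r) (fun z => f z.1) z = derive1 f z.1.
Proof. by move=> df; rewrite /Lie derivative_comp_fst ?mulr1. Qed.

End LieBase.

(** * Transformations with T_x = 0 are affine in x *)

Section Affine.
Variables (F : numFieldType) (r : nat).
Hypothesis cF : geometric_complete F.
Hypothesis aF : dyadic_archi F.
Hypothesis r2 : (2 < r)%N.
Let r0 : (0 < r)%N. Proof. exact: leq_trans r2. Qed.
Local Notation E := (F * 'rV[F]_r.+1)%type.
Local Notation D := (Lie (@jfield F r)).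

Variables (O : set (F * F)) (phi : F * F -> F * F).
Hypothesis oO : open O.
Hypothesis sphi : smooth_on O phi.
Let T q := (phi q).1.
Let X q := (phi q).2.
Hypothesis Tx : forall q, O q -> 'D_(0, 1) T q = 0.
Hypothesis J0 : forall q, O q -> jac phi q != 0.
Local Notation OJ := (@jet_base F r @^-1` O).
Let sT : smooth_on O T := smooth_phi1 oO sphi.
Let sX : smooth_on O X := smooth_phi2 oO sphi.

Lemma jac_factor q : O q -> 'D_(1, 0) T q != 0 /\ 'D_(0, 1) X q != 0.
Proof.
move=> Oq; have := J0 Oq; rewrite /jac -/T -/X [X in _ - X * _](Tx Oq) mul0r subr0.
by rewrite mulf_eq0 negb_or => /andP.
Qed.

(** On the source equation x^(r) is affine in x^(1) and x^(r-1), so the only term of the transformed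
    equation that is not a sum of functions of one of these two variables is r X_xx x^(1) x^(r-1) /
    T'^r. A mixed second difference isolates it. *)
Lemma affine_in_x (a a' : 'cV[F]_r.+1) (s s' : F) (p : F * F) :
  O p -> a ord_max ord0 = 1 -> a' ord_max ord0 = 1 ->
  (forall z : E, jet_base z = p -> 
     (z.2 *m a) ord0 ord0 = s -> ((prolong phi z).2 *m a') ord0 ord0 = s') ->
  'D_(0, 1) ('D_(0, 1) X) p = 0.
Proof.
move=> Op am a'm H.
have [d d0 BO] := open_contains_box oO Op.
pose T1 t := T (t, p.2); pose I := interval_ball p.1 d.
have IO t : I t -> O (t, p.2) by move=> It; apply: BO; split=> //=; rewrite subrr normr0.
have sT1 : smooth_on I T1 by exact: smooth_restrict IO sT.
have oI : open I by exact: open_interval_ball.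
have T1E t : derive1 T1 t = 'D_(1, 0) T (t, p.2) by rewrite derive1E derive_restrict.
have T10 t : I t -> derive1 T1 t != 0.
  by move=> It; rewrite T1E; have [] := jac_factor (IO _ It).
pose W := @jet_base F r @^-1` box p d.
have oW : open W by apply: open_base; exact: open_box.
have WI z : W z -> I z.1 by case.
have WO z : W z -> OJ z by move=> Wz; exact: BO.
have TE z : W z -> T (jet_base z) = T1 z.1 by move=> Wz; exact: (box_const cF aF BO sT Tx Wz).
have DeltaW z : W z -> total_deriv_T phi z = derive1 T1 z.1.
  move=> Wz; rewrite -(@Lie_fst F r T1); last exact: smooth_diff sT1 (WI _ Wz).
  apply: Lie_near; apply: filterS (open_near oW Wz); exact: TE.
pose b f := fun z : E => f (jet_base z) : F.
pose L k := iter k D (b X).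
have sXv v : smooth_on O ('D_v X) by exact: smooth_deriv.
have sXuv u v : smooth_on O ('D_u ('D_v X)) by do 2 apply: smooth_deriv.
have DB f z : smooth_on O f -> OJ z ->
    D (b f) z = 'D_(1, 0) f (jet_base z) + jcoord 1 z * 'D_(0, 1) f (jet_base z).
  by move=> sf Oz; apply: (@D_base F r r0 f); exact: smooth_diff sf Oz.
have DX z : OJ z -> _ := DB X z sX.
have DXt z : OJ z -> _ := DB ('D_(1, 0) X) z (sXv _).
have DXx z : OJ z -> _ := DB ('D_(0, 1) X) z (sXv _).
have sL k : smooth_on OJ (L k) by exact: smooth_iter_D.
have oL k : of_order (@jorder F r) k (L k) by exact: iter_D_order.
have [A [oA _ HA]] := iter_D_first oO (sXv (1, 0)) (sXv (0, 1)) DX (k := r.-1) ltac:(lia).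
have [kappa [M [_ oM _ HM]]] := iter_D_second r2 oO (sXv (1, 0)) (sXv (0, 1)) (sXuv _ _) (sXuv _ _) (sXuv _ _) (sXuv _ _) DX DXt DXx (k := r) ltac:(lia).
(* The factor is 1 because [X] itself, rather than x, is differentiated here. *)
pose P := prolong_mx T1 (fun=> 1).
have PE k z : (k <= r)%N -> W z -> prolong_coord phi k z = \sum_(j < k.+1) P k j z.1 * L j z.
  move: k z; apply: (prolong_mx_expand (V := @jfield F r) (tau := fun z : E => z.1) (W := W) oI sT1 T10 (smooth_cst I (1 : F)) oW) => //.
  - move=> q Wq; split; first exact: smooth_diff (@smooth_fst F _ _ setT) Logic.I.
    by rewrite derivative_fst.
  - move=> j q _ Wq; split=> //; exact: smooth_diff (sL j) (WO _ Wq).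
  - by move=> q _; rewrite mul1r.
  - by move=> k' q _ Wq; rewrite -(DeltaW _ Wq).
pose e k : 'rV[F]_r.+1 := delta_mx ord0 (inord k).
have mE (k : nat) : (k <= r)%N -> nat_of_ord (inord k : 'I_r.+1) = k.
  by move=> kr; rewrite inordK // ltnS.
have eE i k : (i <= r)%N -> (k <= r)%N -> e i ord0 (inord k) = (k == i)%:R.
  by move=> ir kr; rewrite mxE eqxx -val_eqE /= !mE.
have eM k (c : 'cV[F]_r.+1) : (e k *m c) ord0 ord0 = c (inord k) ord0.
  by rewrite -rowE mxE.
have maxE : ord_max = inord r :> 'I_r.+1 by apply/val_inj; rewrite /= mE.
have o0 : (ord0 : 'I_r.+1) = inord 0 by apply/val_inj; rewrite /= mE.
pose zz (u v : F) : 'rV[F]_r.+1 := p.2 *: e 0%N + (u *: e 1%N + v *: e r.-1).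
have DM (u v : 'rV[F]_r.+1) (c : 'cV[F]_r.+1) : ((u + v) *m c) ord0 ord0 = (u *m c) ord0 ord0 + (v *m c) ord0 ord0.
  by rewrite mulmxDl mxE.
have SM k (v : 'rV[F]_r.+1) (c : 'cV[F]_r.+1) : ((k *: v) *m c) ord0 ord0 = k * (v *m c) ord0 ord0.
  by rewrite -scalemxAl mxE.
(* The top derivative that puts the point with x^(1) = u and x^(r-1) = v on the source equation. *)
pose R u v := s - (zz u v *m a) ord0 ord0.
pose zy u v : E := (p.1, zz u v + R u v *: e r).
have zyk u v k : (k <= r)%N -> (zy u v).2 ord0 (inord k) =
    p.2 * (k == 0%N)%:R + (u * (k == 1%N)%:R + v * (k == r.-1)%:R) + R u v * (k == r)%:R.
  move=> kr; rewrite -(eE 0%N k (leq0n r) kr) -(eE 1%N k r0 kr) -(eE r.-1 k (leq_pred r) kr) -(eE r k (leqnn r) kr).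
  have DE (A1 B1 : 'rV[F]_r.+1) i : (A1 + B1) ord0 i = A1 ord0 i + B1 ord0 i by rewrite mxE.
  have SE c (A1 : 'rV[F]_r.+1) i : (c *: A1) ord0 i = c * A1 ord0 i by rewrite mxE.
  by rewrite /zy /zz /= !DE !SE.
have inv2 m g u : of_order (@jorder F r) m g -> (m <= r.-2)%N -> g (zy u 1) = g (zy u 0).
  move=> og mr; have -> : zy u 1 = zy u 0 + (zy u 1 - zy u 0) by rewrite subrKC.
  apply: og; split; first by rewrite /= subrr.
  move=> k km; have kr := ltn_ord k.
  rewrite -[k]inord_val [LHS]mxE [X in _ + X]mxE !zyk; [|lia|lia].
  rewrite (_ : (k == r.-1 :> nat) = false); last by apply/eqP; lia.
  by rewrite (_ : (k == r :> nat) = false) ?mulr0 ?addr0 ?subrr //; apply/eqP; lia.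
have zyp u v : jet_base (zy u v) = p.
  rewrite /jet_base o0 zyk // (_ : (0 == 1)%N = false) // (_ : (0%N == r.-1) = false); last by apply/eqP; lia.
  by rewrite (_ : (0%N == r) = false) ?mulr0 ?addr0 ?mulr1 -?surjective_pairing //; apply/eqP; lia.
have x1E u v : jcoord 1 (zy u v) = u.
  rewrite /jcoord zyk ?r0 // (_ : (1%N == r.-1) = false); last by apply/eqP; lia.
  rewrite (_ : (1%N == r) = false); last by apply/eqP; lia.
  by rewrite /= ?mulr0 ?addr0 ?add0r ?mulr1.
have xpE u v : jcoord r.-1 (zy u v) = v.
  rewrite /jcoord zyk ?leq_pred // eqxx (_ : (r.-1 == r) = false); last by apply/eqP; lia.
  rewrite (_ : (r.-1 == 0)%N = false); last by apply/eqP; lia.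
  rewrite (_ : (r.-1 == 1)%N = false); last by apply/eqP; lia.
  by rewrite /= ?mulr0 ?addr0 ?add0r ?mulr1.
have xrE u v : jcoord r (zy u v) = R u v.
  rewrite /jcoord zyk // eqxx (_ : (r == r.-1) = false); last by apply/eqP; lia.
  rewrite (_ : (r == 0)%N = false); last by apply/eqP; lia.
  rewrite (_ : (r == 1)%N = false); last by apply/eqP; lia.
  by rewrite /= ?mulr0 ?addr0 ?add0r ?mulr1.
have RE u v : R u v = s - (p.2 * a (inord 0) ord0 + (u * a (inord 1) ord0 + v * a (inord r.-1) ord0)).
  by rewrite /R /zz !(DM, SM) !eM.
have onE u v : ((prolong phi (zy u v)).2 *m a') ord0 ord0 = s'.
  apply: H; first exact: zyp.
  by rewrite /zy /= DM SM eM -maxE am mulr1 /R subrKC.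
have Wz u v : W (zy u v) by rewrite /W /= zyp; exact: box_center.
have Oz u v : OJ (zy u v) by exact: WO.
(* The mixed second difference in (u, v). It kills functions of order at most r-2, since these do
   not see v. *)
pose SD (g : E -> F) := g (zy 1 1) - g (zy 1 0) - g (zy 0 1) + g (zy 0 0).
have SDL j : (j < r)%N -> SD (L j) = 0.
  move=> jr; have [jr2|jr2] := leqP j r.-2.
    by rewrite /SD !(inv2 j) // subrr sub0r addNr.
  have -> : j = r.-1 by lia.
  rewrite /SD /L !HA // !(inv2 r.-1.-1 A) // !zyp !xpE.
  by move: ('D_(0, 1) X p) (A (zy 1 0)) (A (zy 0 0)) => q1 q2 q3; ring.
have SDr : SD (L r) = r%:R * 'D_(0, 1) ('D_(0, 1) X) p.
  rewrite /SD /L !HM // !(inv2 r.-2 M) // !zyp !xpE !x1E !xrE !RE.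
  move: ('D_(0, 1) X p) ('D_(0, 1) ('D_(0, 1) X) p) (M (zy 1 0)) (M (zy 0 0)) (kappa p)
    (a (inord 0) ord0) (a (inord 1) ord0) (a (inord r.-1) ord0) (p.2) (r%:R : F).
  by move=> q1 q2 q3 q4 q5 q6 q7 q8 q9 q10; ring.
have SDP k : (k <= r)%N -> SD (prolong_coord phi k) = \sum_(j < k.+1) P k j p.1 * SD (L j).
  move=> kr; rewrite /SD !PE // -!sumrB -big_split /=; apply: eq_bigr => j _.
  by rewrite -!mulrBr -mulrDr.
have : SD (fun z => ((prolong phi z).2 *m a') ord0 ord0) = 0.
  by rewrite /SD !onE subrr sub0r addNr.
have -> : SD (fun z => ((prolong phi z).2 *m a') ord0 ord0) =
    \sum_(k < r.+1) SD (prolong_coord phi k) * a' k ord0.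
  rewrite /SD ![(_ *m _) _ _]mxE -!sumrB -big_split /=; apply: eq_bigr => k _.
  by rewrite !mxE -!mulrBl -mulrDl.
rewrite big_ord_recr big1 /=; last first.
  move=> k _; rewrite SDP ?(ltnW (ltn_ord k)) // big1 ?mul0r // => j _.
  rewrite SDL ?mulr0 //; have := ltn_ord j; have := ltn_ord k; lia.
rewrite add0r a'm mulr1 SDP // big_ord_recr big1 /=; last first.
  by move=> j _; rewrite SDL ?mulr0.
have Ip : I p.1 by rewrite /I /interval_ball /= subrr normr0.
rewrite add0r SDr /P (@prolong_mx_diag _ T1 (fun=> 1) I) //.
have d1 : derive1 T1 p.1 != 0 by exact: T10.
move/eqP; rewrite mulf_eq0 mul1r invr_eq0 expf_eq0 (negPf d1) andbF /= mulf_eq0 pnatr_eq0.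
by rewrite (gtn_eqF r0) => /eqP.
Qed.

End Affine.

(** * Jets of functions of t under x~ = X1 (x + xi), t~ = T *)

Section JetRows.
Variables (F : numFieldType) (r : nat).
Local Notation E := (F * 'rV[F]_r.+1)%type.

Definition jetrow (y : F -> F) (t : F) : 'rV[F]_r.+1 :=
  \row_(m < r.+1) derive1n m y t.

Lemma row_jetmx (th : param F r) i t : row i (jetmx th t) = jetrow (chi th i) t.
Proof. by apply/matrixP => k m; rewrite !mxE. Qed.

Lemma jetrow_near (y y' : F -> F) t : (\forall u \near t, y u = y' u) ->
  jetrow y t = jetrow y' t.
Proof.
move=> H; apply/matrixP => k m; rewrite !mxE.
exact: nbhs_singleton (derive1n_near m H).
Qed.

Lemma derive1n_lincomb (I : set F) n (c : 'rV[F]_n) (f : 'I_n -> F -> F) m t :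
  open I -> (forall i, smooth_on I (f i)) -> I t ->
  derive1n m (fun u => \sum_j c ord0 j * f j u) t = \sum_j c ord0 j * derive1n m (f j) t.
Proof.
move=> oI sf; elim: m t => // m IH t It.
rewrite derive1nS (@derive1_near _ _ (fun u => \sum_j c ord0 j * derive1n m (f j) u)); last first.
  by apply: filterS (open_near oI It) => u; exact: IH.
have df j : differentiable (derive1n m (f j)) t.
  exact: smooth_diff (smooth_derive1n m (sf j)) It.
rewrite derive1E derivative_bigsum => [|j]; last first.
  by apply: differentiableM.
apply: eq_bigr => j _; rewrite derivativeM // derivativeC mul0r addr0.
by rewrite -derive1E -derive1nS.
Qed.

Lemma jetrow_lincomb (I : set F) (th : param F r) (c : 'rV[F]_r) t :
  open I -> (forall i, smooth_on I (chi th i)) -> I t ->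
  jetrow (fun u => \sum_j c ord0 j * chi th j u) t = c *m jetmx th t.
Proof.
move=> oI sf It; apply/matrixP => i m; rewrite (ord1 i) !mxE (derive1n_lincomb _ _ oI) //.
by apply: eq_bigr => j _; rewrite mxE.
Qed.

(** On a hyperplane with top coefficient 1 the top entry is determined by the others. *)
Lemma jet_eq_max (a u v : 'rV[F]_r.+1) (al : 'cV[F]_r.+1) : al ord_max ord0 = 1 ->
  (u *m al) ord0 ord0 = (v *m al) ord0 ord0 ->
  (forall k, u ord0 (lift ord_max k) = v ord0 (lift ord_max k)) -> u = v.
Proof.
move=> am uv H; apply/matrixP => i j; rewrite ord1.
case: (unliftP ord_max j) => [k ->|->]; first exact: H.
move: uv; rewrite !mxE (bigD1_ord ord_max) //= [RHS](bigD1_ord ord_max) //= am !mulr1.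
by under eq_bigr do rewrite H; move/addIr.
Qed.

(** Variation of constants: solve for coefficients c(t) that reproduce y, ..., y^(r-1). The equation
    makes them reproduce y^(r) too, and differentiating these relations gives c' K = 0 with [K]
    invertible, so c is constant on the disc. *)
Lemma solution_span (cF : geometric_complete F) (aF : dyadic_archi F)
    (th : param F r) (t0 d : F) (y : F -> F) :
  let I := interval_ball t0 d in
  (forall i, smooth_on I (chi th i)) -> (forall t, I t -> wronskian th t != 0) ->
  smooth_on I y ->
  (forall t, I t -> (jetrow y t *m annihilator (jetmx th t)) ord0 ord0 = 0) ->
  exists c : 'rV[F]_r, forall t, I t -> y t = \sum_j c ord0 j * chi th j t.
Proof.
move=> I sc W sy Hy; have oI : open I by exact: open_interval_ball.
pose K t : 'M[F]_r := col' ord_max (jetmx th t).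
have KE t i j : K t i j = derive1n j (chi th i) t by rewrite !mxE lift_max.
have K0 t : I t -> \det (K t) != 0 by move=> /W; rewrite -jet_wronskianE.
pose c t : 'rV[F]_r := (\row_m derive1n m y t) *m invmx (K t).
have sc' j : smooth_on I (fun t => c t ord0 j).
  rewrite (_ : (fun t => _) = (fun t => \sum_(m < r) derive1n m y t * invmx (K t) m j)); last first.
    by apply/funext => t; rewrite !mxE; apply: eq_bigr => m _; rewrite mxE.
  apply: smooth_sum => // m _; apply: smoothM => //; first exact: smooth_derive1n.
  apply: smooth_invmx => // k l.
  rewrite (_ : (fun p => _) = derive1n l (chi th k)); first exact: smooth_derive1n.
  by apply/funext => u; rewrite KE.
have cJ t : I t -> c t *m jetmx th t = jetrow y t.
  move=> It; apply: (@jet_eq_max 0 _ _ (annihilator (jetmx th t))).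
  - exact: annihilator_max.
  - rewrite Hy // -mulmxA annihilatorP ?mulmx0 ?mxE //; by rewrite jet_wronskianE W.
  - move=> k; have : c t *m K t = \row_m derive1n m y t.
      by rewrite /c mulmxKV // unitmxE unitfE K0.
    move=> /(congr1 (fun A : 'rV_r => A ord0 k)); rewrite !mxE lift_max => <-.
    by apply: eq_bigr => j _; congr (_ * _); rewrite [RHS]mxE.
(* The relation of order m is differentiated and compared with the one of order m+1; this is
   possible for all m < r because y^(r) is covered by [cJ]. *)
have c'0 t : I t -> (\row_j derive1 (fun t => c t ord0 j) t) *m K t = 0.
  move=> It; apply/matrixP => i m; rewrite !mxE ord1.
  have E1 u (k : 'I_r.+1) : I u -> derive1n k y u = \sum_j c u ord0 j * derive1n k (chi th j) u.
    move=> /cJ/(congr1 (fun A : 'rV_r.+1 => A ord0 k)); rewrite !mxE => <-.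
    by apply: eq_bigr => j _; congr (_ * _); rewrite mxE.
  have m1 : nat_of_ord (lift ord_max m) = m by rewrite lift_max.
  have m2 : nat_of_ord (inord m.+1 : 'I_r.+1) = m.+1 by rewrite inordK // ltnS.
  have := E1 t (inord m.+1) It; rewrite m2 (derive1nS y).
  rewrite (@derive1_near _ _ (fun u => \sum_j c u ord0 j * derive1n m (chi th j) u)); last first.
    apply: filterS (open_near oI It) => u Iu.
    by have := E1 u (lift ord_max m) Iu; rewrite m1.
  have dj j : differentiable (fun u => c u ord0 j) t by exact: smooth_diff (sc' j) It.
  have dk j : differentiable (derive1n m (chi th j)) t.
    exact: smooth_diff (smooth_derive1n m (sc j)) It.
  rewrite derive1E derivative_bigsum; last by move=> j; exact: differentiableM.
  under eq_bigr do rewrite derivativeM // -!derive1E -derive1nS.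
  rewrite big_split /= => /eqP; rewrite addrC -subr_eq0 addrK => /eqP E2.
  by rewrite -[RHS]E2; apply: eq_bigr => j _; rewrite KE mxE.
exists (c t0) => t It.
have d0 : 0 < d.
  by move: It; rewrite /I /interval_ball /=; exact: le_lt_trans.
have I0 : I t0 by rewrite /I /interval_ball /= subrr normr0.
have cc j : c t ord0 j = c t0 ord0 j.
  apply: (zero_derivative_interval cF aF (d := d) (f := fun t => c t ord0 j)) => //.
  move=> u Iu; split; first exact: smooth_diff (sc' j) Iu.
  have := c'0 u Iu => /(congr1 (mulmxr (invmx (K u)))) /=.
  rewrite mulmxK ?mul0mx ?unitmxE ?unitfE ?K0 //.
  by move=> /(congr1 (fun A : 'rV_r => A ord0 j)); rewrite !mxE.
have := cJ t It => /(congr1 (fun A : 'rV_r.+1 => A ord0 ord0)); rewrite !mxE => /esym E1.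
rewrite -[LHS]/(derive1n (@ord0 r) y t) E1.
by apply: eq_bigr => j _; rewrite -cc; congr (_ * _); rewrite mxE.
Qed.

Definition prolong_sq (T X1 : F -> F) (t : F) : 'M[F]_r.+1 :=
  \matrix_(j, k) prolong_mx T X1 k j t.

Section AffinePair.
Variables (I : set F) (T X1 : F -> F).
Hypothesis oI : open I.
Hypothesis sT : smooth_on I T.
Hypothesis T0 : forall t, I t -> derive1 T t != 0.
Hypothesis sX : smooth_on I X1.
Hypothesis X0 : forall t, I t -> X1 t != 0.
Local Notation Q := (prolong_sq T X1).

Lemma prolong_sq_sum (u : 'rV[F]_r.+1) (k : 'I_r.+1) t : I t ->
  (u *m Q t) ord0 k = \sum_(j < k.+1) prolong_mx T X1 k j t * u ord0 (inord j).
Proof.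
move=> It; rewrite mxE.
rewrite (eq_bigr (fun j : 'I_r.+1 => (fun n : nat => prolong_mx T X1 k n t * u ord0 (inord n)) j)); last first.
  by move=> j _; rewrite mxE inord_val mulrC.
rewrite [RHS](big_ord_widen r.+1 (fun n : nat => prolong_mx T X1 k n t * u ord0 (inord n))); last exact: ltn_ord.
rewrite [RHS]big_mkcond /=; apply: eq_bigr => j _.
by case: ltnP => // kj; rewrite (prolong_mx_gt _ _ oI) // mul0r.
Qed.

Lemma jetrow_compose (J : set F) (y' y : F -> F) :
  (forall t, I t -> J (T t)) -> smooth_on J y' -> smooth_on I y ->
  (forall t, I t -> y' (T t) = X1 t * y t) ->
  forall t, I t -> jetrow y' (T t) = jetrow y t *m Q t.
Proof.
move=> IJ sy' sy H t It; apply/matrixP => i k; rewrite ord1 prolong_sq_sum // mxE.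
rewrite (prolong_mx_derive1n oI sT T0 sX IJ sy' sy H) //.
apply: eq_bigr => j _; rewrite mxE inordK //.
exact: leq_trans (ltn_ord j) (ltn_ord k).
Qed.

Lemma prolong_affine (r0 : (0 < r)%N) (B : set (F * F)) (phi : F * F -> F * F) (xi : F -> F) :
  open B -> (forall q, B q -> I q.1) -> smooth_on I xi ->
  (forall q, B q -> phi q = (T q.1, X1 q.1 * (q.2 + xi q.1))) ->
  forall z : E, B (jet_base z) ->
    total_deriv_T phi z = derive1 T z.1 /\
    (prolong phi z).2 = (z.2 + jetrow xi z.1) *m Q z.1.
Proof.
move=> oB BI sxi Hphi z Bz; pose W := @jet_base F r @^-1` B.
have oW : open W by exact: open_base.
have WI w : W w -> I w.1 by move=> /BI.
have Delta w : W w -> total_deriv_T phi w = derive1 T w.1.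
  move=> Ww; rewrite -(@Lie_fst F r T); last exact: smooth_diff sT (WI _ Ww).
  by apply: Lie_near; apply: filterS (open_near oW Ww) => v Wv; rewrite Hphi.
split; first exact: Delta.
apply/matrixP => i k; rewrite ord1 prolong_sq_sum ?mxE; last exact: WI.
have dxi j w : W w -> differentiable (fun z : E => derive1n j xi z.1) w.
  move=> Ww; apply: (@differentiable_comp _ _ _ _ (fun z : E => z.1) (derive1n j xi)).
    exact: smooth_diff (@smooth_fst F _ _ setT) Logic.I.
  exact: smooth_diff (smooth_derive1n j sxi) (WI _ Ww).
have dj j w : differentiable (@jcoord F r j) w.
  exact: smooth_diff (smooth_jcoord j (@openT _)) Logic.I.
rewrite (@prolong_mx_expand F T X1 I oI sT T0 sX _ (@jfield F r) (fun z : E => z.1) W r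
   (fun j z => jcoord j z + derive1n j xi z.1) (prolong_coord phi) oW WI _ _ _ _ k z) //.
- apply: eq_bigr => j _; rewrite !mxE /jcoord inordK //.
  exact: leq_trans (ltn_ord j) (ltn_ord k).
- move=> q Wq; split; first exact: smooth_diff (@smooth_fst F _ _ setT) Logic.I.
  by rewrite derivative_fst.
- move=> j q jr Wq; split; first by apply: differentiableD => //; exact: dxi.
  rewrite (derivativeD _ (dj j q) (dxi j q Wq)).
  have dx := smooth_diff (smooth_derive1n j sxi) (WI _ Wq).
  exact: congr2 (D_jcoord q jr) (Lie_fst dx).
- move=> q Wq; rewrite /= Hphi //=; congr (_ * (_ + _)).
  by rewrite /jcoord; congr (q.2 _ _); apply/val_inj; rewrite /= inordK.
- by move=> k' q _ Wq; rewrite -(Delta _ Wq).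
- by rewrite -ltnS.
Qed.

(** [Q] is upper triangular, so its last row consists of the diagonal entry X1 / T'^r alone. *)
Lemma prolong_sq_max (a : 'cV[F]_r.+1) t : I t -> a ord_max ord0 = 1 ->
  (Q t *m a) ord_max ord0 = X1 t / derive1 T t ^+ r.
Proof.
move=> It am; rewrite mxE (bigD1 ord_max) //= am mulr1 mxE (prolong_mx_diag _ _ oI) //.
rewrite big1 ?addr0 // => k km; rewrite mxE (prolong_mx_gt _ _ oI) ?mul0r //.
by have := ltn_ord k; rewrite ltnS leq_eqVlt => /orP[/eqP E1|//]; case/eqP: km; apply/val_inj.
Qed.

Lemma lambda_neq0 t : I t -> X1 t / derive1 T t ^+ r != 0.
Proof. by move=> It; rewrite mulf_neq0 ?X0 // invr_eq0 expf_neq0 // T0. Qed.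

(** Triangularity of [Q] lets the last column be deleted from all factors; q is the determinant of
    [Q] without its last row and column. *)
Lemma jet_wronskian_transform (C : 'M[F]_r) (J : 'M[F]_(r, r.+1)) t : I t ->
  exists2 q, q != 0 & jet_wronskian (C *m J *m Q t) = \det C * jet_wronskian J * q.
Proof.
move=> It; pose q := \det (row' ord_max (col' ord_max (Q t))).
exists q.
  rewrite /q -det_tr det_trig.
    apply/prodf_neq0 => i _; rewrite !mxE (prolong_mx_diag _ _ oI) //.
    by rewrite mulf_neq0 ?X0 // invr_eq0 expf_neq0 // T0.
  apply/is_trig_mxP => i j ij; rewrite !mxE (prolong_mx_gt _ _ oI) //.
  by rewrite /= /bump !(leqNgt r) !ltn_ord.
rewrite -!det_mulmx; congr (\det _); apply/matrixP => i k.
rewrite !mxE (bigD1_ord ord_max) //= !mxE (prolong_mx_gt _ _ oI) ?mulr0 ?add0r ?lift_max //.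
apply: eq_bigr => j _; rewrite !mxE; congr (_ * _).
by apply: eq_bigr => l _; rewrite !mxE.
Qed.

(** Q times the new annihilator lies in the kernel of [J], hence is a multiple of the old one; the
    factor is its last entry. *)
Lemma annihilator_transform (C : 'M[F]_r) (J : 'M[F]_(r, r.+1)) t : I t ->
  \det C != 0 -> jet_wronskian J != 0 ->
  Q t *m annihilator (C *m J *m Q t) = (X1 t / derive1 T t ^+ r) *: annihilator J.
Proof.
move=> It C0 J0; have [q q0 E1] := jet_wronskian_transform C J It.
have J'0 : jet_wronskian (C *m J *m Q t) != 0 by rewrite E1 !mulf_neq0.
rewrite -(prolong_sq_max It (annihilator_max (C *m J *m Q t))).
apply: annihilator_uniq => //.
have := annihilatorP J'0; rewrite -!mulmxA => /(congr1 (mulmx (invmx C))).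
by rewrite mulKmx ?mulmx0 // unitmxE unitfE.
Qed.

End AffinePair.

End JetRows.

(** * The form of admissible transformations *)

Section Structure.
Variables (F : numFieldType) (r : nat).
Implicit Types th : param F r.

(** Two points of the source hyperplane that differ by a multiple of e_i - a_i e_max have images on
    the target hyperplane, so [b] is orthogonal to that difference. *)
Lemma hyperplane_map (a b : 'cV[F]_r.+1) (xi : 'rV[F]_r.+1) (s s' c d : F) :
  (0 < r)%N -> 0 < d -> a ord_max ord0 = 1 ->
  (forall x : 'rV[F]_r.+1, `|x ord0 ord0 - c| < d -> (x *m a) ord0 ord0 = s ->
     ((x + xi) *m b) ord0 ord0 = s') ->
  b = b ord_max ord0 *: a.
Proof.
move=> r0 d0 am H; apply/matrixP => i j; rewrite (ord1 j) [RHS]mxE.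
pose e (k : 'I_r.+1) : 'rV[F]_r.+1 := delta_mx ord0 k.
have eM k (v : 'cV[F]_r.+1) : (e k *m v) ord0 ord0 = v k ord0.
  by rewrite -rowE mxE.
have D v (x y : 'rV[F]_r.+1) : ((x + y) *m v) ord0 ord0 = (x *m v) ord0 ord0 + (y *m v) ord0 ord0 :> F.
  by rewrite mulmxDl mxE.
have S v k (x : 'rV[F]_r.+1) : ((k *: x) *m v) ord0 ord0 = k * (x *m v) ord0 ord0 :> F.
  by rewrite -scalemxAl mxE.
have max0 : (ord0 == ord_max :> 'I_r.+1) = false by rewrite -val_eqE /= ltn_eqF.
pose x0 := c *: e ord0 + (s - c * a ord0 ord0) *: e ord_max.
(* The factor d / 2 keeps the coordinate of order 0 in the permitted range when i = 0. *)
pose x1 := x0 + (d / 2 *: e i + (- (d / 2 * a i ord0)) *: e ord_max).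
have d2 : d / 2 != 0 by rewrite mulf_neq0 ?gt_eqF // invr_gt0 ltr0n.
have /(H x0) : `|x0 ord0 ord0 - c| < d.
  by rewrite !mxE !eqxx max0 mulr1 mulr0 addr0 subrr normr0.
rewrite !(D, S) !eM am => /(_ ltac:(ring)) H0.
have /(H x1) : `|x1 ord0 ord0 - c| < d.
  rewrite !mxE !eqxx max0 mulr1 !mulr0 !addr0 addrAC subrr add0r normrM.
  case: (_ == i); last by rewrite normr0 mulr0.
  rewrite normr1 mulr1 gtr0_norm ?divr_gt0 ?ltr0n //.
  by rewrite ltr_pdivrMr ?ltr0n // mulr_natr mulr2n ltrDl.
rewrite !(D, S) !eM am => /(_ ltac:(ring)).
rewrite -H0 => /eqP; rewrite -subr_eq0 => /eqP E.
apply/eqP; rewrite -subr_eq0 -(mulrI_eq0 _ (mulfI d2)); apply/eqP; rewrite -[RHS]E; ring.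
Qed.

(** What remains of the conditions on a tuple once the equation it parameterizes is eliminated. *)
Definition regular th := [/\ open (pdom th), forall i, smooth_on (pdom th) (chi th i),
  forall t, pdom th t -> wronskian th t != 0 & smooth_on (pdom th) (rhs th)].

Lemma smooth_jetmx th i k : regular th -> smooth_on (pdom th) (fun t => jetmx th t i k).
Proof.
move=> [_ sc _ _]; rewrite (_ : (fun t => _) = derive1n k (chi th i)).
  exact: smooth_derive1n.
by apply/funext => t; rewrite mxE.
Qed.

Lemma smooth_annihilator (V : normedModType F) (U : set V) (J : V -> 'M[F]_(r, r.+1)) k :
  open U -> (forall p, U p -> jet_wronskian (J p) != 0) ->
  (forall i l, smooth_on U (fun p => J p i l)) ->
  smooth_on U (fun p => annihilator (J p) k ord0).
Proof.
move=> oU W sJ; case: (unliftP ord_max k) => [l ->|->]; last first.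
  by under eq_fun do rewrite annihilator_max; exact: smooth_cst.
rewrite (_ : (fun p => _) = (fun p => - \sum_j invmx (col' ord_max (J p)) l j * J p j ord_max)); last first.
  by apply/funext => p; rewrite !mxE liftK !mxE; under eq_bigr do rewrite mxE.
apply: smoothN => //; apply: smooth_sum => // j _; apply: smoothM => //.
apply: smooth_invmx => // a b.
rewrite (_ : (fun p => _) = (fun p => J p a (lift ord_max b))) //.
by apply/funext => p; rewrite mxE.
Qed.

Lemma jetrow_sum_lift (a : 'cV[F]_r.+1) (y : F -> F) t : a ord_max ord0 = 1 ->
  (jetrow r y t *m a) ord0 ord0 =
  derive1n r y t + \sum_(i < r) a (lift ord_max i) ord0 * derive1n i y t.
Proof.
move=> am; rewrite mxE (bigD1_ord ord_max) //= am mulr1 mxE; congr (_ + _).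
by apply: eq_bigr => i _; rewrite mxE mulrC lift_max.
Qed.

Lemma jetrow_annihilator th i t : wronskian th t != 0 ->
  (jetrow r (chi th i) t *m annihilator (jetmx th t)) ord0 ord0 = 0.
Proof.
move=> W; rewrite -row_jetmx -row_mul annihilatorP ?jet_wronskianE // row0 mxE //.
Qed.

Lemma jetrow_one (U : set F) y t : open U -> (forall u, U u -> y u = 1) -> U t ->
  jetrow r y t = delta_mx ord0 ord0.
Proof.
move=> oU y1 Ut; rewrite (@jetrow_near _ _ _ (fun=> 1)); last by apply: filterS (open_near oU Ut).
apply/matrixP => i [[|k] kr]; rewrite (ord1 i) !mxE ?eqxx // derive1n_cst //.
Qed.

Lemma jetrow_id (U : set F) y t : (0 < r)%N -> open U -> (forall u, U u -> y u = u) -> U t ->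
  jetrow r y t = t *: delta_mx ord0 ord0 + delta_mx ord0 (inord 1).
Proof.
move=> r0 oU yi Ut; rewrite (@jetrow_near _ _ _ id); last by apply: filterS (open_near oU Ut).
apply/matrixP => i k; rewrite (ord1 i) !mxE -!val_eqE [in RHS]/= inordK //.
case: k => -[|[|k]] kr.
- by rewrite [in RHS]/= mulr1 addr0.
- by rewrite [in RHS]/= mulr0 add0r -[LHS]/(derive1 id t) derive1_id'.
- by rewrite [in RHS]/= mulr0 add0r derive1Sn derive1_id' derive1n_cst.
Qed.

(** The tuple determines its equation: the coefficients are the entries of the annihilator. The
    defining constraints of the initial class follow from those on the tuple, since the solution 1
    forces a_0 = 0, and t then forces a_1 = 0. *)
Lemma counterpartE (c : class_name) th : (2 < r)%N ->
  counterpart (@initial_class F r c) (@constraints F r c) th <->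
  regular th /\ constraints c th.
Proof.
move=> r2; split=> [[[e Ce [De fs Rh]] K]|[[oth sc W sr] K]].
  split=> //; have [sc _ W] := fs; have [oe _ sr] := proj1 Ce.
  split; rewrite De //; apply: smooth_eq sr => // t et; exact/esym/Rh.
split=> //; pose e := Lode (pdom th)
  (fun i t => annihilator (jetmx th t) (lift ord_max i) ord0) (rhs th).
have fs : fundamental_set e th.
  split=> // i t et; rewrite -(jetrow_sum_lift _ _ (annihilator_max (jetmx th t))).
  exact/jetrow_annihilator/W.
exists e; last by split.
have hom : rhs0 th -> homogeneous e by move=> H t; exact: H.
have cv n : (n < r)%N -> minor0 n th -> coef_vanishes n e.
  move=> nr H i ni t et; have /minorE := H t et; rewrite W // => /(_ nr isT).
  rewrite /e /=; congr (annihilator _ _ _ = _); apply/val_inj.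
  by rewrite /= inordK ?ltnS ?(ltnW nr) // -ni /bump leqNgt ltn_ord.
have i1E (i : 'I_r) n : i = n :> nat -> lift ord_max i = inord n.
  by move=> ni; apply/val_inj; rewrite /= inordK -ni ?ltnS ?(ltnW (ltn_ord i)) // /bump leqNgt ltn_ord.
have r0 : (0 < r)%N by exact: leq_trans r2.
have r1 : (1 < r)%N by exact: leq_trans r2.
have k0 : chi1_is_1 th -> forall t, pdom th t -> annihilator (jetmx th t) ord0 ord0 = 0.
  move=> H t et; have := jetrow_annihilator (Ordinal r0) (W t et).
  by rewrite (jetrow_one oth (H (Ordinal r0) erefl)) // -rowE mxE.
have c0 : chi1_is_1 th -> coef_vanishes 0 e.
  move=> H i i0 t et; rewrite /e /= (i1E i 0%N i0) (_ : inord 0 = ord0) ?k0 //.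
  by apply/val_inj; rewrite /= inordK.
have c1 : chi1_is_1 th -> chi2_is_t th -> coef_vanishes 1 e.
  move=> H H2 i i0 t et; rewrite /e /= (i1E i 1%N i0).
  have := jetrow_annihilator (Ordinal r1) (W t et).
  rewrite (jetrow_id r0 oth (H2 (Ordinal r1) erefl)) // mulmxDl -scalemxAl -!rowE.
  by rewrite mxE [X in X + _]mxE [X in _ * X + _]mxE [X in _ + X]mxE k0 // mulr0 add0r.
have Ce : class_L e.
  split=> // i; apply: smooth_annihilator => //= [t et|k l]; first by rewrite jet_wronskianE W.
  exact: smooth_jetmx.
split=> //; move: K; case: c => //=.
- by move=> [/cv H /hom]; split=> //; apply: H; rewrite ltn_predL.
- by move=> [/cv H /cv H' /hom]; split=> //; [apply: H|apply: H']; lia.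
- by move=> [/c0 H /hom].
- by move=> [H1 H2]; split; [exact: c0|exact: c1].
- by move=> [H1 H2 /hom H3]; split=> //; [exact: c0|exact: c1].
Qed.

End Structure.

(** * Components of an admissible transformation and its locally constant data *)

Section ArrowStructure.
Variables (F : numFieldType) (r : nat).
Hypothesis cF : geometric_complete F.
Hypothesis aF : dyadic_archi F.
Hypothesis r2 : (2 < r)%N.
Let r0 : (0 < r)%N. Proof. exact: leq_trans r2. Qed.

Lemma lincomb_uniq (th : param F r) t (c c' : 'rV[F]_r) : regular th -> pdom th t ->
  (\forall u \near t, \sum_j c ord0 j * chi th j u = \sum_j c' ord0 j * chi th j u) ->
  c = c'.
Proof.
move=> [oth sc W _] It H; have := jetrow_near r H.
rewrite !(jetrow_lincomb _ oth sc It) => E.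
have : c *m col' ord_max (jetmx th t) = c' *m col' ord_max (jetmx th t).
  apply/matrixP => i j; move: E => /matrixP/(_ i (lift ord_max j)); rewrite !mxE => E.
  by under eq_bigr do rewrite mxE; rewrite E; apply: eq_bigr => l _; rewrite [in RHS]mxE.
have U : col' ord_max (jetmx th t) \in unitmx.
  by rewrite unitmxE unitfE; have := W t It; rewrite -jet_wronskianE.
by move=> /(congr1 (mulmxr (invmx (col' ord_max (jetmx th t))))) /=; rewrite !mulmxK.
Qed.

Variables (th th' : param F r) (O : set (F * F)) (phi : F * F -> F * F).
Hypothesis rth : regular th.
Hypothesis rth' : regular th'.
Hypothesis oO : open O.
Hypothesis sphi : smooth_on O phi.
Hypothesis J0 : forall q, O q -> jac phi q != 0.
Hypothesis dO : forall p, O p -> pdom th p.1 /\ pdom th' (phi p).1.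
Hypothesis map_eq : forall z : jet F r, O (jet_base z) -> total_deriv_T phi z != 0 ->
  (on_equation th z <-> on_equation th' (prolong phi z)).

Definition tcomp q : F := (phi q).1.
Definition xcomp q : F := (phi q).2.
Definition xfactor q : F := 'D_(0, 1) xcomp q.
Definition xshift q : F := xcomp q / xfactor q - q.2.

Let sT : smooth_on O tcomp := smooth_phi1 oO sphi.
Let sX : smooth_on O xcomp := smooth_phi2 oO sphi.
Let sX1 : smooth_on O xfactor := smooth_deriv ((0, 1) : F * F) sX.

Let on_th z : O (jet_base z) -> total_deriv_T phi z != 0 ->
  (z.2 *m annihilator (jetmx th z.1)) ord0 ord0 = rhs th z.1 <->
  ((prolong phi z).2 *m annihilator (jetmx th' (phi (jet_base z)).1)) ord0 ord0
   = rhs th' (phi (jet_base z)).1.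
Proof.
move=> Oz Dz; have [d1 d2] := dO Oz.
have [_ _ W _] := rth; have [_ _ W' _] := rth'.
rewrite -(on_equationE (W _ d1)).
have /on_equationE <- : wronskian th' (prolong phi z).1 != 0 by exact: W'.
exact: map_eq.
Qed.

Lemma T_x0 q : O q -> 'D_(0, 1) tcomp q = 0.
Proof.
move=> Oq.
apply: (@fibre_preserving _ _ r0 O phi oO sphi (annihilator (jetmx th q.1))
  (annihilator (jetmx th' (phi q).1)) (rhs th q.1) (rhs th' (phi q).1)) => //.
- exact: J0.
- exact: annihilator_max.
- exact: annihilator_max.
- by move=> z zq Dz; have := @on_th z; rewrite zq -(congr1 fst zq) => /(_ Oq Dz)[+ _].
Qed.

Lemma T_t_neq0 q : O q -> 'D_(1, 0) tcomp q != 0.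
Proof. by move=> Oq; have [] := jac_factor T_x0 J0 Oq. Qed.

Lemma X1_neq0 q : O q -> xfactor q != 0.
Proof. by move=> Oq; have [] := jac_factor T_x0 J0 Oq. Qed.

(** As T_x = 0, the total derivative of T is T_t. So every jet over [O] is prolongable, and the
    correspondence of equations holds on whole fibres. *)
Lemma Delta_neq0 (z : jet F r) : O (jet_base z) -> total_deriv_T phi z != 0.
Proof.
by move=> Oz; rewrite (DeltaE r0 oO sphi) // -/tcomp T_x0 // mulr0 addr0 T_t_neq0.
Qed.

Lemma X1_x0 q : O q -> 'D_(0, 1) xfactor q = 0.
Proof.
move=> Oq.
apply: (@affine_in_x _ _ cF aF r2 O phi oO sphi T_x0 J0 (annihilator (jetmx th q.1))
  (annihilator (jetmx th' (phi q).1)) (rhs th q.1) (rhs th' (phi q).1)) => //.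
- exact: annihilator_max.
- exact: annihilator_max.
- move=> z zq; have := @on_th z; rewrite zq -(congr1 fst zq) => /(_ Oq)[|+ _] //.
  by apply: Delta_neq0; rewrite zq.
Qed.

Lemma smooth_xshift : smooth_on O xshift.
Proof.
by apply: smoothB => //; [apply: smooth_div => //; exact: X1_neq0|exact: smooth_snd].
Qed.

Lemma xi_x0 q : O q -> 'D_(0, 1) xshift q = 0.
Proof.
move=> Oq; have [dX dX1] := (smooth_diff sX Oq, smooth_diff sX1 Oq).
have n1 := X1_neq0 Oq.
have di : differentiable (fun q => (xfactor q)^-1) q by exact: smooth_diff (smoothV oO X1_neq0 sX1) Oq.
rewrite /xshift derivativeB; last 2 first.
- exact: differentiableM.
- exact: smooth_diff (@smooth_snd F _ _ setT) Logic.I.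
rewrite derivativeM // derivativeV // -/(xfactor q) X1_x0 // mulr0 mulr0 add0r mulfV //.
by rewrite (derivative_linpost (f := id) (L := fun q : F * F => q.2)) // ?derive_id ?subrr // => p; exact: cvg_snd.
Qed.

Section Line.
Variables (p : F * F) (d : F).
Hypothesis BO : box p d `<=` O.
Let I := interval_ball p.1 d.
Let T1 t := tcomp (t, p.2).
Let X1 t := xfactor (t, p.2).
Let xi t := xshift (t, p.2).
Local Notation Q := (prolong_sq r T1 X1).
Let d0 t : I t -> 0 < d. Proof. by rewrite /I /interval_ball /=; exact: le_lt_trans. Qed.
Let IO t : I t -> O (t, p.2).
Proof. by move=> It; apply: BO; split=> //=; rewrite subrr normr0 (d0 It). Qed.
Let oI : open I. Proof. exact: open_interval_ball. Qed.

Lemma smooth_line_T : smooth_on I T1. Proof. exact: smooth_restrict IO sT. Qed.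
Lemma smooth_line_X : smooth_on I X1. Proof. exact: smooth_restrict IO sX1. Qed.
Lemma smooth_line_xi : smooth_on I xi. Proof. exact: smooth_restrict IO smooth_xshift. Qed.

Lemma derive1_line t : derive1 T1 t = 'D_(1, 0) tcomp (t, p.2).
Proof. by rewrite derive1E derive_restrict. Qed.

Lemma line_T_neq0 t : I t -> derive1 T1 t != 0.
Proof. by move=> It; rewrite derive1_line T_t_neq0 //; exact: IO. Qed.

Lemma line_X_neq0 t : I t -> X1 t != 0.
Proof. by move=> It; apply: X1_neq0; exact: IO. Qed.

Lemma phi_box q : box p d q -> phi q = (T1 q.1, X1 q.1 * (q.2 + xi q.1)).
Proof.
move=> Bq; have Oq := BO Bq.
rewrite [LHS]surjective_pairing; congr (_, _); first exact: (box_const cF aF BO sT T_x0 Bq).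
rewrite /X1 /xi -(box_const cF aF BO sX1 X1_x0 Bq) -(box_const cF aF BO smooth_xshift xi_x0 Bq).
by rewrite /xshift subrKC mulrC divfK ?X1_neq0.
Qed.

Lemma prolong_line (z : jet F r) : box p d (jet_base z) ->
  total_deriv_T phi z = derive1 T1 z.1 /\
  (prolong phi z).2 = (z.2 + jetrow r xi z.1) *m Q z.1.
Proof.
apply: (prolong_affine oI smooth_line_T line_T_neq0 smooth_line_X r0 (B := box p d)).
- exact: open_box.
- by move=> q [].
- exact: smooth_line_xi.
- exact: phi_box.
Qed.

End Line.

Section AtPoint.
Variable p : F * F.
Hypothesis Op : O p.
Let T1 t := tcomp (t, p.2).
Let X1 t := xfactor (t, p.2).
Let xi t := xshift (t, p.2).
Let lambda := X1 p.1 / derive1 T1 p.1 ^+ r.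
Local Notation alpha := (annihilator (jetmx th p.1)).
Local Notation alpha' := (annihilator (jetmx th' (tcomp p))).

(** The prolonged map is affine on the jets over [p] and on nearby fibres of the box, so it maps one
    hyperplane to the other and [hyperplane_map] applies. *)
Lemma annihilator_line : prolong_sq r T1 X1 p.1 *m alpha' = lambda *: alpha /\
  rhs th' (tcomp p) = lambda * (rhs th p.1 + (jetrow r xi p.1 *m alpha) ord0 ord0).
Proof.
have [d d0 BO] := open_contains_box oO Op.
have Ip : interval_ball p.1 d p.1 by rewrite /interval_ball /= subrr normr0.
have H (x : 'rV[F]_r.+1) : `|x ord0 ord0 - p.2| < d ->
    (x *m alpha) ord0 ord0 = rhs th p.1 ->
    ((x + jetrow r xi p.1) *m (prolong_sq r T1 X1 p.1 *m alpha')) ord0 ord0 = rhs th' (tcomp p).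
  move=> xd xa; pose z : jet F r := (p.1, x).
  have Bz : box p d (jet_base z) by split=> //=; rewrite subrr normr0.
  have [_ E1] := prolong_line BO Bz.
  have [+ _] := on_th (BO _ Bz) (Delta_neq0 (BO _ Bz)).
  move=> /(_ xa); rewrite E1 (phi_box BO Bz) /= /tcomp -surjective_pairing => <-.
  by rewrite mulmxA.
have am : alpha ord_max ord0 = 1 by exact: annihilator_max.
have E := hyperplane_map r0 d0 am H.
rewrite (prolong_sq_max T1 X1 (@open_interval_ball _ p.1 d)) // in E; last exact: annihilator_max.
(* One point of the source equation, with order-0 coordinate [p.2], is enough to read off the target
   right-hand side. *)
split=> //; pose x : 'rV[F]_r.+1 := p.2 *: delta_mx ord0 ord0
  + (rhs th p.1 - p.2 * alpha ord0 ord0) *: delta_mx ord0 ord_max.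
have x0 : x ord0 ord0 = p.2.
  by rewrite !mxE !eqxx -val_eqE /= (ltn_eqF r0) mulr0 mulr1 addr0.
have xa : (x *m alpha) ord0 ord0 = rhs th p.1.
  by rewrite mulmxDl -!scalemxAl -!rowE mxE [X in X + _]mxE [X in _ + X]mxE
    [X in _ * X + _]mxE [X in _ + _ * X]mxE am mulr1 subrKC.
rewrite -(H x _ xa); last by rewrite x0 subrr normr0.
by rewrite E -scalemxAr [LHS]mxE mulmxDl [X in _ * X]mxE xa.
Qed.

End AtPoint.

Section Relations.
Variables (p : F * F) (d : F).
Hypothesis d0 : 0 < d.
Hypothesis BO : box p d `<=` O.
Let I := interval_ball p.1 d.
Let IO t : I t -> O (t, p.2).
Proof. by move=> It; apply: BO; split=> //=; rewrite subrr normr0. Qed.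
Let oI : open I. Proof. exact: open_interval_ball. Qed.
Let Ip : I p.1. Proof. by rewrite /I /interval_ball /= subrr normr0. Qed.
Let Ith t : I t -> pdom th t. Proof. by move=> /IO/dO[]. Qed.
Let sc i : smooth_on I (chi th i).
Proof. by have [_ sc _ _] := rth; exact: smooth_sub (sc i). Qed.
Let Wth t : I t -> wronskian th t != 0.
Proof. by have [_ _ W _] := rth; move=> /Ith; exact: W. Qed.

Lemma chi_relation : exists2 C : 'M[F]_r, \det C != 0 &
  forall t, I t -> forall i, chi th' i (tcomp (t, p.2)) =
    xfactor (t, p.2) * \sum_j C i j * chi th j t.
Proof.
pose T1 t := tcomp (t, p.2); pose X1 t := xfactor (t, p.2).
have [oth' sc' W' _] := rth'.
have IT t : I t -> pdom th' (T1 t) by move=> /IO/dO[].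
have [sT1 T10 sX1' X10] := And4 (smooth_line_T BO) (line_T_neq0 BO) (smooth_line_X BO) (line_X_neq0 BO).
(* The pull-back of a target solution; it solves the homogeneous source equation. *)
pose eta i t := chi th' i (T1 t) / X1 t.
have se i : smooth_on I (eta i).
  by apply: smooth_div => //; exact: (smooth_comp1 oI IT).
have E i t : I t -> chi th' i (T1 t) = X1 t * eta i t.
  by move=> It; rewrite /eta mulrC divfK //; exact: X10.
have JE i t : I t -> jetrow r (chi th' i) (T1 t) = jetrow r (eta i) t *m prolong_sq r T1 X1 t.
  move=> It; exact (@jetrow_compose F r I T1 X1 oI sT1 T10 sX1' _ _ _ IT (sc' i) (se i) (E i) t It).
have H i : exists c : 'rV[F]_r, forall t, I t -> eta i t = \sum_j c ord0 j * chi th j t.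
  apply: (solution_span cF aF sc Wth (se i)) => t It.
  have [Qa _] := annihilator_line (IO It).
  have := jetrow_annihilator i (W' _ (IT t It)).
  rewrite JE // -mulmxA [prolong_sq _ _ _ _ *m _]Qa -scalemxAr mxE => /eqP.
  by rewrite mulf_eq0 (negPf (lambda_neq0 r T10 X10 It)) => /eqP.
have [c Hc] := choice H; pose C : 'M[F]_r := \matrix_(i, j) c i ord0 j.
have CE t : I t -> forall i, chi th' i (T1 t) = X1 t * \sum_j C i j * chi th j t.
  by move=> It i; rewrite E // Hc //; congr (_ * _); apply: eq_bigr => j _; rewrite mxE.
exists C => //.
(* The target Wronskian is det C times the source Wronskian times a factor, so its being nonzero at
   one t gives det C != 0. *)
have J' : jetmx th' (T1 p.1) = C *m jetmx th p.1 *m prolong_sq r T1 X1 p.1.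
  apply/row_matrixP => i; rewrite row_jetmx JE // !row_mul; congr (_ *m _).
  have -> : row i C = c i by apply/matrixP => a b; rewrite !mxE (ord1 a).
  rewrite -(jetrow_lincomb _ oI sc Ip); apply: jetrow_near.
  by apply: filterS (open_near oI Ip) => t; exact: Hc.
have := W' _ (IT _ Ip); rewrite -jet_wronskianE J'.
have [q _ ->] := jet_wronskian_transform (T := T1) (X1 := X1) oI T10 X10 C (jetmx th p.1) Ip.
by apply: contraNneq => ->; rewrite !mul0r.
Qed.

Lemma shift_relation : rhs0 th -> rhs0 th' -> exists c : 'rV[F]_r,
  forall t, I t -> xshift (t, p.2) = \sum_j c ord0 j * chi th j t.
Proof.
move=> h h'; apply: (solution_span cF aF sc Wth (smooth_line_xi BO)) => t It.
have [_] := annihilator_line (IO It); rewrite h'; last by have [] := dO (IO It).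
rewrite h ?add0r; last exact: Ith.
move/esym/eqP; rewrite mulf_eq0 (negPf (lambda_neq0 r (line_T_neq0 BO) (line_X_neq0 BO) It)).
by move/eqP.
Qed.

End Relations.

Section LocalConstants.
Variable ht : bool.
Hypothesis hth : ht -> rhs0 th /\ rhs0 th'.

Let related (p : F * F) (Cc : 'M[F]_r * 'rV[F]_r) (q : F * F) :=
  (forall i, chi th' i (tcomp q) = xfactor q * \sum_j Cc.1 i j * chi th j q.1) /\
  (ht -> xshift q = \sum_j Cc.2 ord0 j * chi th j q.1).

Let locally_related p Cc := [/\ \det Cc.1 != 0, ~~ ht -> Cc.2 = 0 &
  exists d, [/\ 0 < d, box p d `<=` O & forall q, box p d q -> related p Cc q]].

Let local_constants p : O p -> exists Cc, locally_related p Cc.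
Proof.
move=> Op; have [d d0 BO] := open_contains_box oO Op.
have [C C0 CE] := chi_relation d0 BO.
have H : exists c : 'rV[F]_r, (~~ ht -> c = 0) /\ (ht -> forall t, interval_ball p.1 d t ->
    xshift (t, p.2) = \sum_j c ord0 j * chi th j t).
  case: ht hth => [/(_ isT)[h h']|_]; last by exists 0.
  have [c Hc] := shift_relation d0 BO h h'.
  by exists c.
have [c [c0 cE]] := H; exists (C, c); split=> //; exists d; split=> // q Bq.
have Iq : interval_ball p.1 d q.1 by case: Bq.
split=> [i|hh].
  by rewrite (box_const cF aF BO sT T_x0 Bq) (box_const cF aF BO sX1 X1_x0 Bq) CE.
by rewrite (box_const cF aF BO smooth_xshift xi_x0 Bq) cE.
Qed.

(** Constants are chosen independently at every point, each choice being valid in a box. On the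
    overlap of two boxes, linear independence of the chi_j forces the choices to agree, so they are
    locally constant. *)
Lemma arrow_constants : exists (C : F * F -> 'M[F]_r) (c : F * F -> 'rV[F]_r),
  (forall p, ~~ ht -> O p -> c p = 0) /\
  forall p, O p -> \det (C p) != 0 /\ exists d, [/\ 0 < d, box p d `<=` O &
    forall q, box p d q -> [/\ C q = C p, c q = c p,
      forall i, chi th' i (tcomp q) = xfactor q * \sum_j C p i j * chi th j q.1 &
      ht -> xshift q = \sum_j c p ord0 j * chi th j q.1]].
Proof.
have /choice[f Hf] : forall p, exists Cc, O p -> locally_related p Cc.
  move=> p; case: (pselect (O p)) => [/local_constants[Cc H]|nO]; first by exists Cc.
  by exists (0, 0).
exists (fun p => (f p).1), (fun p => (f p).2); split=> [p nh /Hf[_ /(_ nh)]//|p Op].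
have [C0 c0 [d [d0 BO Hd]]] := Hf p Op; split=> //; exists d; split=> // q Bq.
have Oq := BO _ Bq; have [C0' c0' [d' [d0' BO' Hd']]] := Hf q Oq.
(* The overlap is used only along the horizontal line through [q], as uniqueness is a statement
   about functions of t. *)
have Bn : \forall u \near q.1, box p d (u, q.2) /\ box q d' (u, q.2).
  have o1 : open [set u : F | box p d (u, q.2)].
    rewrite (_ : [set u | _] = interval_ball p.1 d); first exact: open_interval_ball.
    by apply/funext => u; apply/propext; split=> [[]//|h]; split=> //; case: Bq.
  have o2 : open [set u : F | box q d' (u, q.2)].
    rewrite (_ : [set u | _] = interval_ball q.1 d'); first exact: open_interval_ball.
    by apply/funext => u; apply/propext; split=> [[]//|h]; split=> //=; rewrite subrr normr0.
  apply: filterI; [apply: open_near o1 _|apply: open_near o2 _] => /=.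
    by rewrite -surjective_pairing.
  by rewrite -surjective_pairing; exact: box_center.
have [H1 H2] := Hd q Bq; split=> //.
  apply/row_matrixP => i; apply: (lincomb_uniq rth (t := q.1)); first by case: (dO Oq).
  apply: filterS Bn => u [Bp Bq'].
  have [/(_ i) Ep _] := Hd _ Bp; have [/(_ i)] := Hd' _ Bq'; rewrite Ep => + _.
  move/(mulfI (X1_neq0 (BO _ Bp))) => /= E1.
  rewrite (eq_bigr (fun j => (f q).1 i j * chi th j u)) => [|j _]; last by rewrite mxE.
  by rewrite -E1; apply: eq_bigr => j _; rewrite mxE.
have [hh|nh] := boolP ht; last by rewrite c0 // c0'.
apply: (lincomb_uniq rth (t := q.1)); first by case: (dO Oq).
apply: filterS Bn => u [Bp Bq'].
by have [_ /(_ hh) <-] := Hd _ Bp; have [_ /(_ hh) <-] := Hd' _ Bq'.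
Qed.

End LocalConstants.

End ArrowStructure.

(** * Construction of admissible transformations *)

Section NewArrow.
Variables (F : numFieldType) (r : nat).
Hypothesis cF : geometric_complete F.
Hypothesis aF : dyadic_archi F.
Hypothesis r0 : (0 < r)%N.
Variables (th : param F r) (I : set F) (T X1 xi : F -> F) (C : 'M[F]_r) (t0 : F).
Hypothesis rth : regular th.
Hypothesis oI : open I.
Hypothesis It0 : I t0.
Hypothesis Ith : forall t, I t -> pdom th t.
Hypothesis sT : smooth_on I T.
Hypothesis T0 : forall t, I t -> derive1 T t != 0.
Hypothesis sX : smooth_on I X1.
Hypothesis X0 : forall t, I t -> X1 t != 0.
Hypothesis sxi : smooth_on I xi.
Hypothesis C0 : \det C != 0.
Local Notation alpha t := (annihilator (jetmx th t)).
Local Notation lambda t := (X1 t / derive1 T t ^+ r).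

(** The target is transported by the inverse [S] of [T]: chi~_i = (X1 sum_j C_ij chi_j) o S, and
    similarly b. Its domain is exactly the image of [V], so that constraints on it need checking
    only at points T(t). *)
Lemma new_arrow : exists (V : set F) (th' : param F r),
  [/\ open V, V t0 & V `<=` I] /\
  [/\ regular th', forall t, V t -> pdom th' (T t),
     (forall s, pdom th' s -> exists2 t, V t & s = T t),
     (forall t, V t -> forall i, chi th' i (T t) = X1 t * \sum_j C i j * chi th j t)
   & forall t, V t ->
       prolong_sq r T X1 t *m annihilator (jetmx th' (T t)) = lambda t *: alpha t /\
       rhs th' (T t) = lambda t * (rhs th t + (jetrow r xi t *m alpha t) ord0 ord0)] /\
  (forall (O : set (F * F)) (phi : F * F -> F * F), open O ->
    (forall q, O q -> V q.1 /\ phi q = (T q.1, X1 q.1 * (q.2 + xi q.1))) ->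
    [/\ smooth_on O phi, (forall q, O q -> jac phi q != 0) &
      forall z : jet F r, O (jet_base z) ->
        on_equation th z <-> on_equation th' (prolong phi z)]).
Proof.
have [V [S [[oV Vt0 VI] [oTV sS ST]]]] := inverse_function cF aF oI sT It0 (T0 It0).
have [oth sc W sr] := rth.
have scI i : smooth_on I (chi th i) by exact: smooth_sub (sc i).
have SI s : (T @` V) s -> I (S s) by move=> [t Vt <-]; rewrite ST //; exact: VI.
pose y i t := \sum_j C i j * chi th j t.
have sy i : smooth_on I (y i).
  by apply: smooth_sum => // j _; apply: smoothM => //; exact: smooth_cst.
pose b t := lambda t * (rhs th t + (jetrow r xi t *m alpha t) ord0 ord0).
have slam : smooth_on I (fun t => lambda t).
  apply: smooth_div => //; first by move=> t It; rewrite expf_neq0 // T0.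
  by apply: smoothX => //; exact: smooth_derive1.
have sb : smooth_on I b.
  apply: smoothM => //; apply: smoothD => //; first exact: smooth_sub sr.
  rewrite (_ : (fun p => _) = (fun t => \sum_(k < r.+1) derive1n k xi t * alpha t k ord0)); last first.
    by apply/funext => t; rewrite mxE; apply: eq_bigr => k _; rewrite mxE.
  apply: smooth_sum => // k _; apply: smoothM => //; first exact: smooth_derive1n.
  apply: smooth_annihilator => // [t It|i l]; first by rewrite jet_wronskianE W //; exact: Ith.
  exact: smooth_sub Ith (smooth_jetmx i l rth).
pose th' := Param (T @` V) (fun (i : 'I_r) s => X1 (S s) * y i (S s)) (fun s => b (S s)).
have sc' i : smooth_on (T @` V) (chi th' i).
  by apply: smoothM => //; exact: (smooth_comp1 oTV SI).
have chiE i t : V t -> chi th' i (T t) = X1 t * y i t by move=> Vt; rewrite /= ST.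
have sub (f : F -> F) : smooth_on I f -> smooth_on V f by exact: smooth_sub.
have T0V t : V t -> derive1 T t != 0 by move=> /VI; exact: T0.
have X0V t : V t -> X1 t != 0 by move=> /VI; exact: X0.
have TV t : V t -> pdom th' (T t) by move=> Vt; exists t.
have JE t : V t -> jetmx th' (T t) = C *m jetmx th t *m prolong_sq r T X1 t.
  move=> Vt; apply/row_matrixP => i; rewrite row_jetmx !row_mul.
  rewrite (@jetrow_compose F r V T X1 oV (sub _ sT) T0V (sub _ sX) _ _ _ TV (sc' i) (sub _ (sy i)) (chiE i) t Vt).
  congr (_ *m _); rewrite -(jetrow_lincomb _ oI scI); last exact: VI.
  by congr (jetrow _ _ _); apply/funext => u; apply: eq_bigr => j _; rewrite mxE.
have W' s : (T @` V) s -> wronskian th' s != 0.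
  move=> [t Vt <-]; rewrite -jet_wronskianE JE //.
  have [q q0 ->] := jet_wronskian_transform (T := T) (X1 := X1) oV T0V X0V C (jetmx th t) Vt.
  by rewrite !mulf_neq0 // jet_wronskianE W //; exact/Ith/VI.
exists V, th'; split=> //; split.
  split=> //.
  - by split=> //; exact: (smooth_comp1 oTV SI sb sS).
  - by move=> s [t Vt <-]; exists t.
  - by move=> t Vt i; rewrite /= ST.
  - move=> t Vt; rewrite /= ST //; split=> //; rewrite JE //.
    rewrite (annihilator_transform (T := T) (X1 := X1) oV T0V X0V Vt C0) //.
    by rewrite jet_wronskianE W //; exact/Ith/VI.
move=> O phi oO H.
have OV q : O q -> V q.1 by move=> /H[].
have OI q : O q -> I q.1 by move=> /OV/VI.
have E q : O q -> phi q = (T q.1, X1 q.1 * (q.2 + xi q.1)) by move=> /H[].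
have s2 : smooth_on O (fun q => X1 q.1 * (q.2 + xi q.1)).
  apply: smoothM => //; first exact: smooth_comp_fst OI sX.
  by apply: smoothD => //; [exact: smooth_snd|exact: smooth_comp_fst OI sxi].
split.
- apply: (@smooth_eq _ _ _ O (fun q => (T q.1, X1 q.1 * (q.2 + xi q.1)))) => // [q /E//|].
  by apply: smooth_pair => //; exact: smooth_comp_fst OI sT.
- move=> q Oq; have Iq := OI _ Oq.
  have nE : \forall p \near q, phi p = (T p.1, X1 p.1 * (p.2 + xi p.1)).
    by apply: filterS (open_near oO Oq); exact: E.
  have ET v : 'D_v (fun q => (phi q).1) q = derive1 T q.1 * v.1.
    rewrite -derivative_comp_fst; last exact: smooth_diff sT Iq.
    by apply: near_eq_derive; apply: filterS nE => p ->.
  have EX : 'D_(0, 1) (fun q => (phi q).2) q = X1 q.1.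
    have dX1 : differentiable (fun q : F * F => X1 q.1) q.
      exact: smooth_diff (smooth_comp_fst oO OI sX) Oq.
    have dxi : differentiable (fun q : F * F => xi q.1) q.
      exact: smooth_diff (smooth_comp_fst oO OI sxi) Oq.
    have d2 : differentiable (fun q : F * F => q.2) q.
      exact: smooth_diff (@smooth_snd F _ _ setT) Logic.I.
    rewrite (@near_eq_derive _ _ _ _ (fun q => X1 q.1 * (q.2 + xi q.1))); last first.
      by apply: filterS nE => p ->.
    rewrite derivativeM //; last exact: differentiableD.
    rewrite derivativeD // derivative_snd !derivative_comp_fst /= ?mulr0 ?mul0r ?addr0 ?mulr1 //.
    + exact: smooth_diff sX Iq.
    + exact: smooth_diff sxi Iq.
  by rewrite /jac !ET EX mulr1 mulr0 mul0r subr0 mulf_neq0 ?T0 ?X0.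
- move=> z Oz; have Vz := OV _ Oz.
  have [_ E2] := prolong_affine oV (sub _ sT) T0V (sub _ sX) r0 oO OV (sub _ sxi) E Oz.
  have E1 : (prolong phi z).1 = T z.1 by rewrite /= E.
  have Wz : wronskian th z.1 != 0 by apply/W/Ith/VI.
  have Wz' : wronskian th' (prolong phi z).1 != 0 by rewrite E1; apply: W'; exact: TV.
  rewrite (on_equationE Wz) (on_equationE Wz') E1 E2 JE // -mulmxA.
  have lam0 : lambda z.1 != 0 by exact: (lambda_neq0 r T0V X0V Vz).
  rewrite (annihilator_transform (T := T) (X1 := X1) oV T0V X0V Vz C0); last by rewrite jet_wronskianE.
  rewrite /= ST // /b -scalemxAr [X in _ <-> X = _]mxE mulmxDl [X in _ <-> _ * X = _]mxE.
  by split=> [->//|/(mulfI lam0)/addIr].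
Qed.

End NewArrow.

(** * Maps of the extended jet space *)

Section ExtSpace.
Variables (F : numFieldType) (r : nat).
Local Notation E := (ext_space F r).
Implicit Types q v w : E.

Definition xcoord (k : 'I_r.+1) (q : E) : F := q.1.2 ord0 k.
Definition ccoord (i : 'I_r) (k : 'I_r.+1) (q : E) : F := q.2.1 i k.

Lemma linear_tcoord : linear (fun q : E => q.1.1). Proof. by []. Qed.
Lemma linear_bcoord : linear (fun q : E => q.2.2). Proof. by []. Qed.
Lemma linear_xcoord k : linear (xcoord k).
Proof. by move=> a q q'; rewrite /xcoord /= !mxE. Qed.
Lemma linear_ccoord i k : linear (ccoord i k).
Proof. by move=> a q q'; rewrite /ccoord /= !mxE. Qed.

Lemma smooth_jetpart (U : set E) : smooth_on U (fun q => q.1).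
Proof. exact: smooth_fst. Qed.

Lemma smooth_tcoord (U : set E) : open U -> smooth_on U (fun q => q.1.1).
Proof.
move=> oU; apply: (smooth_linpost (L := fun z : F * 'rV[F]_r.+1 => z.1)) => //.
  by move=> p; exact: cvg_fst.
exact: smooth_jetpart.
Qed.

Lemma smooth_bcoord (U : set E) : open U -> smooth_on U (fun q => q.2.2).
Proof.
move=> oU; apply: (smooth_linpost (L := fun z : 'M[F]_(r, r.+1) * F => z.2)) => //.
  by move=> p; exact: cvg_snd.
exact: smooth_snd.
Qed.

Lemma smooth_xcoord (U : set E) k : open U -> smooth_on U (xcoord k).
Proof.
move=> oU; apply: smooth_coord => //.
apply: (smooth_linpost (L := fun z : F * 'rV[F]_r.+1 => z.2)) => //.
  by move=> p; exact: cvg_snd.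
exact: smooth_jetpart.
Qed.

Lemma smooth_ccoord (U : set E) i k : open U -> smooth_on U (ccoord i k).
Proof.
move=> oU; apply: smooth_coord => //.
apply: (smooth_linpost (L := fun z : 'M[F]_(r, r.+1) * F => z.1)) => //.
  by move=> p; exact: cvg_fst.
exact: smooth_snd.
Qed.

Lemma smooth_continuous (g : E -> F) : smooth_on setT g -> continuous g.
Proof. by move=> sg p; exact: smooth_cont sg Logic.I. Qed.

Lemma continuous_tcoord : continuous (fun q : E => q.1.1).
Proof. by apply: smooth_continuous; exact: smooth_tcoord openT. Qed.
Lemma continuous_bcoord : continuous (fun q : E => q.2.2).
Proof. by apply: smooth_continuous; exact: smooth_bcoord openT. Qed.
Lemma continuous_xcoord k : continuous (xcoord k).
Proof. by apply: smooth_continuous; exact: smooth_xcoord openT. Qed.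
Lemma continuous_ccoord i k : continuous (ccoord i k).
Proof. by apply: smooth_continuous; exact: smooth_ccoord openT. Qed.

Lemma ext_eq q q' : q.1.1 = q'.1.1 -> (forall k, xcoord k q = xcoord k q') ->
  (forall i k, ccoord i k q = ccoord i k q') -> q.2.2 = q'.2.2 -> q = q'.
Proof.
move: q q' => [[t x] [J b]] [[t' x'] [J' b']] /= -> Hx HJ ->.
congr (_, _, (_, _)); first by apply/matrixP => i k; rewrite (ord1 i); exact: Hx.
by apply/matrixP => i k; exact: HJ.
Qed.

Definition shiftmx m (A : 'M[F]_(m, r.+1)) : 'M[F]_(m, r.+1) :=
  \matrix_(i < m, k < r.+1) if (k < r)%N then A i (inord k.+1) else 0.

(** D_t with the derivatives of the chi_i as further coordinates. What would leave the space at the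
    top order, and the b-component, are set to 0; the map below applies the field only to functions
    of order below r that do not involve b. *)
Definition efield q : E := (jfield q.1, (shiftmx q.2.1, 0)).
Definition eshift q : E := (jshift q.1, (shiftmx q.2.1, 0)).

(* No condition on the component b. *)
Definition eorder (m : nat) : set E := [set w | w.1.1 = 0 /\
  forall k : 'I_r.+1, (k <= m)%N -> xcoord k w = 0 /\ forall i, ccoord i k w = 0].

Lemma efield_shift q w : efield (q + w) = efield q + eshift w.
Proof.
rewrite /efield jfield_shift; congr (_, (_, _)); last by rewrite addr0.
by apply/matrixP => i j; rewrite !mxE; case: ifP; rewrite ?addr0 // mxE.
Qed.

Lemma eshift_scale (h : F) w : eshift (h *: w) = h *: eshift w.
Proof.
congr ((_, _), (_, _)); rewrite /= ?[h *: 0]scaler0 //.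
  by apply/matrixP => i j; rewrite !mxE; case: ifP; rewrite ?mulr0 // mxE.
by apply/matrixP => i j; rewrite !mxE; case: ifP; rewrite ?mulr0 // mxE.
Qed.

Lemma xcoord_eshift k w : (k < r)%N -> xcoord (inord k) (eshift w) = xcoord (inord k.+1) w.
Proof. by move=> kr; rewrite /xcoord mxE inordK ?kr // ltnS ltnW. Qed.

Lemma ccoord_eshift i k w : (k < r)%N -> ccoord i (inord k) (eshift w) = ccoord i (inord k.+1) w.
Proof. by move=> kr; rewrite /ccoord mxE inordK ?kr // ltnS ltnW. Qed.

Lemma eshift_order m w : eorder m.+1 w -> eorder m (eshift w).
Proof.
move=> [w1 w2]; split=> // k km; rewrite /xcoord mxE.
have [kr|kr] := ltnP k r; last by split=> // i; rewrite /ccoord mxE ltnNge kr.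
have [] := w2 (inord k.+1); rewrite /xcoord ?inordK // => -> H; split=> // i.
by have := H i; rewrite /ccoord mxE kr.
Qed.

Lemma eorderS m w : eorder m.+1 w -> eorder m w.
Proof. by move=> [w1 w2]; split=> // k km; apply: w2; exact: leqW. Qed.

Lemma eorderD m (c : F) w w' : eorder m w -> eorder m w' -> eorder m (c *: w + w').
Proof.
move=> [w1 w2] [w1' w2']; split=> [|k km].
  by rewrite /= w1 w1' scaler0 addr0.
have [a1 b1] := w2 k km; have [a2 b2] := w2' k km.
by split=> [|i]; rewrite ?linear_xcoord ?linear_ccoord ?a1 ?a2 ?b1 ?b2 scaler0 addr0.
Qed.

Local Notation D := (Lie efield).
Local Notation orde := (of_order eorder).

Lemma eorder_Lie m g : orde m g -> orde m.+1 (D g).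
Proof. exact: (of_order_Lie efield_shift eshift_order eorderS eorderD). Qed.

Lemma eorder_le m n g : (m <= n)%N -> orde m g -> orde n g.
Proof. exact: (of_order_le eorderS). Qed.

Lemma efieldE q : efield q = (((1, 0), 0) : E)
  + (\sum_(k < r.+1) (if (k < r)%N then xcoord (inord k.+1) q else 0) *: (((0, delta_mx ord0 k), 0) : E)
  + \sum_(i < r) \sum_(k < r.+1) (if (k < r)%N then ccoord i (inord k.+1) q else 0) *: ((0, (delta_mx i k, 0)) : E)).
Proof.
have SX k : linear (xcoord k) := linear_xcoord k.
pose tM := GRing.isLinear.Build _ _ _ _ _ linear_tcoord.
pose tL : {linear E -> F} := HB.pack (fun q : E => q.1.1) tM.
pose bM := GRing.isLinear.Build _ _ _ _ _ linear_bcoord.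
pose bL : {linear E -> F} := HB.pack (fun q : E => q.2.2) bM.
pose xM k := GRing.isLinear.Build _ _ _ _ _ (linear_xcoord k).
pose xL k : {linear E -> F} := HB.pack (xcoord k) (xM k).
pose cM i k := GRing.isLinear.Build _ _ _ _ _ (linear_ccoord i k).
pose cL i k : {linear E -> F} := HB.pack (ccoord i k) (cM i k).
apply: ext_eq.
- rewrite -[RHS]/(tL _) !linearD !linear_sum !big1 ?addr0 //.
    by move=> i _; rewrite linear_sum big1 // => k _; rewrite linearZ /= scaler0.
  by move=> i _; rewrite linearZ /= scaler0.
- move=> k; rewrite -[RHS]/(xL k _) !linearD !linear_sum [X in _ + (_ + X)]big1 ?addr0; last first.
    by move=> i _; rewrite linear_sum big1 // => l _; rewrite linearZ /= /xcoord mxE scaler0.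
  rewrite (bigD1 k) // big1 => [|l lk]; rewrite linearZ /= /xcoord !mxE ?eqxx.
    by rewrite [_ *: 1]mulr1 addr0 add0r.
  by rewrite eq_sym (negPf lk) scaler0.
- move=> i k; rewrite -[RHS]/(cL i k _) !linearD !linear_sum [X in _ + (X + _)]big1 ?add0r; last first.
    by move=> l _; rewrite linearZ /= /ccoord mxE scaler0.
  rewrite (bigD1 i) // linear_sum (bigD1 k) // !big1 => [|j ji|l lk].
  + by rewrite linearZ /= /ccoord !mxE !eqxx [_ *: 1]mulr1 !addr0 add0r.
  + rewrite linear_sum big1 // => l _; rewrite linearZ /= /ccoord !mxE.
    by rewrite eq_sym (negPf ji) scaler0.
  + by rewrite linearZ /= /ccoord !mxE eqxx eq_sym (negPf lk) scaler0.
- rewrite -[RHS]/(bL _) !linearD !linear_sum !big1 ?addr0 //.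
    by move=> i _; rewrite linear_sum big1 // => k _; rewrite linearZ /= scaler0.
  by move=> i _; rewrite linearZ /= scaler0.
Qed.

Lemma smooth_eD (U : set E) g : open U -> smooth_on U g -> smooth_on U (D g).
Proof.
move=> oU sg; apply: (@smooth_eq _ _ _ U (fun q => 'D_(((1, 0), 0) : E) g q
  + (\sum_(k < r.+1) (if (k < r)%N then xcoord (inord k.+1) q else 0) * 'D_(((0, delta_mx ord0 k), 0) : E) g q
  + \sum_(i < r) \sum_(k < r.+1) (if (k < r)%N then ccoord i (inord k.+1) q else 0) * 'D_((0, (delta_mx i k, 0)) : E) g q))) => //.
  move=> q Uq; have dg := smooth_diff sg Uq.
  rewrite /Lie efieldE !derivative_addv // !derivative_sumv //; congr (_ + (_ + _)).
    by apply: eq_bigr => k _; rewrite derivative_scalev.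
  apply: eq_bigr => i _; rewrite derivative_sumv //; apply: eq_bigr => k _.
  by rewrite derivative_scalev.
apply: smoothD => //; first exact: smooth_deriv.
apply: smoothD => //.
  apply: smooth_sum => // k _; apply: smoothM => //; last exact: smooth_deriv.
  by case: (k < r)%N; [exact: smooth_xcoord|exact: smooth_cst].
apply: smooth_sum => // i _; apply: smooth_sum => // k _; apply: smoothM => //; last exact: smooth_deriv.
by case: (k < r)%N; [exact: smooth_ccoord|exact: smooth_cst].
Qed.

Definition ebase q : F * F := jet_base q.1.

Lemma linear_ebase : linear ebase.
Proof. by move=> c q q'; rewrite /ebase /jet_base /= !mxE. Qed.

Lemma continuous_ebase : continuous ebase.
Proof.
move=> q; apply: continuous_comp; first exact: cvg_fst.
exact: continuous_jet_base.
Qed.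

Lemma smooth_ebase (O : set (F * F)) (f : F * F -> F) : smooth_on O f ->
  smooth_on (ebase @^-1` O) (fun q => f (ebase q)).
Proof.
by apply: smooth_linpre; [exact: linear_ebase|exact: continuous_ebase].
Qed.

Lemma open_ebase (O : set (F * F)) : open O -> open (ebase @^-1` O).
Proof. by move=> oO; apply: open_comp => // z _; exact: continuous_ebase. Qed.

Lemma ebase_order (f : F * F -> F) : orde 0 (fun q => f (ebase q)).
Proof.
move=> q w [w1 w2]; have [wx _] := w2 ord0 (leq0n _).
by rewrite /ebase /jet_base /= mxE w1 addr0 -[w.1.2 _ _]/(xcoord ord0 w) wx addr0.
Qed.

Lemma derivative_ebase (f : F * F -> F) q v : differentiable f (ebase q) ->
  'D_(0, 1) f (ebase q) = 0 ->
  'D_v (fun q => f (ebase q)) q = v.1.1 * 'D_(1, 0) f (ebase q).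
Proof.
move=> df f0; pose LM := GRing.isLinear.Build _ _ _ _ _ linear_ebase.
pose L : {linear E -> (F * F)%type} := HB.pack ebase LM.
rewrite (derive_linpre L) /= (_ : ebase v = v.1.1 *: (1, 0) + v.1.2 ord0 ord0 *: ((0, 1) : F * F)).
  rewrite derivative_addv // !derivative_scalev // f0 [_ *: 0]mulr0 addr0 //.
by congr (_, _); rewrite /= ?scaler0 ?addr0 ?add0r [_ *: _]mulr1.
Qed.

End ExtSpace.

(** * The map of the extended jet space determined by T, X1, X0, C and c *)

Section ExtMap.
Variables (F : numFieldType) (r : nat).
Local Notation E := (ext_space F r).
Local Notation D := (Lie (@efield F r)).
Local Notation orde := (of_order (@eorder F r)).
Hypothesis r1 : (1 < r)%N.
Let r0 : (0 < r)%N. Proof. exact: ltnW. Qed.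
Let i0 : 'I_r := Ordinal r0.
Let i1 : 'I_r := Ordinal r1.

Variables (kd : nat) (O : set (F * F)) (T X1 X0 : F * F -> F).
Variables (C : F * F -> 'M[F]_r) (c : F * F -> 'rV[F]_r).
Hypothesis kd2 : (kd <= 2)%N.
Hypothesis oO : open O.
Hypotheses (sT : smooth_on O T) (sX1 : smooth_on O X1) (sX0 : smooth_on O X0).
Hypotheses (T_0 : forall p, O p -> 'D_(0, 1) T p = 0)
  (X1_0 : forall p, O p -> 'D_(0, 1) X1 p = 0)
  (X0_0 : forall p, O p -> 'D_(0, 1) X0 p = 0).
Hypothesis X1_neq0 : forall p, O p -> X1 p != 0.
Hypothesis sC : forall i j, smooth_on O (fun p => C p i j).
Hypothesis sc : forall j, smooth_on O (fun p => c p ord0 j).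
Hypothesis C_0 : forall i j p v, O p -> 'D_v (fun p => C p i j) p = 0.
Hypothesis c_0 : forall j p v, O p -> 'D_v (fun p => c p ord0 j) p = 0.
Hypothesis C_neq0 : forall p, O p -> \det (C p) != 0.

(* [kd] is the number of functions chi_i prescribed by the constraints (chi_1 = 1,
   chi_2 = t): for [kd > 0] the factor X1 of x, and for [kd = 2] also T, are
   determined by the constants C. *)
Definition clin (i : 'I_r) (q : E) : F := \sum_j C (ebase q) i j * ccoord j ord0 q.
Definition ccomb (q : E) : F := \sum_j c (ebase q) ord0 j * ccoord j ord0 q.
Definition omega (q : E) : F := if kd == 0%N then X1 (ebase q) else (clin i0 q)^-1.
Definition ychi (i : 'I_r) (q : E) : F := omega q * clin i q.
Definition text (q : E) : F := if kd == 2%N then ychi i1 q else T (ebase q).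
Definition xext (q : E) : F := omega q * (xcoord ord0 q + ccomb q) + X0 (ebase q).
Definition Dtext : E -> F := D text.
Definition iterD (k : nat) (g : E -> F) : E -> F := iter k (fun g q => D g q / Dtext q) g.

Definition dom1 : set E :=
  [set q | O (ebase q) /\ (if kd == 0%N then 1 else clin i0 q) != 0].
Definition dom2 : set E := [set q | dom1 q /\ Dtext q != 0].

Let U0 : set E := @ebase F r @^-1` O.
Let oU0 : open U0. Proof. exact: open_ebase. Qed.

Lemma smooth_clin i : smooth_on U0 (clin i).
Proof.
apply: smooth_sum => // j _; apply: smoothM => //; last exact: smooth_ccoord.
exact (@smooth_ebase F r O (fun p => C p i j) (sC i j)).
Qed.

Lemma smooth_ccomb : smooth_on U0 ccomb.
Proof.
apply: smooth_sum => // j _; apply: smoothM => //; last exact: smooth_ccoord.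
exact (@smooth_ebase F r O (fun p => c p ord0 j) (sc j)).
Qed.

Lemma open_dom1 : open dom1.
Proof.
apply: open_neq0 => //; case: (kd == 0%N); first exact: smooth_cst.
exact: smooth_clin.
Qed.

Let U01 : dom1 `<=` U0. Proof. by move=> q []. Qed.

Lemma smooth_base1 (f : F * F -> F) : smooth_on O f -> smooth_on dom1 (fun q => f (ebase q)).
Proof. by move=> sf; apply: (@smooth_sub _ _ _ U0) => //; exact (@smooth_ebase F r O f sf). Qed.

Lemma smooth_omega : smooth_on dom1 omega.
Proof.
have o1 := open_dom1; rewrite /omega; have [k0|k0] := eqVneq kd 0%N.
  exact: (smooth_base1 sX1).
apply: smoothV => //; last exact: smooth_sub U01 (smooth_clin _).
by move=> q [_]; rewrite (negPf k0).
Qed.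

Lemma omega_neq0 q : dom1 q -> omega q != 0.
Proof.
move=> [Oq]; rewrite /omega; case: (kd == 0%N) => H; first exact: X1_neq0.
by rewrite invr_eq0.
Qed.

Lemma smooth_ychi i : smooth_on dom1 (ychi i).
Proof.
apply: smoothM; [exact: open_dom1|exact: smooth_omega|].
exact: smooth_sub U01 (smooth_clin _).
Qed.

Lemma smooth_text : smooth_on dom1 text.
Proof.
rewrite /text; case: (kd == 2)%N; first exact: smooth_ychi.
exact: (smooth_base1 sT).
Qed.

Lemma smooth_xext : smooth_on dom1 xext.
Proof.
have o1 := open_dom1; apply: smoothD => //; last exact: (smooth_base1 sX0).
apply: smoothM => //; first exact: smooth_omega.
apply: smoothD => //; first exact: smooth_xcoord.
exact: smooth_sub U01 smooth_ccomb.
Qed.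

Lemma smooth_Dtext : smooth_on dom1 Dtext.
Proof. by apply: smooth_eD; [exact: open_dom1|exact: smooth_text]. Qed.

Lemma open_dom2 : open dom2.
Proof. by apply: open_neq0; [exact: open_dom1|exact: smooth_Dtext]. Qed.

Let U12 : dom2 `<=` dom1. Proof. by move=> q []. Qed.

Lemma smooth_iterD k g : smooth_on dom2 g -> smooth_on dom2 (iterD k g).
Proof.
have o2 := open_dom2; move=> sg; elim: k => // k IH; apply: smooth_div => //.
- by move=> q [].
- exact: smooth_eD.
- exact: smooth_sub U12 smooth_Dtext.
Qed.

Lemma clin_order i : orde 0 (clin i).
Proof.
move=> q w Sw; apply: eq_bigr => j _; rewrite (@ebase_order F r (fun p => C p i j) q w Sw).
by have [_ /(_ ord0 (leqnn _))[_ /(_ j)]] := Sw; rewrite /ccoord mxE => ->; rewrite addr0.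
Qed.

Lemma ccomb_order : orde 0 ccomb.
Proof.
move=> q w Sw; apply: eq_bigr => j _; rewrite (@ebase_order F r (fun p => c p ord0 j) q w Sw).
by have [_ /(_ ord0 (leqnn _))[_ /(_ j)]] := Sw; rewrite /ccoord mxE => ->; rewrite addr0.
Qed.

Lemma omega_order : orde 0 omega.
Proof.
move=> q w Sw; rewrite /omega clin_order //; case: (kd == 0%N) => //.
exact: (@ebase_order F r X1 q w Sw).
Qed.

Lemma ychi_order i : orde 0 (ychi i).
Proof. by move=> q w Sw; rewrite /ychi omega_order // clin_order. Qed.

Lemma text_order : orde 0 text.
Proof.
move=> q w Sw; rewrite /text ychi_order //; case: (kd == 2)%N => //.
exact: (@ebase_order F r T q w Sw).
Qed.

Lemma xext_order : orde 0 xext.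
Proof.
move=> q w Sw; rewrite /xext omega_order // ccomb_order //.
rewrite (@ebase_order F r X0 q w Sw); congr (_ * (_ + _) + _).
by have [_ /(_ ord0 (leqnn _))[+ _]] := Sw; rewrite /xcoord mxE => ->; rewrite addr0.
Qed.

Lemma Dtext_order : orde 1 Dtext.
Proof. exact: eorder_Lie text_order. Qed.

Lemma iterD_order k g : orde 0 g -> orde k (iterD k g).
Proof.
move=> og; elim: k => // k IH q w Sw; rewrite /iterD /= -/(iterD k g).
by congr (_ / _); [exact: (eorder_Lie IH)|exact (@eorder_le F r 1 k.+1 Dtext (ltn0Sn k) Dtext_order q w Sw)].
Qed.

(** A vector without components of order up to k is felt only through its part of order k+1, shifted
    down to order 0. The correction by [text] arises in the first step, where numerator and
    denominator vary together; in later steps [Dtext] has too low an order to vary. *)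
Lemma deriv_iterD k g q v : orde 0 g -> smooth_on dom2 g -> dom2 q -> eorder k v ->
  'D_v (iterD k.+1 g) q =
  (Dtext q)^-1 ^+ k.+1 * ('D_(iter k.+1 (@eshift F r) v) g q
     - D g q / Dtext q * 'D_(iter k.+1 (@eshift F r) v) text q).
Proof.
move=> og sg Uq; have o2 := open_dom2.
have dT : differentiable Dtext q by exact: smooth_diff smooth_Dtext (proj1 Uq).
have dtx : differentiable text q by exact: smooth_diff smooth_text (proj1 Uq).
elim: k v => [|k IH] v Sv.
  have E1 := deriv_Lie (@efield_shift F r) (@eorderD F r) og Sv (smooth_diff sg Uq) (fun h => eshift_scale h v).
  have E2 := deriv_Lie (@efield_shift F r) (@eorderD F r) text_order Sv dtx (fun h => eshift_scale h v).
  have dD : differentiable (D g) q by exact: smooth_diff (smooth_eD o2 sg) Uq.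
  have E0 : 'D_v (iterD 1 g) q = D g q * (- (Dtext q)^-1 ^+ 2 * 'D_v Dtext q) + 'D_v (D g) q / Dtext q.
    exact: derivative_quot dD dT (proj2 Uq).
  have alg (a b x y dg dt : F) : a = x -> b = y ->
      dg * (- dt^-1 ^+ 2 * b) + a / dt = dt^-1 ^+ 1 * (x - dg / dt * y).
    by move=> -> ->; ring.
  exact: etrans E0 (alg _ _ _ _ _ _ E1 E2).
have oh : orde k.+1 (iterD k.+1 g) by exact: iterD_order.
have sh : smooth_on dom2 (iterD k.+1 g) by exact: smooth_iterD.
have E1 := deriv_Lie (@efield_shift F r) (@eorderD F r) oh Sv (smooth_diff sh Uq) (fun h => eshift_scale h v).
have dD : differentiable (D (iterD k.+1 g)) q by exact: smooth_diff (smooth_eD o2 sh) Uq.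
have E0 : 'D_v (iterD k.+2 g) q = D (iterD k.+1 g) q * (- (Dtext q)^-1 ^+ 2 * 'D_v Dtext q)
    + 'D_v (D (iterD k.+1 g)) q / Dtext q by exact: derivative_quot dD dT (proj2 Uq).
have E2 := IH _ (eshift_order Sv); rewrite -!iterSr in E2.
have oD : orde k.+1 Dtext by exact: (@eorder_le F r 1 k.+1 Dtext (ltn0Sn k) Dtext_order).
have E3 : 'D_v Dtext q = 0 by apply: (deriv_of_order (@eorderD F r) q oD).
have alg (a b x y h dt : F) n : a = x -> b = 0 -> x = dt^-1 ^+ n * y ->
    h * (- dt^-1 ^+ 2 * b) + a / dt = dt^-1 ^+ n.+1 * y.
  by move=> -> -> ->; rewrite [_ ^+ n.+1]exprS !mulr0 add0r [LHS]mulrC mulrA.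
exact: etrans E0 (alg _ _ _ _ _ _ _ E1 E3 E2).
Qed.

Lemma derivative_clin i q v : dom1 q ->
  'D_v (clin i) q = \sum_j C (ebase q) i j * ccoord j ord0 v.
Proof.
move=> [Oq _].
have dC j : differentiable (fun q => C (ebase q) i j) q.
  by exact: smooth_diff (@smooth_ebase F r O (fun p => C p i j) (sC i j)) Oq.
have dc j : differentiable (ccoord j ord0) q by exact: smooth_diff (smooth_ccoord _ _ openT) Logic.I.
rewrite derivative_bigsum; last by move=> j; exact: differentiableM.
apply: eq_bigr => j _; rewrite (derivativeM _ (dC j) (dc j)).
have dCp : differentiable (fun p => C p i j) (ebase q) by exact: smooth_diff (sC i j) Oq.
rewrite (derivative_ebase _ dCp (C_0 i j (0, 1) Oq)) (C_0 i j (1, 0) Oq) mulr0 mul0r addr0.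
by rewrite (derivative_linear _ _ (@linear_ccoord F r j ord0) (@continuous_ccoord F r j ord0)).
Qed.

Lemma derivative_ccomb q v : dom1 q ->
  'D_v ccomb q = \sum_j c (ebase q) ord0 j * ccoord j ord0 v.
Proof.
move=> [Oq _].
have dC j : differentiable (fun q => c (ebase q) ord0 j) q.
  by exact: smooth_diff (@smooth_ebase F r O (fun p => c p ord0 j) (sc j)) Oq.
have dc j : differentiable (ccoord j ord0) q by exact: smooth_diff (smooth_ccoord _ _ openT) Logic.I.
rewrite derivative_bigsum; last by move=> j; exact: differentiableM.
apply: eq_bigr => j _; rewrite (derivativeM _ (dC j) (dc j)).
have dCp : differentiable (fun p => c p ord0 j) (ebase q) by exact: smooth_diff (sc j) Oq.
rewrite (derivative_ebase _ dCp (c_0 j (0, 1) Oq)) (c_0 j (1, 0) Oq) mulr0 mul0r addr0.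
by rewrite (derivative_linear _ _ (@linear_ccoord F r j ord0) (@continuous_ccoord F r j ord0)).
Qed.

Lemma derivative_ychi i q v : dom1 q -> 'D_v (ychi i) q =
  'D_v omega q * clin i q + omega q * \sum_j C (ebase q) i j * ccoord j ord0 v.
Proof.
move=> Uq; rewrite derivativeM.
- by rewrite derivative_clin // addrC.
- exact: smooth_diff smooth_omega Uq.
- exact: smooth_diff (smooth_clin i) (proj1 Uq).
Qed.

Lemma derivative_xext q v : dom1 q -> 'D_v xext q =
  'D_v omega q * (xcoord ord0 q + ccomb q)
  + omega q * (xcoord ord0 v + \sum_j c (ebase q) ord0 j * ccoord j ord0 v)
  + v.1.1 * 'D_(1, 0) X0 (ebase q).
Proof.
move=> Uq; have Oq := proj1 Uq; have o1 := open_dom1.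
have dx : differentiable (xcoord ord0) q by exact: smooth_diff (smooth_xcoord _ openT) Logic.I.
have dc : differentiable ccomb q by exact: smooth_diff smooth_ccomb Oq.
have dom : differentiable omega q by exact: smooth_diff smooth_omega Uq.
have d0 : differentiable (fun q => X0 (ebase q)) q by exact: smooth_diff (smooth_base1 sX0) Uq.
have ds := differentiableD dx dc.
rewrite (derivativeD _ (differentiableM dom ds) d0) (derivativeM _ dom ds) (derivativeD _ dx dc).
rewrite derivative_ccomb // (derivative_linear _ _ (@linear_xcoord F r ord0) (@continuous_xcoord F r ord0)).
rewrite (derivative_ebase _ (smooth_diff sX0 Oq) (X0_0 Oq)); congr (_ + _).
by rewrite addrC.
Qed.

Lemma derivative_text q v : dom1 q -> (kd < 2)%N ->
  'D_v text q = v.1.1 * 'D_(1, 0) T (ebase q).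
Proof.
move=> [Oq _] k2; rewrite /text (_ : (kd == 2)%N = false); last by apply/eqP; lia.
exact: (derivative_ebase _ (smooth_diff sT Oq) (T_0 Oq)).
Qed.

Lemma derivative_omega0 q v : dom1 q -> kd = 0%N ->
  'D_v omega q = v.1.1 * 'D_(1, 0) X1 (ebase q).
Proof.
move=> [Oq _] k0; rewrite /omega k0 /=.
exact: (derivative_ebase _ (smooth_diff sX1 Oq) (X1_0 Oq)).
Qed.

Lemma tcoord_efield (q : E) : (efield q).1.1 = 1. Proof. by []. Qed.

Lemma ychi0 q : dom1 q -> (0 < kd)%N -> ychi i0 q = 1.
Proof.
move=> [_ + k0]; rewrite /ychi /omega (gtn_eqF k0) => n0.
by rewrite mulVf.
Qed.

Let w1 : 'I_r.+1 := inord 1.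

(* The conditions met by the part of order k of a kernel vector of [emap], moved
   down to order 0; s is the induced change of t~ relative to D t~. *)
Lemma infinitesimal_trivial q w (s : F) : dom2 q ->
  (kd != 0%N -> ccoord i0 ord0 q != 0) ->
  (kd = 2%N -> ccoord i0 ord0 q * ccoord i1 w1 q - ccoord i1 ord0 q * ccoord i0 w1 q != 0) ->
  s = 0 \/ w.1.1 = 0 ->
  'D_w text q = s * Dtext q ->
  (forall i : 'I_r, (kd <= i)%N -> 'D_w (ychi i) q = s * D (ychi i) q) ->
  'D_w xext q = s * D xext q ->
  ((0 < kd)%N -> ccoord i0 ord0 w = 0) -> (kd = 2%N -> ccoord i1 ord0 w = w.1.1) ->
  [/\ w.1.1 = 0, forall j, ccoord j ord0 w = 0 & xcoord ord0 w = 0].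
Proof.
move=> [Uq DT0] n0 n1 sw HT HY HX w0 w1E.
pose mu := 'D_w omega q - s * D omega q.
have om0 := omega_neq0 Uq; have o1 := open_dom1.
(* The condition extends to the rows i < kd: [ychi i0] is constantly 1, and for kd = 2 [ychi i1] is
   [text]. *)
have HY' i : 'D_w (ychi i) q = s * D (ychi i) q.
  case: (ltnP i kd) => ik; last exact: HY.
  have cst0 : (0 < kd)%N -> forall v, 'D_v (ychi i0) q = 0.
    move=> k0 v; rewrite -[RHS](@derivativeC F E F 1 q v); apply: near_eq_derive.
    by apply: filterS (open_near o1 Uq) => p /ychi0; exact.
  case: (i =P i0) => [->|ii0]; first by rewrite /Lie !cst0 ?mulr0 //; exact: leq_trans ik.
  have k2 : kd = 2%N by move/eqP: ii0; rewrite -val_eqE /=; lia.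
  have -> : i = i1 by apply/val_inj => /=; move/eqP: ii0; rewrite -val_eqE /=; lia.
  by move: HT; rewrite /Dtext /text k2.
(* The conditions [HY'] say that [C] times this vector vanishes. *)
pose u j := mu * ccoord j ord0 q + omega q * (ccoord j ord0 w - s * ccoord j ord0 (efield q)).
have u0 j : u j = 0.
  pose uv : 'cV[F]_r := \col_j u j.
  have : C (ebase q) *m uv = 0.
    apply/matrixP => i l; rewrite (ord1 l) !mxE; have := HY' i.
    move=> /eqP; rewrite -subr_eq0 => /eqP E1.
    transitivity (\sum_k C (ebase q) i k * u k); first by apply: eq_bigr => k _; rewrite mxE.
    rewrite /u /mu (sum_combination (C (ebase q) i)) -[RHS]E1 derivative_ychi //.
    by rewrite [D (ychi i) q]derivative_ychi.
  move=> /(congr1 (mulmx (invmx (C (ebase q))))).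
  rewrite mulKmx ?mulmx0 ?unitmxE ?unitfE ?C_neq0 //; last by case: Uq.
  by move=> /matrixP/(_ j ord0); rewrite !mxE.
have t0 : (kd < 2)%N -> s = 0 /\ w.1.1 = 0.
  move=> k2; have E1 := HT; rewrite /Dtext /Lie !derivative_text // tcoord_efield mul1r in E1.
  have T0 : 'D_(1, 0) T (ebase q) != 0.
    by move: DT0; rewrite /Dtext /Lie derivative_text // tcoord_efield mul1r.
  by have := mulIf T0 E1; case: sw => -> ->.
have w1f : ccoord i1 ord0 (efield q) = ccoord i1 w1 q.
  by rewrite /ccoord mxE /= r0.
have w0f : ccoord i0 ord0 (efield q) = ccoord i0 w1 q.
  by rewrite /ccoord mxE /= r0.
have [mu0 s0] : mu = 0 /\ s = 0.
  have [k0|k0] := eqVneq kd 0%N.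
    have [s0 wt] : s = 0 /\ w.1.1 = 0 by apply: t0; rewrite k0.
    by split=> //; rewrite /mu s0 mul0r subr0 derivative_omega0 // wt mul0r.
  have k1 : (0 < kd)%N by rewrite lt0n.
  have E0 := u0 i0; rewrite /u w0 // w0f in E0.
  have mu_s : s = 0 -> mu = 0 /\ s = 0.
    move=> s0; split=> //; move/eqP: E0; rewrite s0 mul0r subrr mulr0 addr0 mulf_eq0.
    by rewrite (negPf (n0 k0)) orbF => /eqP.
  have [k2|k2] := ltnP kd 2; first by apply: mu_s; case: (t0 k2).
  have kE : kd = 2%N by apply/eqP; rewrite eqn_leq kd2.
  case: sw => [s0|wt]; first exact: mu_s.
  apply: mu_s; have E1 := u0 i1; rewrite /u w1E // w1f wt in E1.
  (* For kd = 2 the entries of chi_1 and chi_2 form a linear system in (mu, s) whose determinant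
     contains the Wronskian of these two functions. *)
  have : s * (omega q * (ccoord i0 ord0 q * ccoord i1 w1 q - ccoord i1 ord0 q * ccoord i0 w1 q)) = 0.
    have alg (m o a b a' b' : F) : m * a + o * (0 - s * a') = 0 -> m * b + o * (0 - s * b') = 0 ->
        s * (o * (a * b' - b * a')) = 0.
      move=> e1 e2; transitivity (b * (m * a + o * (0 - s * a')) - a * (m * b + o * (0 - s * b'))).
        by ring.
      by rewrite e1 e2 !mulr0 subrr.
    exact: alg E0 E1.
  by move/eqP; rewrite !mulf_eq0 (negPf om0) (negPf (n1 kE)) !orbF => /eqP.
have wj j : ccoord j ord0 w = 0.
  have /eqP := u0 j; rewrite /u mu0 s0 !mul0r subr0 add0r mulf_eq0 (negPf om0).
  by move/eqP.
have wt : w.1.1 = 0.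
  have [k2|k2] := ltnP kd 2; first by case: (t0 k2).
  by rewrite -w1E ?wj //; apply/eqP; rewrite eqn_leq kd2.
split=> //; have := HX; rewrite s0 mul0r derivative_xext // wt mul0r addr0.
have -> : 'D_w omega q = 0 by move: mu0; rewrite /mu s0 mul0r subr0.
rewrite mul0r add0r big1 ?addr0 => [/eqP|j _]; last by rewrite wj mulr0.
by rewrite mulf_eq0 (negPf om0) => /eqP.
Qed.

Definition Jtrue (q : E) : 'M[F]_(r, r.+1) :=
  \matrix_(i < r, k < r.+1) iterD k (ychi i) q.
Definition xout (q : E) : 'rV[F]_r.+1 := \row_(k < r.+1) iterD k xext q.
(* On the class the rows [i < kd] of [Jtrue] are those of 1 and t; as this makes
   them degenerate, [Jout] retains the original coordinates there. *)
Definition Jout (q : E) : 'M[F]_(r, r.+1) :=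
  \matrix_(i < r, k < r.+1) if (i < kd)%N
    then ccoord i k q + (if ((i : nat) == 1%N) && (k == ord0) then text q - q.1.1 else 0)
    else iterD k (ychi i) q.
Definition multiplier (q : E) : F := omega q / Dtext q ^+ r.
(* From Q alpha~ = lambda alpha: b~ - alpha~ x~ = lambda (b - alpha x). *)
Definition bout (q : E) : F := multiplier q * (q.2.2 - (q.1.2 *m annihilator q.2.1) ord0 ord0)
  + (xout q *m annihilator (Jtrue q)) ord0 ord0.
Definition emap (q : E) : E := ((text q, xout q), (Jout q, bout q)).

(** The last two factors are chi_1 and the Wronskian of chi_1 and chi_2. Both equal 1 on the classes
    where they occur; they are required for the sake of the other points of the space, where the
    kernel computation divides by them. *)
Definition nondegenerate (q : E) : F := jet_wronskian q.2.1 * jet_wronskian (Jtrue q)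
  * (if kd == 0%N then 1 else ccoord i0 ord0 q)
  * (if kd == 2%N then ccoord i0 ord0 q * ccoord i1 w1 q - ccoord i1 ord0 q * ccoord i0 w1 q
     else 1).

Definition dom3 : set E := [set q | dom2 q /\ nondegenerate q != 0].

Let U23 : dom3 `<=` dom2. Proof. by move=> q []. Qed.

Lemma smooth_Jtrue i k : smooth_on dom2 (fun q => Jtrue q i k).
Proof.
rewrite (_ : (fun q => _) = iterD k (ychi i)); last by apply/funext => q; rewrite mxE.
by apply: smooth_iterD; exact: smooth_sub U12 (smooth_ychi i).
Qed.

Lemma smooth_xout k : smooth_on dom2 (fun q => xout q ord0 k).
Proof.
rewrite (_ : (fun q => _) = iterD k xext); last by apply/funext => q; rewrite mxE.
by apply: smooth_iterD; exact: smooth_sub U12 smooth_xext.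
Qed.

Lemma smooth_nondegenerate : smooth_on dom2 nondegenerate.
Proof.
have o2 := open_dom2; have sw (J : E -> 'M[F]_(r, r.+1)) :
    (forall i k, smooth_on dom2 (fun q => J q i k)) -> smooth_on dom2 (fun q => jet_wronskian (J q)).
  move=> sJ; apply: smooth_det => // i j.
  by rewrite (_ : (fun p => _) = (fun p => J p i (lift ord_max j))) //; apply/funext => p; rewrite mxE.
apply: smoothM => //; first apply: smoothM => //; first apply: smoothM => //.
- by apply: sw => i k; exact: smooth_ccoord.
- by apply: sw => i k; exact: smooth_Jtrue.
- by case: (kd == 0)%N; [exact: smooth_cst|exact: smooth_ccoord].
- case: (kd == 2)%N; last exact: smooth_cst.
  by apply: smoothB => //; apply: smoothM => //; exact: smooth_ccoord.
Qed.

Lemma open_dom3 : open dom3.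
Proof. by apply: open_neq0; [exact: open_dom2|exact: smooth_nondegenerate]. Qed.

Lemma smooth_multiplier : smooth_on dom2 multiplier.
Proof.
have o2 := open_dom2; apply: smooth_div => //.
- by move=> q [_ d0]; rewrite expf_neq0.
- exact: smooth_sub U12 smooth_omega.
- by apply: smoothX => //; exact: smooth_sub U12 smooth_Dtext.
Qed.

Lemma smooth_pairing (u : E -> 'rV[F]_r.+1) (J : E -> 'M[F]_(r, r.+1)) :
  (forall k, smooth_on dom3 (fun q => u q ord0 k)) ->
  (forall i k, smooth_on dom3 (fun q => J q i k)) ->
  (forall q, dom3 q -> jet_wronskian (J q) != 0) ->
  smooth_on dom3 (fun q => (u q *m annihilator (J q)) ord0 ord0).
Proof.
have o3 := open_dom3; move=> su sJ W.
rewrite (_ : (fun q => _) = fun q => \sum_k u q ord0 k * annihilator (J q) k ord0); last first.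
  by apply/funext => q; rewrite mxE.
by apply: smooth_sum => // k _; apply: smoothM => //; exact: smooth_annihilator.
Qed.

Lemma nondegenerateP q : nondegenerate q != 0 -> [/\ jet_wronskian q.2.1 != 0,
  jet_wronskian (Jtrue q) != 0, kd != 0%N -> ccoord i0 ord0 q != 0
  & kd = 2%N -> ccoord i0 ord0 q * ccoord i1 w1 q - ccoord i1 ord0 q * ccoord i0 w1 q != 0].
Proof.
rewrite /nondegenerate !mulf_eq0 !negb_or => /andP[/andP[/andP[h1 h2] h3] h4]; split=> //.
- by move=> k0; move: h3; rewrite (negPf k0).
- by move=> k2; move: h4; rewrite k2.
Qed.

Lemma smooth_pairing_in : smooth_on dom3 (fun q => (q.1.2 *m annihilator q.2.1) ord0 ord0).
Proof.
have o3 := open_dom3; apply: smooth_pairing => [k|i k|q [_ /nondegenerateP[]]] //.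
- exact: smooth_xcoord.
- exact: smooth_ccoord.
Qed.

Lemma smooth_pairing_out : smooth_on dom3 (fun q => (xout q *m annihilator (Jtrue q)) ord0 ord0).
Proof.
apply: smooth_pairing => [k|i k|q [_ /nondegenerateP[]]] //.
- exact: smooth_sub U23 (smooth_xout k).
- exact: smooth_sub U23 (smooth_Jtrue i k).
Qed.

Lemma smooth_emap : smooth_on dom3 emap.
Proof.
have o3 := open_dom3.
have st : smooth_on dom3 text by apply: smooth_sub smooth_text => q [[]].
apply: smooth_pair => //; apply: smooth_pair => //.
- by apply: smooth_matrix => // i k; rewrite (ord1 i); exact: smooth_sub U23 (smooth_xout k).
- apply: smooth_matrix => // i k; case: (ltnP i kd) => ik; last first.
    rewrite (_ : (fun p => _) = fun p => Jtrue p i k); first exact: smooth_sub U23 (smooth_Jtrue i k).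
    by apply/funext => p; rewrite !mxE ltnNge ik.
  rewrite (_ : (fun p => _) = fun p => ccoord i k p
      + (if ((i : nat) == 1%N) && (k == ord0) then text p - p.1.1 else 0)); last first.
    by apply/funext => p; rewrite mxE ik.
  apply: smoothD => //; first exact: smooth_ccoord.
  by case: (_ && _); [apply: smoothB => //; exact: smooth_tcoord|exact: smooth_cst].
- apply: smoothD => //; last exact: smooth_pairing_out.
  apply: smoothM => //; first exact: smooth_sub U23 smooth_multiplier.
  by apply: smoothB => //; [exact: smooth_bcoord|exact: smooth_pairing_in].
Qed.

Lemma ccoord_iter_eshift i k m (v : E) : (k + m <= r)%N ->
  ccoord i (inord k) (iter m (@eshift F r) v) = ccoord i (inord (k + m)) v.
Proof.
elim: m k v => [|m IH] k v km; first by rewrite addn0.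
by rewrite iterS ccoord_eshift ?IH ?addSnnS //; lia.
Qed.

Lemma xcoord_iter_eshift k m (v : E) : (k + m <= r)%N ->
  xcoord (inord k) (iter m (@eshift F r) v) = xcoord (inord (k + m)) v.
Proof.
elim: m k v => [|m IH] k v km; first by rewrite addn0.
by rewrite iterS xcoord_eshift ?IH ?addSnnS //; lia.
Qed.

Lemma emap_kernel q v : dom3 q -> 'D_v emap q = 0 -> v = 0.
Proof.
move=> U3 H0; have U2 := U23 U3; have [U1 DT0] := U2; have Oq := proj1 U1.
have [_ _ n0 n1] := nondegenerateP (proj2 U3); have o2 := open_dom2.
have dem : differentiable emap q by exact: smooth_diff smooth_emap U3.
have comp (L : E -> F) : linear L -> continuous L -> 'D_v (fun q => L (emap q)) q = 0.
  move=> Ll Lc; rewrite (derivative_linpost v Ll Lc dem) H0.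
  by have := Ll (-1) 0 0; rewrite scaler0 addr0 scaleN1r addrC subrr.
have HT : 'D_v text q = 0 by exact: comp _ (@linear_tcoord F r) (@continuous_tcoord F r).
have HX k : (k <= r)%N -> 'D_v (iterD k xext) q = 0.
  move=> kr; rewrite -[RHS](comp _ (@linear_xcoord F r (inord k)) (@continuous_xcoord F r _)).
  by congr ('D_ _ _ _); apply/funext => p; rewrite /xcoord mxE inordK.
have HJ (i : 'I_r) k : (k <= r)%N -> (kd <= i)%N -> 'D_v (iterD k (ychi i)) q = 0.
  move=> kr ik; rewrite -[RHS](comp _ (@linear_ccoord F r i (inord k)) (@continuous_ccoord F r _ _)).
  by congr ('D_ _ _ _); apply/funext => p; rewrite /ccoord mxE ltnNge ik inordK.
have dt : differentiable text q by exact: smooth_diff smooth_text U1.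
have HJ' (i : 'I_r) (k : 'I_r.+1) : (i < kd)%N ->
    ccoord i k v = if ((i : nat) == 1%N) && (k == ord0) then v.1.1 else 0.
  move=> ik; have := comp _ (@linear_ccoord F r i k) (@continuous_ccoord F r _ _).
  rewrite (_ : (fun _ => _) = fun p => ccoord i k p
      + (if ((i : nat) == 1%N) && (k == ord0) then text p - p.1.1 else 0)); last first.
    by apply/funext => p; rewrite /ccoord mxE ik.
  have dc : differentiable (ccoord i k) q by exact: smooth_diff (smooth_ccoord _ _ openT) Logic.I.
  have Dc : 'D_v (ccoord i k) q = ccoord i k v.
    exact: (derivative_linear _ _ (@linear_ccoord F r i k) (@continuous_ccoord F r i k)).
  case: (_ && _); last first.
    by rewrite (derivativeD _ dc (differentiable_cst _ _)) derivativeC addr0 Dc.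
  have dtc : differentiable (fun q : E => q.1.1) q.
    exact: smooth_diff (@smooth_tcoord F r _ openT) Logic.I.
  rewrite (derivativeD _ dc (differentiableB dt dtc)) (derivativeB _ dt dtc) HT Dc sub0r.
  rewrite (derivative_linear _ _ (@linear_tcoord F r) (@continuous_tcoord F r)) => /eqP.
  by rewrite subr_eq0 => /eqP.
have o0 : ord0 = inord 0 :> 'I_r.+1 by apply/val_inj; rewrite /= inordK.
have i0E (k : 'I_r.+1) : (0 < kd)%N -> ccoord i0 k v = 0 by move=> k0; rewrite HJ'.
have i1E (k : 'I_r.+1) : kd = 2%N -> ccoord i1 k v = if k == ord0 then v.1.1 else 0.
  by move=> k2; rewrite HJ' // k2.
(* Induction on the order: [infinitesimal_trivial] with s = 0 removes order 0, and then the part of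
   order m+1, shifted down, satisfies the same conditions with s the relative change of t~. *)
have S m : (m <= r)%N -> eorder m v.
  elim: m => [_|m IH mr].
    have [] := infinitesimal_trivial (w := v) (s := 0) U2 n0 n1.
    - by left.
    - by rewrite mul0r.
    - by move=> i ik; rewrite mul0r (HJ i 0%N).
    - by rewrite mul0r (HX 0%N).
    - exact: i0E.
    - by move=> k2; rewrite i1E.
    move=> t0 c0 x0; split=> // k; rewrite leqn0 => /eqP k0.
    by have -> : k = ord0 by exact/val_inj.
  have Sm := IH (ltnW mr); have vt : v.1.1 = 0 by case: Sm.
  pose w := iter m.+1 (@eshift F r) v.
  have wt : w.1.1 = 0 by [].
  have key g : orde 0 g -> smooth_on dom2 g -> 'D_v (iterD m.+1 g) q = 0 ->
      'D_w g q = 'D_w text q / Dtext q * D g q.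
    move=> og sg; rewrite (deriv_iterD og sg U2 Sm) => /eqP.
    rewrite mulf_eq0 expf_eq0 invr_eq0 (negPf DT0) andbF /= subr_eq0 => /eqP ->.
    by rewrite mulrAC -mulrA mulrC.
  have [] := infinitesimal_trivial (w := w) (s := 'D_w text q / Dtext q) U2 n0 n1.
  - by right.
  - by rewrite divfK.
  - move=> i ik; apply: key; [exact: ychi_order|exact: smooth_sub U12 (smooth_ychi i)|exact: HJ].
  - by apply: key; [exact: xext_order|exact: smooth_sub U12 smooth_xext|exact: HX].
  - by move=> k0; rewrite o0 /w ccoord_iter_eshift // i0E.
  - move=> k2; rewrite o0 /w ccoord_iter_eshift // i1E // -val_eqE /= inordK //.
  move=> _ c0 x0; split=> // k; rewrite leq_eqVlt => /orP[/eqP km|km]; last first.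
    by case: Sm => _; apply.
  have -> : k = inord (0 + m.+1) by apply/val_inj; rewrite /= inordK.
  by split=> [|i]; rewrite -?xcoord_iter_eshift -?ccoord_iter_eshift // -o0.
have Sr := S r (leqnn r); have [vt vr] := Sr.
(* Everything in [bout] except b has order at most r and is constant along v, so only the multiplier
   times the b-component remains. *)
have vb : v.2.2 = 0.
  have := comp _ (@linear_bcoord F r) (@continuous_bcoord F r).
  have dm : differentiable multiplier q by exact: smooth_diff smooth_multiplier U2.
  have di := smooth_diff smooth_pairing_in U3; have dout := smooth_diff smooth_pairing_out U3.
  have db : differentiable (fun q : E => q.2.2) q.
    exact: smooth_diff (@smooth_bcoord F r _ openT) Logic.I.
  have ord_out (u : E -> 'rV[F]_r.+1) (J : E -> 'M[F]_(r, r.+1)) :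
      (forall k, orde r (fun q => u q ord0 k)) -> (forall i k, orde r (fun q => J q i k)) ->
      orde r (fun q => (u q *m annihilator (J q)) ord0 ord0).
    move=> ou oJ p w Sw; congr ((_ *m annihilator _) _ _); apply/matrixP => i k.
      by rewrite (ord1 i); exact: ou.
    exact: oJ.
  have Z g : orde r g -> 'D_v g q = 0 by move=> og; exact: (deriv_of_order (@eorderD F r) q og Sr).
  have om : orde r multiplier.
    move=> p w Sw; rewrite /multiplier (@eorder_le F r 0 r omega (leq0n r) omega_order p w Sw).
    by rewrite (@eorder_le F r 1 r Dtext r0 Dtext_order p w Sw).
  have oi : orde r (fun q : E => (q.1.2 *m annihilator q.2.1) ord0 ord0).
    apply: ord_out => [k|i k] p w [_ /(_ k (ltn_ord k))[ck jk]].
      by rewrite mxE -[w.1.2 _ _]/(xcoord k w) ck addr0.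
    by rewrite mxE -[w.2.1 _ _]/(ccoord i k w) jk addr0.
  have oo : orde r (fun q => (xout q *m annihilator (Jtrue q)) ord0 ord0).
    have oit (k : 'I_r.+1) g : orde 0 g -> orde r (iterD k g).
      by move=> og; apply: (@eorder_le F r k r _ (ltn_ord k)); exact: iterD_order.
    apply: ord_out => [k|i k] p w Sw; rewrite !mxE.
      exact (oit k _ xext_order p w Sw).
    exact (oit k _ (ychi_order i) p w Sw).
  rewrite (_ : (fun _ => _) = bout) //.
  rewrite (derivativeD _ (differentiableM dm (differentiableB db di)) dout).
  rewrite (derivativeM _ dm (differentiableB db di)) (derivativeB _ db di).
  rewrite (Z _ om) (Z _ oi) (Z _ oo) mul0r subr0 !addr0.
  rewrite (derivative_linear _ _ (@linear_bcoord F r) (@continuous_bcoord F r)) => /eqP.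
  rewrite mulf_eq0 /multiplier mulf_eq0 (negPf (omega_neq0 U1)) invr_eq0 expf_eq0 (negPf DT0) andbF /=.
  by move/eqP.
apply: ext_eq => //= [k|i k]; rewrite /xcoord /ccoord [RHS]mxE.
- by have [] := vr k (ltn_ord k).
- by have [_ H] := vr k (ltn_ord k); exact: H.
Qed.

Lemma emap_local_diffeo : local_diffeo (ExtTrans dom3 emap).
Proof.
split; [exact: open_dom3|exact: smooth_emap|move=> q U3 u v E1].
have dem : differentiable emap q by exact: smooth_diff smooth_emap U3.
apply/eqP; rewrite -subr_eq0; apply/eqP; apply: (emap_kernel U3).
by rewrite deriveE // linearB /= -E1 subrr.
Qed.

Lemma smooth_lift (th : param F r) (W : set (jet F r)) : regular th -> open W ->
  (forall z, W z -> pdom th z.1) -> smooth_on W (lift_jet th).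
Proof.
move=> [_ sch _ sr] oW Wth; have comp (f : F -> F) : smooth_on (pdom th) f -> smooth_on W (fun z => f z.1).
  by move=> sf; apply: (smooth_comp1 oW Wth sf); exact: smooth_fst.
apply: smooth_pair => //; first by apply: smooth_linear => // p; exact: cvg_id.
apply: smooth_pair => //; last exact: comp.
apply: smooth_matrix => // i k.
rewrite (_ : (fun p => _) = fun p => derive1n k (chi th i) p.1); last by apply/funext => p; rewrite mxE.
exact: (comp (derive1n k (chi th i)) (smooth_derive1n k (sch i))).
Qed.

(** By the chain rule, the image of the jet field under the lift of a tuple agrees with [efield] in
    t and up to order k; the discrepancy in higher orders and in b is invisible to [g]. *)
Lemma D_lift (th : param F r) (W : set (jet F r)) (g : E -> F) (z : jet F r) k :
  regular th -> open W -> (forall z, W z -> pdom th z.1) -> W z -> (k < r)%N -> orde k g ->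
  differentiable g (lift_jet th z) ->
  Lie (@jfield F r) (fun z => g (lift_jet th z)) z = D g (lift_jet th z).
Proof.
move=> rth oW Wth Wz kr og dg; have dl := smooth_diff (smooth_lift rth oW Wth) Wz.
have [_ sch _ _] := rth.
rewrite /Lie (derivative_chain _ dl dg); set w : E := 'D_(jfield z) (lift_jet th) z.
have wL (L : E -> F) : linear L -> continuous L ->
    L w = 'D_(jfield z) (fun z => L (lift_jet th z)) z.
  by move=> Ll Lc; rewrite (derivative_linpost _ Ll Lc dl).
have -> : w = efield (lift_jet th z) + (w - efield (lift_jet th z)) by rewrite subrKC.
apply: (of_order_deriv0 (@eorderD F r) _ _ og); split.
  rewrite -[LHS]/(w.1.1 - 1) (wL _ (@linear_tcoord F r) (@continuous_tcoord F r)).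
  by rewrite derivative_fst subrr.
move=> j jk; have jr := leq_ltn_trans jk kr.
have LB (L : E -> F) a b : linear L -> L (a - b) = L a - L b.
  by move=> Ll; rewrite addrC -scaleN1r Ll scaleN1r addrC.
split=> [|i].
  rewrite (LB _ _ _ (@linear_xcoord F r j)) (wL _ (@linear_xcoord F r j) (@continuous_xcoord F r j)).
  rewrite (_ : (fun _ => _) = @jcoord F r j); last first.
    by apply/funext => p; rewrite /jcoord inord_val.
  by rewrite deriv_jcoord /jcoord inord_val subrr.
rewrite (LB _ _ _ (@linear_ccoord F r i j)) (wL _ (@linear_ccoord F r i j) (@continuous_ccoord F r i j)).
rewrite (_ : (fun _ => _) = fun z : jet F r => derive1n j (chi th i) z.1); last first.
  by apply/funext => p; rewrite /ccoord mxE.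
have dc : differentiable (derive1n j (chi th i)) z.1.
  exact: smooth_diff (smooth_derive1n j (sch i)) (Wth _ Wz).
by rewrite [X in X - _](Lie_fst dc) /ccoord /efield /= !mxE jr inordK // subrr.
Qed.

Lemma iterD_lift (th : param F r) (W : set (jet F r)) (h : nat -> jet F r -> F) (g : E -> F) :
  regular th -> open W -> (forall z, W z -> pdom th z.1) ->
  (forall z, W z -> dom2 (lift_jet th z)) -> orde 0 g -> smooth_on dom2 g ->
  (forall z, W z -> h 0%N z = g (lift_jet th z)) ->
  (forall k z, (k < r)%N -> W z ->
     h k.+1 z = Lie (@jfield F r) (h k) z / Dtext (lift_jet th z)) ->
  forall k z, (k <= r)%N -> W z -> h k z = iterD k g (lift_jet th z).
Proof.
move=> rth oW Wth Wdom og sg h0 hS; elim=> [|k IH] z kr Wz; first exact: h0.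
rewrite hS // [RHS]/(D (iterD k g) (lift_jet th z) / Dtext (lift_jet th z)).
congr (_ / _); have sgk : smooth_on dom2 (iterD k g) by exact: smooth_iterD.
have ok : orde k (iterD k g) by exact: iterD_order.
rewrite -(D_lift rth oW Wth Wz kr ok); last exact: smooth_diff sgk (Wdom _ Wz).
apply: Lie_near; apply: filterS (open_near oW Wz) => w Ww; apply: IH => //; exact: ltnW.
Qed.

Lemma Dtext_lift (th : param F r) (W : set (jet F r)) (tau : jet F r -> F) (z : jet F r) :
  regular th -> open W -> (forall z, W z -> pdom th z.1) -> W z -> dom1 (lift_jet th z) ->
  (forall z, W z -> text (lift_jet th z) = tau z) ->
  Dtext (lift_jet th z) = Lie (@jfield F r) tau z.
Proof.
move=> rth oW Wth Wz d1 E1; rewrite /Dtext -(D_lift rth oW Wth Wz r0 text_order).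
  by apply: Lie_near; apply: filterS (open_near oW Wz).
exact: smooth_diff smooth_text d1.
Qed.

(** Criterion for the map to act as a given arrow: agreement in order 0 and in b suffices, for on
    lifts both sides obtain the higher orders by the same repeated derivation. *)
Lemma emap_lift (th th' : param F r) (B : set (F * F)) (phi : F * F -> F * F) :
  regular th -> regular th' -> open B ->
  (forall p, B p -> pdom th p.1 /\ pdom th' (phi p).1) ->
  (forall z : jet F r, B (jet_base z) -> [/\ dom2 (lift_jet th z),
    phi (jet_base z) = (text (lift_jet th z), xext (lift_jet th z)),
    forall i, chi th' i (phi (jet_base z)).1 = ychi i (lift_jet th z) &
    rhs th' (phi (jet_base z)).1 = multiplier (lift_jet th z)
       * (rhs th z.1 - (z.2 *m annihilator (jetmx th z.1)) ord0 ord0)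
       + ((prolong phi z).2 *m annihilator (jetmx th' (phi (jet_base z)).1)) ord0 ord0]) ->
  ((0 < kd)%N -> chi1_is_1 th /\ chi1_is_1 th') ->
  (kd = 2%N -> chi2_is_t th /\ chi2_is_t th') ->
  forall z : jet F r, B (jet_base z) ->
    dom3 (lift_jet th z) /\ emap (lift_jet th z) = lift_jet th' (prolong phi z).
Proof.
move=> rth rth' oB Bd H H1 H2; pose W := @jet_base F r @^-1` B.
have oW : open W by exact: open_base.
have Wth z : W z -> pdom th z.1 by move=> /Bd[].
have Wdom z : W z -> dom2 (lift_jet th z) by move=> /H[].
have [oth' sch' W' _] := rth'; have [oth _ Wr _] := rth.
have dtl z : W z -> differentiable (fun w => (phi (jet_base w)).1) z.
  move=> Wz; apply: (@differentiable_eq_near _ _ _ (fun w => text (lift_jet th w))).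
    by apply: filterS (open_near oW Wz) => w /H[_ ->].
  apply: (@differentiable_comp _ _ _ _ (lift_jet th) text).
    exact: smooth_diff (smooth_lift rth oW Wth) Wz.
  exact: smooth_diff smooth_text (proj1 (Wdom _ Wz)).
have DE z : W z -> total_deriv_T phi z = Dtext (lift_jet th z).
  move=> Wz; apply/esym/(Dtext_lift rth oW Wth Wz (proj1 (Wdom _ Wz))).
  by move=> w /H[_ ->].
have s1 g : smooth_on dom1 g -> smooth_on dom2 g by exact: smooth_sub U12.
have xE k z : (k <= r)%N -> W z -> prolong_coord phi k z = iterD k xext (lift_jet th z).
  move: k z; apply: (iterD_lift (h := prolong_coord phi) rth oW Wth Wdom xext_order (s1 _ _ smooth_xext)).
    by move=> z /H[_ E _ _]; rewrite /prolong_coord /= E.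
  by move=> k z _ Wz; rewrite -DE.
have cE i k z : (k <= r)%N -> W z ->
    derive1n k (chi th' i) (phi (jet_base z)).1 = iterD k (ychi i) (lift_jet th z).
  move: k z; apply: (iterD_lift (h := fun k z => derive1n k (chi th' i) (phi (jet_base z)).1) rth oW Wth Wdom (ychi_order i) (s1 _ _ (smooth_ychi i))).
    by move=> z /H[_ _ E _]; exact: E.
  move=> k z _ Wz; have dk : differentiable (derive1n k (chi th' i)) (phi (jet_base z)).1.
    exact: smooth_diff (smooth_derive1n k (sch' i)) (proj2 (Bd _ Wz)).
  have D0 := proj2 (Wdom _ Wz).
  rewrite /Lie (derivative_comp1 (g := fun z => (phi (jet_base z)).1) _ (dtl _ Wz) dk).
  transitivity (derive1 (derive1n k (chi th' i)) (phi (jet_base z)).1 * total_deriv_T phi z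
    / Dtext (lift_jet th z)); last by [].
  by rewrite DE // mulfK.
move=> z Bz; have [D2 Ep Ec Er] := H z Bz; have [d1 d2] := Bd _ Bz.
have JE : Jtrue (lift_jet th z) = jetmx th' (phi (jet_base z)).1.
  by apply/matrixP => i k; rewrite !mxE cE // -ltnS.
have xoE : xout (lift_jet th z) = (prolong phi z).2.
  by apply/matrixP => i k; rewrite !mxE xE // -ltnS.
have cl i k : ccoord i k (lift_jet th z) = derive1n k (chi th i) z.1 by rewrite /ccoord mxE.
have row_one (th1 : param F r) t (i : 'I_r) (k : 'I_r.+1) : open (pdom th1) -> chi1_is_1 th1 -> pdom th1 t ->
    i = 0%N :> nat -> derive1n k (chi th1 i) t = (k == ord0 :> 'I_r.+1)%:R.
  move=> o1 c1 dt ii; have := jetrow_one r o1 (c1 i ii) dt.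
  by move=> /matrixP/(_ ord0 k); rewrite !mxE eqxx.
have row_id (th1 : param F r) t (i : 'I_r) (k : 'I_r.+1) : open (pdom th1) -> chi2_is_t th1 -> pdom th1 t ->
    i = 1%N :> nat -> derive1n k (chi th1 i) t = t * (k == ord0 :> 'I_r.+1)%:R + (k == w1)%:R.
  move=> o1 c1 dt ii; have := jetrow_id r0 o1 (c1 i ii) dt.
  by move=> /matrixP/(_ ord0 k); rewrite !mxE eqxx.
have w10 : (w1 == ord0) = false by rewrite -val_eqE /= inordK.
split.
  split=> //; rewrite /nondegenerate !mulf_neq0 //.
  - by rewrite -[(lift_jet th z).2.1]/(jetmx th z.1) jet_wronskianE Wr.
  - by rewrite JE jet_wronskianE W'.
  - case: (boolP (kd == 0%N)) => [_|]; first exact: oner_neq0.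
    rewrite -lt0n => /H1[c1 _].
    by rewrite cl (row_one th) // eqxx oner_eq0.
  - case: (kd =P 2%N) => [k2|_]; last exact: oner_neq0.
    have [c2 _] := H2 k2; have [c1 _] := H1 ltac:(by rewrite k2).
    by rewrite !cl !(row_one th z.1 i0) // !(row_id th z.1 i1) // w10 !eqxx mulr0 mulr0 add0r subr0 mulr1 oner_neq0.
apply: ext_eq.
- by rewrite /= Ep.
- move=> k; rewrite /xcoord [(emap _).1.2]xoE //.
- move=> i k; have -> : ccoord i k (lift_jet th' (prolong phi z)) = derive1n k (chi th' i) (phi (jet_base z)).1.
    by rewrite /ccoord mxE.
  transitivity (Jout (lift_jet th z) i k); first by [].
  rewrite mxE; case: ltnP => ik; last by rewrite -cE // -ltnS.
  rewrite cl; have k0 := leq_ltn_trans (leq0n _) ik; have [c1 c1'] := H1 k0.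
  have [i0E|i0E] := eqVneq (i : nat) 0%N.
    by rewrite i0E addr0 (row_one th z.1 i) // (row_one th' _ i).
  have k2 : kd = 2%N by apply/eqP; rewrite eqn_leq kd2 (leq_trans _ ik) // ltnS lt0n.
  have i1E : i = 1%N :> nat by move: ik i0E; rewrite k2; case: (i : nat) => [|[|]].
  have [c2 c2'] := H2 k2.
  (* The row of the function t is (t, 1, 0, ...); the term [text - t] turns its first entry into
     t~. *)
  rewrite i1E eqxx andTb (row_id th z.1 i) // (row_id th' _ i) // Ep.
  case: (k == ord0); last by rewrite !mulr0 addr0.
  by rewrite !mulr1 addrAC subrKC.
- by rewrite [LHS]/= /bout xoE JE /= Er.
Qed.

End ExtMap.

(** * The equivalence group *)

Section ClassConstraints.
Variables (F : numFieldType) (r : nat).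
Hypothesis r2 : (2 < r)%N.

Definition kind (c : class_name) : nat :=
  match c with A1 | hatA1 => 1 | A2 | hatA2 => 2 | _ => 0 end.
Definition hat (c : class_name) : bool :=
  match c with A1 | A2 => false | _ => true end.
(* The coefficients a_k with [top_order c <= k < r] vanish for the equations of class c. *)
Definition top_order (c : class_name) : nat :=
  match c with hatL1 => r.-1 | hatL2 => r.-2 | _ => r end.

Definition top_vanish (n : nat) (a : 'cV[F]_r.+1) :=
  forall k : 'I_r.+1, (n <= k)%N -> (k < r)%N -> a k ord0 = 0.

(** A common form for the seven lists of constraints, so that the remaining arguments treat all
    classes at once. *)
Lemma constraintsE (c : class_name) (th : param F r) : regular th ->
  constraints c th <-> [/\ hat c -> rhs0 th,
    forall t, pdom th t -> top_vanish (top_order c) (annihilator (jetmx th t)),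
    (0 < kind c)%N -> chi1_is_1 th & kind c = 2%N -> chi2_is_t th].
Proof.
move=> [_ _ W _].
have vr t : top_vanish r (annihilator (jetmx th t)) by move=> k /leq_ltn_trans H /H; rewrite ltnn.
have mE n t : (n < r)%N -> pdom th t ->
    wronskian_minor n th t = 0 <-> annihilator (jetmx th t) (inord n) ord0 = 0.
  by move=> nr dt; apply: minorE => //; exact: W.
have r1E : (r.-1 < r)%N by lia.
have r2E : (r.-2 < r)%N by lia.
case: c => /=.
- by split=> [H|[/(_ isT) H _ _ _]] //; split.
- split=> [[H1 H2]|[H1 H2 _ _]].
    split=> // t dt k k1 k2; have -> : k = inord r.-1 by apply/val_inj; rewrite /= inordK; lia.
    by apply/mE => //; exact: H1.
  split; last exact: H1.
  by move=> t dt; apply/mE => //; apply: H2 => //; rewrite inordK //; lia.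
- split=> [[H1 H2 H3]|[H1 H2 _ _]].
    split=> // t dt k k1 k2; have [kE|kE] := eqVneq (k : nat) r.-1.
      have -> : k = inord r.-1 by apply/val_inj; rewrite /= inordK; lia.
      by apply/mE => //; exact: H1.
    have -> : k = inord r.-2 by apply/val_inj; rewrite /= inordK; move/eqP: kE; lia.
    by apply/mE => //; exact: H2.
  by split; [move=> t dt|move=> t dt|exact: H1]; apply/mE => //; apply: H2 => //; rewrite inordK //; lia.
- by split=> [H|[_ _ /(_ isT) H _]] //; split.
- by split=> [[H1 H2]|[/(_ isT) H1 _ /(_ isT) H2 _]]; split.
- by split=> [[H1 H2]|[_ _ /(_ isT) H1 /(_ erefl) H2]]; split.
- by split=> [[H1 H2 H3]|[/(_ isT) H1 _ /(_ isT) H2 /(_ erefl) H3]]; split.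
Qed.

Variables (T X1 : F -> F) (I : set F) (t : F).
Hypothesis oI : open I.
Hypothesis T0 : derive1 T t != 0.
Hypothesis X0 : X1 t != 0.
Hypothesis It : I t.
Local Notation Q := (prolong_sq r T X1 t).

Lemma prolong_sq_lt (i k : 'I_r.+1) : (k < i)%N -> Q i k = 0.
Proof. by move=> ki; rewrite mxE (prolong_mx_gt _ _ oI). Qed.

Lemma prolong_sq_diag (i : 'I_r.+1) : Q i i != 0.
Proof. by rewrite mxE (prolong_mx_diag _ _ oI) // mulf_neq0 // invr_eq0 expf_neq0. Qed.

(** In rows k with n <= k < r only the last column of the triangular [Q] can contribute. So the
    vanishing of leading coefficients in both equations is a condition on T and X1 alone, which can
    be reused for any other source equation. *)
Lemma top_vanish_column (n : nat) (a a' : 'cV[F]_r.+1) (l : F) : a' ord_max ord0 = 1 ->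
  Q *m a' = l *: a -> top_vanish n a -> top_vanish n a' ->
  forall k : 'I_r.+1, (n <= k)%N -> (k < r)%N -> Q k ord_max = 0.
Proof.
move=> am QE va va' k nk kr; have /matrixP/(_ k ord0) := QE; rewrite !mxE va // mulr0 => <-.
rewrite (bigD1 ord_max) //= am mulr1 mxE big1 ?addr0 // => j jm.
have jr : (j < r)%N by have := ltn_ord j; move: jm; rewrite -val_eqE /=; lia.
have [jk|kj] := ltnP j k; first by rewrite (prolong_sq_lt jk) mul0r.
by rewrite va' ?mulr0 // (leq_trans nk).
Qed.

Lemma column_top_vanish (n : nat) (a a' : 'cV[F]_r.+1) (l : F) : a' ord_max ord0 = 1 ->
  Q *m a' = l *: a -> top_vanish n a ->
  (forall k : 'I_r.+1, (n <= k)%N -> (k < r)%N -> Q k ord_max = 0) -> top_vanish n a'.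
Proof.
move=> am QE va Qk k nk kr.
(* Back substitution in a triangular system, from the row below the top downwards. *)
have [m] := ubnP (r - k); elim: m k nk kr => // m IH k nk kr km.
have /matrixP/(_ k ord0) := QE; rewrite [RHS]mxE va // mulr0 mxE.
rewrite (bigD1 k) //= big1 ?addr0 => [/eqP|j jk].
  by rewrite mulf_eq0 (negPf (prolong_sq_diag k)) => /eqP.
have [jk'|kj] := ltnP j k; first by rewrite (prolong_sq_lt jk') mul0r.
have [->|jm] := eqVneq j ord_max; first by rewrite Qk // mul0r.
have jr : (j < r)%N by have := ltn_ord j; move: jm; rewrite -val_eqE /=; lia.
rewrite IH ?mulr0 //; first exact: leq_trans kj.
by move: jk kj km; rewrite -val_eqE /=; lia.
Qed.

End ClassConstraints.

(** * The equivalence transformation generated by an arrow *)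

Section Generating.
Variables (F : numFieldType) (r : nat).
Hypothesis cF : geometric_complete F.
Hypothesis aF : dyadic_archi F.
Hypothesis r2 : (2 < r)%N.
Let r1 : (1 < r)%N. Proof. exact: ltnW. Qed.
Let r0 : (0 < r)%N. Proof. exact: ltnW. Qed.
Let i0 : 'I_r := Ordinal (ltnW r1).
Let i1 : 'I_r := Ordinal r1.
Variable cl : class_name.
Local Notation S := (counterpart (@initial_class F r cl) (@constraints F r cl)).
Let kd := kind cl.
Let kd2 : (kd <= 2)%N. Proof. by rewrite /kd; case: cl. Qed.

Variable g : arrow F r.
Hypothesis Hg : equivalence_groupoid S g.
Let th := source g.
Let th' := target g.
Let O := pt_dom g.
Let phi := ptrans g.

Let rth : regular th.
Proof. by have [[[/(counterpartE _ _ r2)[]]]] := Hg. Qed.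
Let rth' : regular th'.
Proof. by have [[[_ /(counterpartE _ _ r2)[]]]] := Hg. Qed.
Let Kth : [/\ hat cl -> rhs0 th,
    forall t, pdom th t -> top_vanish (top_order r cl) (annihilator (jetmx th t)),
    (0 < kd)%N -> chi1_is_1 th & kd = 2%N -> chi2_is_t th].
Proof. by have [[[/(counterpartE _ _ r2)[_ H] _] _ _ _ _] _] := Hg; exact: (proj1 (constraintsE r2 _ rth) H). Qed.
Let Kth' : [/\ hat cl -> rhs0 th',
    forall t, pdom th' t -> top_vanish (top_order r cl) (annihilator (jetmx th' t)),
    (0 < kd)%N -> chi1_is_1 th' & kd = 2%N -> chi2_is_t th'].
Proof. by have [[[_ /(counterpartE _ _ r2)[_ H]] _ _ _ _] _] := Hg; exact: (proj1 (constraintsE r2 _ rth') H). Qed.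
Let oO : open O. Proof. by have [[]] := Hg. Qed.
Let dO p : O p -> pdom th p.1 /\ pdom th' (phi p).1.
Proof. by have [[_ _ H _ _] _] := Hg; exact: H. Qed.
Let sphi : smooth_on O phi. Proof. by have [[]] := Hg. Qed.
Let J0 q : O q -> jac phi q != 0.
Proof. by have [[_ _ _ _ H] _] := Hg; exact: H. Qed.
Let map_eq (z : jet F r) : O (jet_base z) -> total_deriv_T phi z != 0 ->
  (on_equation th z <-> on_equation th' (prolong phi z)).
Proof. by move=> Oz Dz; have [_ H] := Hg; apply: H. Qed.

Let T := tcomp phi.
Let X1 := xfactor phi.
(** In the homogeneous classes the constants [c] carry the shift of x; in the others c = 0 and the
    whole shift is a free function of t. *)
Let X0 (q : F * F) : F := if hat cl then 0 else xfactor phi q * xshift phi q.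

Let sT : smooth_on O T := smooth_phi1 oO sphi.
Let sX1 : smooth_on O X1 := smooth_deriv ((0, 1) : F * F) (smooth_phi2 oO sphi).
Let sxi : smooth_on O (xshift phi).
Proof. exact: (smooth_xshift r2 rth rth' oO sphi J0 dO map_eq). Qed.
Let sX0 : smooth_on O X0.
Proof. by rewrite /X0; case: (hat cl); [exact: smooth_cst|exact: smoothM]. Qed.
Let T_0 q : O q -> 'D_(0, 1) T q = 0.
Proof. exact: (T_x0 r2 rth rth' oO sphi J0 dO map_eq). Qed.
Let X1_0 q : O q -> 'D_(0, 1) X1 q = 0.
Proof. exact: (X1_x0 cF aF r2 rth rth' oO sphi J0 dO map_eq). Qed.
Let xi_0 q : O q -> 'D_(0, 1) (xshift phi) q = 0.
Proof. exact: (xi_x0 cF aF r2 rth rth' oO sphi J0 dO map_eq). Qed.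
Let X0_0 q : O q -> 'D_(0, 1) X0 q = 0.
Proof.
move=> Oq; rewrite /X0; case: (hat cl); first by rewrite derivativeC.
rewrite (derivativeM _ (smooth_diff sX1 Oq) (smooth_diff sxi Oq)).
by rewrite [X in _ + X * _]X1_0 // xi_0 // mulr0 mul0r addr0.
Qed.
Let X1_n q : O q -> X1 q != 0.
Proof. exact: (X1_neq0 r2 rth rth' oO sphi J0 dO map_eq). Qed.

Variables (C : F * F -> 'M[F]_r) (c : F * F -> 'rV[F]_r).
Hypothesis c_hat : forall p, ~~ hat cl -> O p -> c p = 0.
Hypothesis Cc : forall p, O p -> \det (C p) != 0 /\ exists d, [/\ 0 < d, box p d `<=` O &
    forall q, box p d q -> [/\ C q = C p, c q = c p,
      forall i, chi th' i (tcomp phi q) = xfactor phi q * \sum_j C p i j * chi th j q.1 &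
      hat cl -> xshift phi q = \sum_j c p ord0 j * chi th j q.1]].

Let near_cst (f : F * F -> F) p : O p ->
  (forall q d, box p d q -> C q = C p -> c q = c p -> f q = f p) -> \forall q \near p, f q = f p.
Proof.
move=> Op H; have [_ [d [d0 _ Hd]]] := Cc Op.
apply: filterS (open_near (open_box (p := p) (d := d)) (box_center _ d0)) => q Bq.
by have [E1 E2 _ _] := Hd q Bq; exact: H Bq E1 E2.
Qed.

Let smooth_locally_cst (f : F * F -> F) :
  (forall p, O p -> \forall q \near p, f q = f p) -> smooth_on O f.
Proof.
move=> H; apply: smooth_local => // p Op.
have /nbhs_ballP[d /= d0 Hd] := H p Op; exists (ball p d); split.
- exact: ball_open.
- exact: ballxx.
- by apply: (@smooth_eq _ _ _ _ (fun=> f p)); [exact: ball_open|move=> q /Hd|exact: smooth_cst].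
Qed.

Let C_cst i j p : O p -> \forall q \near p, C q i j = C p i j.
Proof. by move=> Op; apply: near_cst => // q d _ ->. Qed.
Let c_cst j p : O p -> \forall q \near p, c q ord0 j = c p ord0 j.
Proof. by move=> Op; apply: near_cst => // q d _ _ ->. Qed.
Let sC i j : smooth_on O (fun p => C p i j).
Proof. by apply: smooth_locally_cst => p; exact: C_cst. Qed.
Let sc j : smooth_on O (fun p => c p ord0 j).
Proof. by apply: smooth_locally_cst => p; exact: c_cst. Qed.
Let C_0 i j p v : O p -> 'D_v (fun p => C p i j) p = 0.
Proof.
move=> Op; rewrite -[RHS](@derivativeC F _ F (C p i j) p v); apply: near_eq_derive.
exact: C_cst.
Qed.
Let c_0 j p v : O p -> 'D_v (fun p => c p ord0 j) p = 0.
Proof.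
move=> Op; rewrite -[RHS](@derivativeC F _ F (c p ord0 j) p v); apply: near_eq_derive.
exact: c_cst.
Qed.
Let C_n p : O p -> \det (C p) != 0. Proof. by move=> /Cc[]. Qed.

Definition ext_of_arrow := ExtTrans (dom3 r1 kd O T X1 C) (emap r1 kd T X1 X0 C c).

Lemma ext_of_arrow_diffeo : local_diffeo ext_of_arrow.
Proof. exact: emap_local_diffeo. Qed.

Let clinE i (th1 : param F r) (z : jet F r) : clin C i (lift_jet th1 z) =
  \sum_j C (jet_base z) i j * chi th1 j z.1.
Proof. by apply: eq_bigr => j _; rewrite /ccoord mxE. Qed.

(** On the source tuple the constraints of the target recover X1 and T from the constants: chi~_1 =
    1 gives X1 sum_j C_1j chi_j = 1, and chi~_2 = t gives T. *)
Lemma obtained_ext_of_arrow : obtained_from ext_of_arrow g.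
Proof.
pose W := @jet_base F r @^-1` O; have oW : open W by exact: open_base.
have Wth z : W z -> pdom th z.1 by move=> /dO[].
have rel p : O p -> (forall i, chi th' i (T p) = X1 p * \sum_j C p i j * chi th j p.1) /\
    (hat cl -> xshift phi p = \sum_j c p ord0 j * chi th j p.1).
  move=> Op; have [_ [d [d0 _ /(_ p (box_center _ d0))[_ _ h1 h2]]]] := Cc Op.
  by split.
have [_ _ one tt] := Kth'.
have omE z : W z -> omega r1 kd X1 C (lift_jet th z) = X1 (jet_base z).
  move=> Wz; rewrite /omega; case: (boolP (kd == 0%N)) => // k0; rewrite clinE; set i := Ordinal _.
  have [/(_ i) E1 _] := rel _ Wz; have Xn := X1_n Wz.
  have k1 : (0 < kd)%N by rewrite lt0n.
  have := one k1 i erefl _ (proj2 (dO Wz)).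
  rewrite -[(phi _).1]/(T (jet_base z)) E1 mulrC => H.
  have H' : (\sum_j C (jet_base z) i j * chi th j z.1) * X1 (jet_base z) = 1 := H.
  by apply: (mulIf (invr_neq0 Xn)); rewrite mulfV // -invfM H' invr1.
have yE z i : W z -> ychi r1 kd X1 C i (lift_jet th z) = chi th' i (T (jet_base z)).
  by move=> Wz; rewrite /ychi omE // clinE; have [-> _] := rel _ Wz.
have tE z : W z -> text r1 kd T X1 C (lift_jet th z) = T (jet_base z).
  move=> Wz; rewrite /text; case: eqP => // k2; rewrite yE // tt //.
  exact: (proj2 (dO Wz)).
have d1 z : W z -> dom1 r1 kd O C (lift_jet th z).
  move=> Wz; split=> //; case: (boolP (kd == 0%N)) => [_|k0]; first exact: oner_neq0.
  have := omE z Wz; rewrite /omega (negPf k0) => H.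
  by rewrite -invr_eq0 H X1_n.
have DE z : W z -> Dtext r1 kd T X1 C (lift_jet th z) = total_deriv_T phi z.
  by move=> Wz; apply: (Dtext_lift oO sT sX1 sC rth oW Wth Wz (d1 _ Wz) tE).
have d2 z : W z -> dom2 r1 kd O T X1 C (lift_jet th z).
  move=> Wz; split; first exact: d1.
  by rewrite DE // (Delta_neq0 r2 rth rth' oO sphi J0 dO map_eq).
have xE z : W z -> xext r1 kd X1 X0 C c (lift_jet th z) = xcomp phi (jet_base z).
  move=> Wz; have X1n := X1_n Wz; rewrite /xext omE //.
  have -> : xcomp phi (jet_base z) = X1 (jet_base z) * (z.2 ord0 ord0 + xshift phi (jet_base z)).
    by rewrite /xshift subrKC mulrC divfK.
  rewrite /X0; have [_] := rel _ Wz; case: ifP => [_ /(_ isT) ->|/negbT nh _].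
    rewrite addr0; congr (_ * (_ + _)); apply: eq_bigr => j _.
    by rewrite /ccoord mxE.
  rewrite /ccomb big1 ?addr0 ?mulrDr // => j _.
  by rewrite (c_hat nh Wz) mxE mul0r.
move=> z [Oz Dz]; have H z' : O (jet_base z') -> _ := fun Oz' => _.
apply: (emap_lift kd2 oO sT sX1 sX0 sC sc rth rth' oO dO _ _ _ Oz).
- move=> w Ow; split; first exact: d2.
  + by rewrite tE // xE // -surjective_pairing.
  + by move=> i; rewrite yE.
  have [QE rE] := annihilator_line cF aF r2 rth rth' oO sphi J0 dO map_eq Ow.
  have [d d0 BO] := open_contains_box oO Ow.
  have [Dw ->] := prolong_line cF aF r2 rth rth' oO sphi J0 dO map_eq BO (box_center _ d0).
  rewrite /multiplier omE // DE // Dw.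
  exact: rhs_transform QE rE.
- by move=> k0; have [_ _ h _] := Kth; split; [exact: h|exact: one].
- by move=> k0; have [_ _ _ h] := Kth; split; [exact: h|exact: tt].
Qed.

Let omegaE (q : ext_space F r) : omega r1 kd X1 C q = if kd == 0%N then X1 (ebase q) else (clin C i0 q)^-1.
Proof. by rewrite /omega; case: ifP => // _; congr (clin _ _ _)^-1; exact/val_inj. Qed.

(** For another tuple of the class the constants are frozen at the base point. The resulting
    functions of t define, by [new_arrow], an arrow starting at that tuple, and what remains is that
    its target satisfies the constraints of the class. *)
Lemma ext_of_arrow_group : generalized_equivalence_group S ext_of_arrow.
Proof.
split=> [|th1 z0 S1 dz0 D3]; first exact: ext_of_arrow_diffeo.
have [rth1 K1] := proj1 (counterpartE _ _ r2) S1.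
have [hat1 top1 one1 id1] := proj1 (constraintsE r2 _ rth1) K1.
have [oth1 sch1 W1 sr1] := rth1.
have [[[Op0 n0] Dn0] _] := D3; rewrite -[ebase _]/(jet_base z0) in Op0.
pose p0 := jet_base z0; have [C0 [d [d0 BO Hd]]] := Cc Op0.
pose lin i t := \sum_j C p0 i j * chi th1 j t.
pose X1t t := if kd == 0%N then X1 (t, p0.2) else (lin i0 t)^-1.
pose T1 t := if kd == 2%N then X1t t * lin i1 t else T (t, p0.2).
pose comb t := \sum_j c p0 ord0 j * chi th1 j t.
(* [X0] is added to x~ after multiplication by the factor, hence the division. *)
pose xi t := comb t + X0 (t, p0.2) / X1t t.
pose I0 : set F := interval_ball p0.1 d `&` pdom th1.
have oI0 : open I0 by apply: openI => //; exact: open_interval_ball.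
have I0O t : I0 t -> O (t, p0.2).
  by case=> It _; apply: BO; split=> //=; rewrite subrr normr0.
have sl i : smooth_on I0 (lin i).
  apply: smooth_sum => // j _; apply: smoothM => //; first exact: smooth_cst.
  by apply: smooth_sub (sch1 j) => t [].
pose I1 : set F := [set t | I0 t /\ (if kd == 0%N then 1 else lin i0 t) != 0].
have oI1 : open I1.
  by apply: open_neq0 => //; case: (kd == 0%N); [exact: smooth_cst|exact: sl].
have I10 : I1 `<=` I0 by move=> t [].
have I1O t : I1 t -> O (t, p0.2) by move=> /I10/I0O.
have I1th t : I1 t -> pdom th1 t by move=> /I10[].
have sX1t : smooth_on I1 X1t.
  rewrite /X1t; have [k0|k0] := eqVneq kd 0%N; first exact: smooth_restrict I1O sX1.
  apply: smoothV => //; last exact: smooth_sub I10 (sl i0).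
  by move=> t [_]; rewrite (negPf k0).
have X1tn t : I1 t -> X1t t != 0.
  move=> It; have := It; rewrite /X1t => -[_]; case: (kd == 0%N) => h; first by apply: X1_n; exact: I1O.
  by rewrite invr_eq0.
have sT1 : smooth_on I1 T1.
  rewrite /T1; case: (kd == 2%N); last exact: smooth_restrict I1O sT.
  by apply: smoothM => //; exact: smooth_sub I10 (sl i1).
have scomb : smooth_on I1 comb.
  apply: smooth_sum => // j _; apply: smoothM => //; first exact: smooth_cst.
  exact: smooth_sub I1th (sch1 j).
have sxit : smooth_on I1 xi.
  apply: smoothD => //; apply: smooth_div => //.
  exact: smooth_restrict I1O sX0.
pose B1 : set (F * F) := box p0 d `&` [set q | I1 q.1].
have o1 (I : set F) : open I -> open [set q : F * F | I q.1].
  by move=> oI; apply: open_comp => // q _; exact: cvg_fst.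
have oB1 : open B1 by apply: openI; [exact: open_box|exact: o1].
pose W := @jet_base F r @^-1` B1; have oW : open W by exact: open_base.
have Wth z : W z -> pdom th1 z.1 by move=> [_ /I1th].
have cE z i : W z -> clin C i (lift_jet th1 z) = lin i z.1.
  move=> [/Hd[E1 _ _ _] _]; rewrite clinE E1 //.
have oE z : W z -> omega r1 kd X1 C (lift_jet th1 z) = X1t z.1.
  move=> Wz; rewrite omegaE /X1t cE //; case: (kd == 0%N) => //.
  exact: (box_const cF aF BO sX1 X1_0 (proj1 Wz)).
have yE z i : W z -> ychi r1 kd X1 C i (lift_jet th1 z) = X1t z.1 * lin i z.1.
  by move=> Wz; rewrite /ychi oE // cE.
have tE z : W z -> text r1 kd T X1 C (lift_jet th1 z) = T1 z.1.
  move=> Wz; rewrite /text yE // /T1; case: (kd == 2%N) => //.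
  exact: (box_const cF aF BO sT T_0 (proj1 Wz)).
have xE z : W z -> xext r1 kd X1 X0 C c (lift_jet th1 z) = X1t z.1 * (z.2 ord0 ord0 + xi z.1).
  move=> Wz; have [Bz Iz] := Wz; have [_ Ec _ _] := Hd _ Bz; rewrite /xext oE //.
  have -> : ccomb c (lift_jet th1 z) = comb z.1.
    by apply: eq_bigr => j _; rewrite -[ebase _]/(jet_base z) Ec /ccoord mxE.
  rewrite -[ebase _]/(jet_base z) (box_const cF aF BO sX0 X0_0 Bz) /xi.
  by rewrite !mulrDr [_ * (_ / _)]mulrC divfK ?addrA // X1tn.
have d1 z : W z -> dom1 r1 kd O C (lift_jet th1 z).
  move=> Wz; have [Bz [_ n1]] := Wz; split; first exact: BO.
  case: (boolP (kd == 0%N)) => k0; first exact: oner_neq0.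
  rewrite (negPf k0) in n1; rewrite (_ : Ordinal _ = i0) ?cE //; exact/val_inj.
have DE z : W z -> Dtext r1 kd T X1 C (lift_jet th1 z) = derive1 T1 z.1.
  move=> Wz; rewrite (Dtext_lift oO sT sX1 sC rth1 oW Wth Wz (d1 _ Wz) (tau := fun z => T1 z.1) tE).
  by apply: Lie_fst; exact: smooth_diff sT1 (proj2 Wz).
have Wz0 : W z0.
  split; first exact: box_center.
  split; first by split=> //; rewrite /interval_ball /= subrr normr0.
  move: n0; case: (kd == 0%N) => //; rewrite clinE.
  by rewrite (_ : Ordinal _ = i0) //; exact/val_inj.
pose I2 : set F := [set t | I1 t /\ derive1 T1 t != 0].
have oI2 : open I2 by apply: open_neq0 => //; exact: smooth_derive1.
have I21 : I2 `<=` I1 by move=> t [].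
have I2z0 : I2 z0.1 by split; [exact: (proj2 Wz0)|rewrite -DE].
have s2 (f : F -> F) : smooth_on I1 f -> smooth_on I2 f by exact: smooth_sub.
have [V [th2 [[oV Vz0 VI] [[rth2 dT2 onto2 chi2 rhs2] Hphi]]]] :=
  new_arrow cF aF r0 rth1 oI2 I2z0 (fun t It => I1th t (I21 t It)) (s2 _ sT1)
    (fun t It => proj2 It) (s2 _ sX1t) (fun t It => X1tn t (I21 t It)) (s2 _ sxit) C0.
pose B : set (F * F) := box p0 d `&` [set q | V q.1].
have oB : open B by apply: openI; [exact: open_box|exact: o1].
pose phi2 (q : F * F) : F * F := (T1 q.1, X1t q.1 * (q.2 + xi q.1)).
have [sphi2 J2 eq2] := Hphi B phi2 oB (fun q Bq => conj (proj2 Bq) erefl).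
have BB1 q : B q -> B1 q by move=> [h1 /VI/I21 h2].
have K2 : constraints cl th2.
  apply/(constraintsE r2 _ rth2); split.
  (* Here xi is a solution of the homogeneous source equation, so it contributes nothing to the new
     right-hand side. *)
  - move=> hh s /onto2[t Vt ->]; have It := I21 _ (VI _ Vt).
    have [_ ->] := rhs2 t Vt; rewrite hat1 ?add0r //; last exact: I1th.
    rewrite (jetrow_near r (y' := comb)); last first.
      by apply: filterS (open_near oI1 It) => u _; rewrite /xi /X0 hh mul0r addr0.
    have -> : jetrow r comb t = c p0 *m jetmx th1 t.
      exact: (jetrow_lincomb (c p0) oth1 sch1 (I1th _ It)).
    have Wt : jet_wronskian (jetmx th1 t) != 0 by rewrite jet_wronskianE W1 //; exact: I1th.
    by rewrite -mulmxA (annihilatorP Wt) mulmx0 [X in _ * X]mxE mulr0.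
  - move=> s /onto2[t Vt ->]; have It := I21 _ (VI _ Vt).
    (* For kd > 0 no leading coefficient is constrained. For kd = 0 the functions T1 and X1t are
       those of the given arrow, whose own source and target force the required entries of the last
       column of [Q] to vanish. *)
    case: (posnP kd) => k0; last first.
      have -> : top_order r cl = r by move: k0; rewrite /kd; case: cl.
      by move=> k /leq_ltn_trans H /H; rewrite ltnn.
    have [QE _] := rhs2 t Vt.
    have T1E : T1 = fun t => T (t, p0.2) by apply/funext => u; rewrite /T1 k0.
    have X1E : X1t = fun t => X1 (t, p0.2) by apply/funext => u; rewrite /X1t k0.
    have Ot := I1O _ It.
    have [QE' _] := annihilator_line cF aF r2 rth rth' oO sphi J0 dO map_eq Ot.
    have [_ topg _ _] := Kth; have [_ topg' _ _] := Kth'.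
    have [dt dt'] := dO Ot.
    have Tn : derive1 T1 t != 0 by have [] := VI _ Vt.
    have Xn := X1tn _ It; rewrite -T1E -X1E in QE'.
    have col := top_vanish_column r2 oI1 Tn Xn It (annihilator_max _) QE' (topg _ dt) (topg' _ dt').
    exact: (column_top_vanish r2 oI1 Tn Xn It (annihilator_max _) QE (top1 _ (I1th _ It)) col).
  - move=> k0 i ii s /onto2[t Vt ->]; have [_ n1] := I21 _ (VI _ Vt).
    have -> : i = i0 by exact/val_inj.
    rewrite chi2 // /X1t (gtn_eqF k0) mulVf //.
    by move: n1; rewrite (gtn_eqF k0).
  - move=> k2 i ii s /onto2[t Vt ->].
    have -> : i = i1 by exact/val_inj.
    by rewrite chi2 // /T1 /kd k2.
have V1 (f : F -> F) : smooth_on I1 f -> smooth_on V f by apply: smooth_sub => t /VI/I21.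
have VT t : V t -> derive1 T1 t != 0 by move=> /VI[].
have VX t : V t -> X1t t != 0 by move=> /VI/I21; exact: X1tn.
have prol (z : jet F r) : B (jet_base z) -> total_deriv_T phi2 z = derive1 T1 z.1 /\
    (prolong phi2 z).2 = (z.2 + jetrow r xi z.1) *m prolong_sq r T1 X1t z.1.
  exact: (prolong_affine oV (V1 _ sT1) VT (V1 _ sX1t) r0 oB (fun q Bq => proj2 Bq) (V1 _ sxit) (fun q _ => erefl)).
have dB q : B q -> pdom th1 q.1 /\ pdom th2 (phi2 q).1.
  by move=> Bq; split; [exact/I1th/(proj2 (BB1 _ Bq))|apply: dT2; case: Bq].
have Bn : \forall z \near z0, B (jet_base z).
  apply: open_near; [exact: (open_base oB)|split; [exact: box_center|exact: Vz0]].
exists (Arrow th1 th2 B phi2); split=> //.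
  split; last by move=> z [Bz _]; exact: eq2.
  split=> //; split=> //; exact: (proj2 (counterpartE _ _ r2)).
apply: filterS Bn => z Bz; have [Dz _] := prol z Bz.
split; first by split=> //=; rewrite Dz VT //; case: Bz.
apply: (emap_lift kd2 oO sT sX1 sX0 sC sc rth1 rth2 oB dB _ _ _ Bz).
- move=> w Bw; have Ww : W w by exact: BB1.
  have Vw : V w.1 by case: Bw.
  split.
  + by split; [exact: d1|rewrite DE // VT].
  + by rewrite tE // xE.
  + by move=> i; rewrite yE // chi2.
  have [QE rE] := rhs2 _ Vw; have [_ ->] := prol w Bw.
  by rewrite /multiplier oE // DE //; exact: rhs_transform QE rE.
- by move=> k0; split; [exact: one1|have [_ _ h _] := proj1 (constraintsE r2 _ rth2) K2; exact: h].
- by move=> k0; split; [exact: id1|have [_ _ _ h] := proj1 (constraintsE r2 _ rth2) K2; exact: h].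
Qed.

End Generating.

(** * From the group back to the groupoid, and the theorem *)

Section Groupoid.
Variables (F : numFieldType) (r : nat).

Lemma on_equation_lift (th th' : param F r) z z' :
  lift_jet th z = lift_jet th' z' -> on_equation th z -> on_equation th' z'.
Proof.
move=> [zz' /matrixP J b]; subst z'.
have E i m : (m <= r)%N -> derive1n m (chi th i) z.1 = derive1n m (chi th' i) z.1.
  by move=> mr; have := J i (inord m); rewrite !mxE inordK.
rewrite /on_equation -b; congr (_ / _ = _); congr (\det _); apply/matrixP => i m; rewrite !mxE.
  by case: (unlift _ _) => // k; rewrite E // -ltnS.
by rewrite E // ltnW.
Qed.

(** At each jet the transformation also acts as an arrow of the groupoid with the same source. Both
    arrows send the jet to the same point of the extended space, and that point alone decides
    whether the target equation holds. *)
Lemma groupoid_of_obtained (S : param F r -> Prop) (Phi : ext_trans F r) (g : arrow F r) :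
  generalized_equivalence_group S Phi -> arrow_of S g -> obtained_from Phi g ->
  equivalence_groupoid S g.
Proof.
move=> [_ GP] ag Hg; split=> // z pz; have [dz ez] := Hg z pz.
have [[Ss _] _ dg _ _] := ag.
have [g' [[_ eg'] sg' /nbhs_singleton[pz' [_ ez']]]] := GP _ z Ss (proj1 (dg _ (proj1 pz))) dz.
have := eg' z pz'; rewrite sg' in ez' *; rewrite ez in ez'.
by move=> ->; split; apply: on_equation_lift.
Qed.

End Groupoid.

Theorem proposition27 (R : realType) (F : numFieldType)
    (hF : F = (R : numFieldType) \/ F = (R[i] : numFieldType))
    (r : nat) (hr : (3 <= r)%N) (c : class_name) :
  normalized_generalized_extended
    (@initial_class F r c) (@constraints F r c) /\
  generates_groupoid
    (generalized_extended_equivalence_group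
       (@initial_class F r c) (@constraints F r c))
    (counterpart (@initial_class F r c) (@constraints F r c)).
Proof.
have cF : geometric_complete F by exact: geometric_complete_RC hF.
have aF : dyadic_archi F by exact: dyadic_archi_RC hF.
have N : normalized_generalized (counterpart (@initial_class F r c) (@constraints F r c)).
  move=> g Hg; have [[[Ss St] oO dO sphi J0] eqv] := Hg.
  have [rth K] := proj1 (counterpartE _ _ hr) Ss; have [rth' K'] := proj1 (counterpartE _ _ hr) St.
  have [h _ _ _] := proj1 (constraintsE hr _ rth) K.
  have [h' _ _ _] := proj1 (constraintsE hr _ rth') K'.
  have eqv' (z : jet F r) : pt_dom g (jet_base z) -> total_deriv_T (ptrans g) z != 0 ->
      (on_equation (source g) z <-> on_equation (target g) (prolong (ptrans g) z)).
    by move=> Oz Dz; apply: eqv.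
  have [C [cc [c0 Cc]]] := arrow_constants cF aF hr rth rth' oO sphi J0 dO eqv'
    (fun hh => conj (h hh) (h' hh)).
  exists (ext_of_arrow hr c g C cc).
    exact: (ext_of_arrow_group cF aF hr Hg Cc).
  exact: (obtained_ext_of_arrow cF aF hr Hg c0 Cc).
split=> // g; split=> [Hg|[ag [Phi GPhi Hg]]].
  by split; [case: Hg|exact: N].
exact: groupoid_of_obtained GPhi ag Hg.
Qed.
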